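(* Let $p$ be a monic real polynomial of degree $d\ge 2$ with $p(0)=0$ and $\lambda=p'(0)>1$, and let $f$ be the entire solution of $f(\lambda z)=p(f(z))$ with $f(0)=0$, $f'(0)=1$. Put $\rho=\log_\lambda d$. Assume that $\mathcal{F}_\infty(p)$ contains an angular region $W_{\alpha,\beta}$. (A) Then the following asymptotic expansion for $f$ is valid for all $z\in W_{\alpha,\beta}$ large enough: $$f(z)=\exp\left(z^\rho F(\log_\lambda z)\right)+\sum_{n=0}^\infty c_n\exp\left(-nz^\rho F(\log_\lambda z)\right),$$ where $F$ is a periodic function of period $1$, holomorphic in the strip $$\left\{z\in\mathbb{C}\mid \frac{\alpha}{\log\lambda}<\Im z<\frac{\beta}{\log\lambda}\right\}.$$ Furthermore, $\Re\left(z^\rho F(\log_\lambda z)\right)>0$ for all $z\in W_{\alpha,\beta}$. (B) Let $g$ denote the Böttcher function associated with $p$ at $\infty$, i.e. $(g(z))^d=g(p(z))$ in some neighbourhood of $\infty$. Its inverse function is given by a Laurent series around $\infty$ of the form $$g^{(-1)}(w)=w+\sum_{n=0}^\infty\frac{c_n}{w^n},$$ and with these same coefficients $c_n$ and the function $F$ of (A) we have $$f(z)=g^{(-1)}\left(\exp\left(z^\rho F(\log_\lambda z)\right)\right)$$ (for $z\in W_{\alpha,\beta}$ large enough, as in (A)), and the $c_n$ can be determined from the coefficients of $p$ (they depend only on these coefficients).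
   Context: $\mathcal{F}_\infty(p)=\{z\in\mathbb{C}\mid \lim_{n\to\infty}p^{(n)}(z)=\infty\}$, where $p^{(n)}$ is the $n$-th iterate of $p$. $W_{\alpha,\beta}=\{z\in\mathbb{C}\setminus\{0\}\mid \alpha<\arg z<\beta\}$. The functions $\log_\lambda z=\log z/\log\lambda$ and $z^\rho=\exp(\rho\log z)$ are defined on $W_{\alpha,\beta}$ with $\Im\log z=\arg z\in(\alpha,\beta)$. The Böttcher function $g$ of the monic polynomial $p$ at the super-attracting fixed point $\infty$ is the solution of $(g(z))^d=g(p(z))$ with a Laurent expansion $g(z)=z+\sum_{n\ge0}b_n z^{-n}$ converging for $|z|>R$ for some $R>0$; $g^{(-1)}$ is its inverse function near $\infty$.
   Formalization: In (A) and (B) exp(z^ρ F(log_λ z)) is replaced by ω·exp(z^ρ F(log_λ z)) with ω^(d-1)=1, and ω=1 if W_{α,β} meets the positive real axis; ''z∈W_{α,β} large enough'' is meant uniformly on each smaller sector W_{a,b}, α<a, b<β. *)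

(* Defs.v *)
From HB Require Import structures.
From mathcomp Require Import all_boot all_order all_algebra.
From mathcomp Require Import complex.
From mathcomp Require Import all_classical all_reals all_analysis.
Set Implicit Arguments.
Unset Strict Implicit.
Unset Printing Implicit Defensive.
Import Order.TTheory GRing.Theory Num.Theory.
Import numFieldNormedType.Exports ComplexField.Normc.
Local Open Scope classical_set_scope.
Local Open Scope ring_scope.
Local Open Scope complex_scope.

(* [R[i]] has no canonical topology; its regular module [R[i]^o] carries the
   one given by the modulus, with scalar field [R[i]], so that [derivable]
   and [is_derive] below mean complex differentiability. *)

Definition holomorphic_on (R : realType) (D : set R[i]) (f : R[i] -> R[i]) :=
  forall z, D z -> derivable (f : R[i]^o -> R[i]^o) z 1.

Definition has_cderivative (R : realType) (f : R[i] -> R[i]) (z l : R[i]) :=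
  is_derive (z : R[i]^o) 1 (f : R[i]^o -> R[i]^o) l.

Definition has_csum (R : realType) (u : nat -> R[i]) (s : R[i]) :=
  series (u : nat -> R[i]^o) @ \oo --> (s : R[i]^o).

Definition cexp (R : realType) (z : R[i]) : R[i] :=
  (expR (complex.Re z))%:C *
  (cos (complex.Im z) +i* sin (complex.Im z)).

Definition ceval (R : realType) (p : {poly R}) (z : R[i]) : R[i] :=
  (map_poly (real_complex R) p).[z].

Definition escaping_set (R : realType) (p : {poly R}) : set R[i] :=
  [set z | normc (iter n (ceval p) z) @[n --> \oo] --> +oo].

Definition sector (R : realType) (alpha beta : R) : set R[i] :=
  [set z | exists r theta, [/\ 0 < r, alpha < theta < beta &
                              z = r%:C * (cos theta +i* sin theta)]].

(* The logarithm on the sector with imaginary part in ]alpha, beta[; it is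
   uniquely determined there as soon as [beta - alpha <= 2 * pi]. *)
Definition sector_log (R : realType) (alpha beta : R) (z : R[i]) : R[i] :=
  xget 0 [set l | cexp l = z /\ alpha < complex.Im l < beta].

Definition strip (R : realType) (a b : R) : set R[i] :=
  [set z | a < complex.Im z < b].

(* z |-> z^rho * F (log_lambda z), for the above branch of the logarithm. *)
Definition sector_phase (R : realType) (alpha beta lambda rho : R)
    (F : R[i] -> R[i]) (z : R[i]) : R[i] :=
  let l := sector_log alpha beta z in
  cexp (rho%:C * l) * F (l / (ln lambda)%:C).

(* "For all large z in the sector", uniformly on smaller sectors only: the
   threshold may deteriorate at the two edges. It has to: for
   p = X^2 + 5 X the plane slit along the negative axis escapes, but f has
   arbitrarily large zeros on the slit, and near these the expansion at
   infinity of the inverse Boettcher function diverges. *)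
Definition large_in_sector (R : realType) (alpha beta : R)
    (P : R[i] -> Prop) :=
  forall a b : R, alpha < a -> b < beta ->
    exists M : R, forall z, sector a b z -> M < normc z -> P z.

Definition laurent_at_infty (R : realType) (b : nat -> R[i])
    (g : R[i] -> R[i]) :=
  exists2 M : R, 0 < M &
    forall z, M < normc z -> has_csum (fun n => b n / z ^+ n) (g z - z).

Definition boettcher (R : realType) (d : nat) (p : {poly R})
    (g : R[i] -> R[i]) :=
  (exists b, laurent_at_infty b g) /\
  (exists M : R, forall z, M < normc z -> g z ^+ d = g (ceval p z)).

Definition inverse_at_infty (R : realType) (g h : R[i] -> R[i]) :=
  exists M : R, forall z, M < normc z -> h (g z) = z /\ g (h z) = z.

(* Main.v *)
(* For the inverse Boettcher function h, the equation h (w ^ d) = p (h w) near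
   infinity is a fixed-point equation for the power series of h w / w in 1 / w,
   solved by a contraction in a weighted l^1 norm of coefficients. Any Boettcher function g satisfies g (h w) = w near infinity,
   because q w = g (h w) / w tends to 1 and q (w ^ d) = q w ^ d, and raising to
   the power d expands the distance to 1.

   In the coordinate u = log z the sector is a strip, hence convex. As
   f (lambda ^ - n * z) is asymptotic to lambda ^ - n * z, which stays in the
   sector, f maps the sector into the escaping set; so f (exp u) has no zeros and
   has a logarithm on the strip, and f tends to infinity uniformly on smaller
   sectors. There log (g (f (exp u))) satisfies
   L (u + ln lambda) = d * L u + 2 * pi * i * k with a constant integer k;
   adding 2 * pi * i * k / (d - 1) to L yields Phi with
   Phi (u + ln lambda) = d * Phi u, a relation that extends Phi to the whole
   strip, and F w = Phi (w * ln lambda) * exp (- rho * w * ln lambda) is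
   1-periodic. Phi is holomorphic as a continuous branch of a local inverse of
   h \o exp, applied to f (exp u), so that no Cauchy theory is needed. The added
   constant vanishes modulo 2 * pi * i when the sector meets the positive axis,
   since f is real and positive there. *)
Require Import Defs.
From HB Require Import structures.
From mathcomp Require Import all_boot all_order all_algebra.
From mathcomp Require Import complex.
From mathcomp Require Import all_classical all_reals all_analysis.
From mathcomp Require Import ring lra.
Set Implicit Arguments.
Unset Strict Implicit.
Unset Printing Implicit Defensive.
Import Order.TTheory GRing.Theory Num.Theory.
Import numFieldNormedType.Exports ComplexField.Normc.
Local Open Scope classical_set_scope.
Local Open Scope ring_scope.
Local Open Scope complex_scope.

(** The inverse Boettcher function [h] is built before any Boettcher function. Its approximants are
    real polynomials, so the contraction lives on finite sums in [{poly R}] and needs no complete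
    space of series. The coefficients are limits of real sequences computed from [p] alone, which is
    why [c] can be quantified before all other data.

    Holomorphy of [f] is known only as differentiability at each point, without a Taylor expansion.
    What is usually read off the series, such as realness of [f] on the positive axis, has to come
    from the functional equation and the derivative at 0.

    Two facts about the sector are needed beyond escape. The branch [sector_log] is unique only if
    the opening is at most 2 pi; a wider sector would contain every nonzero point, hence a nonzero
    root of [p], whose orbit ends at the fixed point 0. Uniform escape on closed subsectors comes
    from a compact fundamental domain for multiplication by [lambda], the rectangle [0, ln lambda] x
    [a, b] in the coordinate u = log z. *)

Section ComplexModulus.
Variable R : realType.
Implicit Types (x y z : R[i]).

Lemma normc_ge0 z : 0 <= normc z.
Proof. by rewrite -lecR; exact: (normr_ge0 z). Qed.

Lemma normc_gt0 z : (0 < normc z) = (z != 0).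
Proof. by rewrite -ltcR -[(normc z)%:C]/`|z| normr_gt0. Qed.

Lemma normc_eq0 z : (normc z == 0) = (z == 0).
Proof. by rewrite -[RHS]normr_eq0 -(inj_eq (@complexI R)). Qed.

Lemma normc_le0 z : normc z <= 0 -> z = 0.
Proof.
by move=> h; apply/eqP; rewrite -normc_eq0 eq_le h normc_ge0.
Qed.

Lemma normcD x y : normc (x + y) <= normc x + normc y.
Proof. exact: le_normcD. Qed.

Lemma normcB x y : normc (x - y) <= normc x + normc y.
Proof. by rewrite -(normcN y) normcD. Qed.

Lemma normc_distC x y : normc (x - y) = normc (y - x).
Proof. by rewrite -normcN opprB. Qed.

Lemma normc_triangle z x y : normc (x - y) <= normc (x - z) + normc (z - y).
Proof. by rewrite -[x - y](subrKA z) normcD. Qed.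

Lemma normc_lbB x y : normc x - normc y <= normc (x - y).
Proof. by rewrite lerBlDr (le_trans _ (normcD _ _))// subrK. Qed.

Lemma normc_lbD x y : normc x - normc y <= normc (x + y).
Proof. by rewrite -(normcN y) -[y in leRHS]opprK normc_lbB. Qed.

Lemma normcX z n : normc (z ^+ n) = normc z ^+ n.
Proof. by elim: n => [|n ih]; rewrite ?normc1// !exprS normcM ih. Qed.

Lemma normc_real (r : R) : normc r%:C = `|r|.
Proof. by rewrite /= expr0n /= addr0 sqrtr_sqr. Qed.

Lemma normc_nat n : normc (n%:R : R[i]) = n%:R.
Proof. by rewrite -(rmorph_nat (real_complex R)) normc_real ger0_norm. Qed.

Lemma normc_div x y : normc (x / y) = normc x / normc y.
Proof. by rewrite normcM normcV. Qed.

Lemma normc_sum (I : Type) (s : seq I) (P : pred I) (F : I -> R[i]) :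
  normc (\sum_(i <- s | P i) F i) <= \sum_(i <- s | P i) normc (F i).
Proof.
elim/big_ind2 : _ => //; first by rewrite normc0.
by move=> x1 x2 y1 y2 h1 h2; apply: (le_trans (normcD _ _)); exact: lerD.
Qed.

Lemma Re_le_normc z : `|complex.Re z| <= normc z.
Proof.
by case: z => a b /=; rewrite -sqrtr_sqr ler_wsqrtr// lerDl sqr_ge0.
Qed.

Lemma Im_le_normc z : `|complex.Im z| <= normc z.
Proof.
by case: z => a b /=; rewrite -sqrtr_sqr ler_wsqrtr// lerDr sqr_ge0.
Qed.

Lemma normc_le_ReIm z : normc z <= `|complex.Re z| + `|complex.Im z|.
Proof.
case: z => a b /=; rewrite -[leRHS]ger0_norm ?addr_ge0//.
rewrite -sqrtr_sqr ler_wsqrtr// sqrrD !real_normK ?num_real//.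
by rewrite lerD2r lerDl mulrn_wge0// mulr_ge0.
Qed.

Lemma complex_eq z (a b : R) : z = a +i* b <-> complex.Re z = a /\ complex.Im z = b.
Proof. by case: z => u v; split=> [[]|[/= -> ->]]. Qed.

Lemma complex_eqP x y :
  complex.Re x = complex.Re y -> complex.Im x = complex.Im y -> x = y.
Proof. by case: x => a b; case: y => c d /= -> ->. Qed.

Lemma cReD x y : complex.Re (x + y) = complex.Re x + complex.Re y.
Proof. by case: x => a b; case: y. Qed.
Lemma cImD x y : complex.Im (x + y) = complex.Im x + complex.Im y.
Proof. by case: x => a b; case: y. Qed.
Lemma cReN x : complex.Re (- x) = - complex.Re x.
Proof. by case: x. Qed.
Lemma cImN x : complex.Im (- x) = - complex.Im x.
Proof. by case: x. Qed.
Lemma cReM x y : complex.Re (x * y) =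
  complex.Re x * complex.Re y - complex.Im x * complex.Im y.
Proof. by case: x => a b; case: y. Qed.
Lemma cImM x y : complex.Im (x * y) =
  complex.Re x * complex.Im y + complex.Im x * complex.Re y.
Proof. by case: x => a b; case: y. Qed.
Lemma cReMr (r : R) x : complex.Re (r%:C * x) = r * complex.Re x.
Proof. by rewrite cReM mul0r subr0. Qed.
Lemma cImMr (r : R) x : complex.Im (r%:C * x) = r * complex.Im x.
Proof. by rewrite cImM mul0r addr0. Qed.
Lemma realCM (a b : R) : (a * b)%:C = a%:C * b%:C :> R[i].
Proof. exact: rmorphM. Qed.
Lemma realCD (a b : R) : (a + b)%:C = a%:C + b%:C :> R[i].
Proof. exact: rmorphD. Qed.
Lemma realCX (a : R) n : (a ^+ n)%:C = a%:C ^+ n :> R[i].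
Proof. exact: rmorphXn. Qed.
Lemma realCV (a : R) : (a^-1)%:C = (a%:C)^-1 :> R[i].
Proof. exact: fmorphV. Qed.
Lemma realC_nat n : (n%:R)%:C = n%:R :> R[i].
Proof. exact: rmorph_nat. Qed.
Lemma realC_eq0 (a : R) : (a%:C == 0 :> R[i]) = (a == 0).
Proof. exact: (fmorph_eq0 (real_complex R)). Qed.

End ComplexModulus.

(** * Continuity and complex differentiability by epsilons *)

Section EpsilonDelta.
Variable R : realType.
Implicit Types (f g : R[i] -> R[i]) (z l : R[i]).

(* Continuity and complex differentiability with real epsilons, instead of the
   positive elements of R[i] used by the topology of [R[i]^o]. *)
Definition ccont f z := forall e : R, 0 < e ->
  exists2 d : R, 0 < d &
    forall w, normc (w - z) < d -> normc (f w - f z) < e.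

Definition cder f z l := forall e : R, 0 < e ->
  exists2 d : R, 0 < d & forall w, normc (w - z) < d ->
    normc (f w - f z - l * (w - z)) <= e * normc (w - z).

Lemma nbhs_normcP z (P : set R[i]) :
  (\forall w \near (z : R[i]^o), P w) <->
  exists2 d : R, 0 < d & forall w, normc (w - z) < d -> P w.
Proof.
split.
  (* Positivity in [R[i]] forces a zero imaginary part, so [complex.Re d] is the radius itself. *)
  move=> /nbhs_ballP[d d0 h]; exists (complex.Re d).
    by move: d0; rewrite /= ltcE => /andP[].
  move=> w wz; apply: h; rewrite /ball /= -opprB normrN.
  rewrite -[`|_|]/((normc (w - z))%:C).
  by move: d0; rewrite /= !ltcE /= => /andP[/eqP <- _]; rewrite eqxx.
move=> [d d0 h]; apply/nbhs_ballP; exists d%:C; first by rewrite /= ltcR.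
move=> w; rewrite /ball /= -opprB normrN -[`|_|]/((normc (w - z))%:C) ltcR.
exact: h.
Qed.

Lemma cvg_normcP (T : Type) (F : set_system T) {FF : Filter F}
    (u : T -> R[i]) l :
  (u x @[x --> F] --> (l : R[i]^o)) <->
  forall e : R, 0 < e -> \forall x \near F, normc (u x - l) < e.
Proof.
split.
  move=> ul e e0; have /(_ _)/ul := (nbhs_normcP l [set w | normc (w - l) < e]).2.
  by apply; exists e.
move=> h P /nbhs_normcP[d d0 dP]; apply: filterS (h _ d0) => x; exact: dP.
Qed.

Lemma cderP f z l : has_cderivative f z l <-> cder f z l.
Proof.
have E : (h^-1 *: ((f \o shift z) (h *: (1 : R[i]^o)) - f z)
      @[h --> (0 : R[i]^o)^'] --> (l : R[i]^o)) <-> cder f z l.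
  split.
    move=> /cvg_normcP H e e0; have := H e e0.
    move=> /nbhs_normcP[d d0 dP]; exists d => // w wz.
    have [->|wz0] := eqVneq w z.
      by rewrite !subrr mulr0 subr0 normc0 mulr0.
    have := dP (w - z); rewrite subr0 subr_eq0 => /(_ wz wz0) /=.
    rewrite -[_ *: 1]/((w - z) * 1) mulr1 subrK.
    rewrite -[_ *: _]/((w - z)^-1 * _) => /ltW.
    have wz1 : 0 < normc (w - z) by rewrite normc_gt0 subr_eq0.
    rewrite -(ler_pM2r wz1) -normcM mulrBl mulrAC mulVf ?mul1r//.
    by rewrite subr_eq0.
  move=> H; apply/cvg_normcP => e e0.
  have e20 : 0 < e / 2 by rewrite divr_gt0.
  have [d d0 dP] := H _ e20.
  apply/nbhs_normcP; exists d => // w; rewrite subr0 => wd w0 /=.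
  have w0' : 0 < normc w by rewrite normc_gt0.
  rewrite -[_ *: 1]/(w * 1) mulr1 -[_ *: _]/(w^-1 * _).
  rewrite -(ltr_pM2r w0') -normcM mulrBl mulrAC mulVf// mul1r.
  have := dP (w + z); rewrite addrK => /(_ wd) /le_lt_trans; apply.
  by rewrite ltr_pM2r// ltr_pdivrMr// ltr_pMr// ltr1n.
rewrite -E; split.
  by move=> [/[swap] <-].
by move=> h; apply: DeriveDef; [apply/cvg_ex; exists l|exact: cvg_lim].
Qed.

Lemma has_cder f z : derivable (f : R[i]^o -> R[i]^o) z 1 <-> exists l, cder f z l.
Proof.
split=> [df|[l /cderP[//]]].
by exists ('D_1 (f : R[i]^o -> R[i]^o) z); apply/cderP; apply: DeriveDef.
Qed.

Lemma has_csumP (u : nat -> R[i]) s : has_csum u s <->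
  forall e : R, 0 < e -> exists N, forall n, (N <= n)%N ->
    normc (\sum_(i < n) u i - s) < e.
Proof.
rewrite /has_csum; split.
  move=> /cvg_normcP H e e0; have [N _ NP] := H e e0.
  exists N => n Nn; have := NP n Nn.
  by rewrite /series /= big_mkord.
move=> H; apply/cvg_normcP => e /H[N NP]; exists N => // n /= Nn.
by rewrite /series /= big_mkord; exact: NP.
Qed.

Lemma cder_ccont f z l : cder f z l -> ccont f z.
Proof.
move=> df e e0; have [d d0 dP] := df 1 ltr01.
pose k := 1 + normc l.
have k0 : 0 < k by rewrite ltr_pwDl// normc_ge0.
exists (Num.min d (e / k)); first by rewrite lt_min d0 divr_gt0.
move=> w; rewrite lt_min => /andP[wd we].
rewrite ltr_pdivlMr// in we; apply: le_lt_trans we.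
rewrite -[f w - f z](subrK (l * (w - z))).
apply: (le_trans (normcD _ _)); rewrite normcM [leRHS]mulrC /k mulrDl lerD2r.
exact: dP.
Qed.

Lemma ccont_near f g z (d : R) : 0 < d ->
  (forall w, normc (w - z) < d -> f w = g w) -> ccont f z -> ccont g z.
Proof.
move=> d0 fg cf e e0; have [d' d'0 dP] := cf e e0.
exists (Num.min d d'); first by rewrite lt_min d0.
move=> w; rewrite lt_min => /andP[wd wd'].
by rewrite -!fg ?subrr ?normc0//; exact: dP.
Qed.

Lemma cder_near f g z l (d : R) : 0 < d ->
  (forall w, normc (w - z) < d -> f w = g w) -> cder f z l -> cder g z l.
Proof.
move=> d0 fg cf e e0; have [d' d'0 dP] := cf e e0.
exists (Num.min d d'); first by rewrite lt_min d0.
move=> w; rewrite lt_min => /andP[wd wd'].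
by rewrite -!fg ?subrr ?normc0//; exact: dP.
Qed.

Lemma ccont_comp f g z : ccont f z -> ccont g (f z) -> ccont (fun w => g (f w)) z.
Proof.
move=> cf cg e /cg[d d0 dP]; have [d' d'0 d'P] := cf d d0.
by exists d' => // w /d'P /dP.
Qed.

Lemma ccont_cst (c : R[i]) z : ccont (fun=> c) z.
Proof. by move=> e e0; exists 1 => // w _; rewrite subrr normc0. Qed.

Lemma ccont_id z : ccont id z.
Proof. by move=> e e0; exists e. Qed.

Lemma ccontD f g z : ccont f z -> ccont g z -> ccont (fun w => f w + g w) z.
Proof.
move=> cf cg e e0; have e2 : 0 < e / 2 by rewrite divr_gt0.
have [a a0 aP] := cf _ e2; have [b b0 bP] := cg _ e2.
exists (Num.min a b); first by rewrite lt_min a0.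
move=> w; rewrite lt_min => /andP[/aP A /bP B].
rewrite opprD addrACA (le_lt_trans (normcD _ _))//; lra.
Qed.

Lemma ccontM f g z : ccont f z -> ccont g z -> ccont (fun w => f w * g w) z.
Proof.
move=> cf cg e e0.
have f0 := normc_ge0 (f z); have g0 := normc_ge0 (g z).
pose k := 1 + normc (f z) + normc (g z).
have k0 : 0 < k by rewrite /k; lra.
have ek : 0 < e / k / 2 by rewrite !divr_gt0.
have [a a0 aP] := cf _ ek; have [b b0 bP] := cg _ ek; have [c c0 cP] := cg _ ltr01.
exists (Num.min a (Num.min b c)); first by rewrite !lt_min a0 b0.
move=> w; rewrite !lt_min => /and3P[/aP A /bP B /cP D].
have -> : f w * g w - f z * g z = (f w - f z) * g w + f z * (g w - g z) by ring.
rewrite (le_lt_trans (normcD _ _))// !normcM.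
have gw : normc (g w) <= k.
  rewrite -[g w](subrK (g z)) (le_trans (normcD _ _))// /k; lra.
apply: (@le_lt_trans _ _ (normc (f w - f z) * k + k * normc (g w - g z))).
  rewrite lerD ?ler_wpM2l ?ler_wpM2r ?normc_ge0 ?mulr_ge0// /k; lra.
rewrite [X in X + _]mulrC -mulrDr mulrC -ltr_pdivlMr//; lra.
Qed.

Lemma ccontV z : z != 0 -> ccont GRing.inv z.
Proof.
move=> z0 e e0; have nz : 0 < normc z by rewrite normc_gt0.
exists (Num.min (normc z / 2) (e * normc z ^+ 2 / 2)).
  by rewrite lt_min !divr_gt0// ?mulr_gt0 ?exprn_gt0.
move=> w; rewrite lt_min => /andP[wz we].
have nw : normc z / 2 < normc w.
  by have := normc_lbB z w; rewrite normc_distC; lra.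
have nw0 : 0 < normc w by apply: lt_trans nw; rewrite divr_gt0.
have w0 : w != 0 by rewrite -normc_gt0.
have -> : w^-1 - z^-1 = (z - w) / (w * z) by field; rewrite w0 z0.
rewrite normc_div normcM ltr_pdivrMr ?mulr_gt0// normc_distC (lt_trans we)//.
have nwz : 0 < normc w - normc z / 2 by lra.
by have := mulr_gt0 (mulr_gt0 e0 nz) nwz; rewrite expr2; lra.
Qed.

(** Caratheodory's form of the derivative: a slope function continuous at [z]. It turns the product,
    chain and inverse rules into algebra, with no case distinction at w = z. *)
Lemma cder_slope f z l : cder f z l <->
  exists phi, [/\ ccont phi z, phi z = l &
    exists2 d : R, 0 < d &
      forall w, normc (w - z) < d -> f w - f z = phi w * (w - z)].
Proof.
split.
  move=> df; pose phi w := if w == z then l else (f w - f z) / (w - z).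
  exists phi; split; [|by rewrite /phi eqxx|].
    move=> e e0; have e2 : 0 < e / 2 by rewrite divr_gt0.
    have [d d0 dP] := df _ e2; exists d => // w wd.
    rewrite /phi eqxx; case: eqVneq => [_|wz]; first by rewrite subrr normc0.
    have := dP _ wd; rewrite -subr_eq0 in wz.
    have nz : 0 < normc (w - z) by rewrite normc_gt0.
    have -> : (f w - f z) / (w - z) - l = (f w - f z - l * (w - z)) / (w - z).
      by field.
    by rewrite normc_div -ler_pdivrMr// => /le_lt_trans; apply; lra.
  exists 1 => // w _; rewrite /phi; case: eqVneq => [->|wz].
    by rewrite !subrr mulr0.
  by rewrite divfK// subr_eq0.
move=> [phi [cphi pz [d d0 dP]]] e e0.
have [d' d'0 d'P] := cphi _ e0.
exists (Num.min d d'); first by rewrite lt_min d0.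
move=> w; rewrite lt_min => /andP[/dP -> /d'P /ltW].
by rewrite pz -mulrBl normcM => h; rewrite ler_wpM2r// normc_ge0.
Qed.

Lemma cderD f g z l m : cder f z l -> cder g z m ->
  cder (fun w => f w + g w) z (l + m).
Proof.
move=> /cder_slope[p [cp pz [a a0 aP]]] /cder_slope[q [cq qz [b b0 bP]]].
apply/cder_slope; exists (fun w => p w + q w); split; rewrite ?pz ?qz//.
  exact: ccontD.
exists (Num.min a b); first by rewrite lt_min a0.
move=> w; rewrite lt_min => /andP[/aP A /bP B].
by rewrite opprD addrACA A B mulrDl.
Qed.

Lemma cderM f g z l m : cder f z l -> cder g z m ->
  cder (fun w => f w * g w) z (f z * m + l * g z).
Proof.
move=> df dg; have cf := cder_ccont df.
move: df dg => /cder_slope[p [cp pz [a a0 aP]]] /cder_slope[q [cq qz [b b0 bP]]].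
apply/cder_slope; exists (fun w => f w * q w + p w * g z); split; rewrite ?pz ?qz//.
  by apply: ccontD; apply: ccontM => //; exact: ccont_cst.
exists (Num.min a b); first by rewrite lt_min a0.
move=> w; rewrite lt_min => /andP[/aP A /bP B].
rewrite mulrDl -mulrA -B mulrAC -A; ring.
Qed.

Lemma cder_cst (c : R[i]) z : cder (fun=> c) z 0.
Proof.
apply/cder_slope; exists (fun=> 0); split=> //; first exact: ccont_cst.
by exists 1 => // w _; rewrite subrr mul0r.
Qed.

Lemma cder_id z : cder id z 1.
Proof.
apply/cder_slope; exists (fun=> 1); split=> //; first exact: ccont_cst.
by exists 1 => // w _; rewrite mul1r.
Qed.

Lemma cderMl (c : R[i]) f z l : cder f z l -> cder (fun w => c * f w) z (c * l).
Proof.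
by move=> df; rewrite -[c * l]addr0 -[X in _ + X](mul0r (f z)); apply: cderM (cder_cst _ _) df.
Qed.

Lemma cder_comp f g z l m : cder f z l -> cder g (f z) m ->
  cder (fun w => g (f w)) z (m * l).
Proof.
move=> df dg; have cf := cder_ccont df.
move: df dg => /cder_slope[p [cp pz [a a0 aP]]] /cder_slope[q [cq qz [b b0 bP]]].
have [c c0 cP] := cf _ b0.
apply/cder_slope; exists (fun w => q (f w) * p w); split; rewrite ?pz ?qz//.
  by apply: ccontM => //; exact: ccont_comp.
exists (Num.min a c); first by rewrite lt_min a0.
by move=> w; rewrite lt_min => /andP[/aP A /cP/bP ->]; rewrite A mulrA.
Qed.

Lemma cderV z : z != 0 -> cder GRing.inv z (- z ^- 2).
Proof.
move=> z0; have nz : 0 < normc z by rewrite normc_gt0.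
apply/cder_slope; exists (fun w => - z^-1 * w^-1); split.
- apply: ccontM; [exact: ccont_cst|exact: ccontV].
- by rewrite mulNr expr2 invfM.
- exists (normc z) => // w wz.
  have w0 : w != 0 by apply: contraTneq wz => ->; rewrite sub0r normcN ltxx.
  by field; rewrite w0.
Qed.

(** Stands in for the inverse function theorem: [g] is a branch of the inverse of [f] applied to
    [h], already known to be continuous, and the slope of [f] near [g z] stays away from 0 and can
    be divided out. *)
Lemma cder_inverse f g h z l m (d : R) : m != 0 -> 0 < d ->
  ccont g z -> cder f (g z) m -> cder h z l ->
  (forall w, normc (w - z) < d -> f (g w) = h w) ->
  cder g z (l / m).
Proof.
move=> m0 d0 cg /cder_slope[p [cp pz [a a0 aP]]] /cder_slope[q [cq qz [b b0 bP]]] fg.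
have [c c0 cP] := cg _ a0.
have cpg : ccont (fun w => p (g w)) z by exact: ccont_comp.
have nm0 : 0 < normc m by rewrite normc_gt0.
have [a' a'0 a'P] := cpg _ nm0.
have zz : normc (z - z) < d by rewrite subrr normc0.
apply/cder_slope; exists (fun w => q w * (p (g w))^-1); split; rewrite ?pz ?qz//.
  apply: ccontM => //; apply: (ccont_comp cpg); apply: ccontV; by rewrite pz.
exists (Num.min (Num.min d a') (Num.min b c)); first by rewrite !lt_min d0 a'0 b0.
move=> w; rewrite !lt_min => /andP[/andP[wd /a'P wa]] /andP[/bP B /cP/aP A].
have pw : p (g w) != 0.
  by apply: contraTneq wa => ->; rewrite pz sub0r normcN ltxx.
by rewrite mulrAC -B -!fg// A mulrAC divff// mul1r.
Qed.

End EpsilonDelta.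

(** * The complex exponential, its periods and the principal logarithm *)

Section ComplexExponential.
Variable R : realType.
Implicit Types (x y z l : R[i]).

Lemma cexpD x y : cexp (x + y) = cexp x * cexp y.
Proof.
case: x => a b; case: y => c d; rewrite /cexp /= expRD cosD sinD realCM.
rewrite mulrACA; congr (_ * _).
by apply: complex_eqP => /=; ring.
Qed.

Lemma cexp0 : cexp (0 : R[i]) = 1.
Proof. by rewrite /cexp /= expR0 cos0 sin0 mul1r. Qed.

Lemma normc_cexp z : normc (cexp z) = expR (complex.Re z).
Proof.
rewrite /cexp normcM normc_real ger0_norm ?expR_ge0//.
by rewrite [X in _ * X]/= cos2Dsin2 sqrtr1 mulr1.
Qed.

Lemma cexp_neq0 z : cexp z != 0.
Proof. by rewrite -normc_gt0 normc_cexp expR_gt0. Qed.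

Lemma cexpN z : cexp (- z) = (cexp z)^-1.
Proof.
apply: (mulfI (cexp_neq0 z)); rewrite -cexpD subrr cexp0 divff//.
exact: cexp_neq0.
Qed.

Lemma cexpB x y : cexp (x - y) = cexp x / cexp y.
Proof. by rewrite cexpD cexpN. Qed.

Lemma cexp_natl n z : cexp (n%:R * z) = cexp z ^+ n.
Proof.
elim: n => [|n ih]; first by rewrite mul0r cexp0.
by rewrite mulrSr mulrDl mul1r cexpD ih exprSr.
Qed.

Lemma cexp_real (r : R) : cexp r%:C = (expR r)%:C.
Proof. by rewrite /cexp /= cos0 sin0 mulr1. Qed.

Lemma cexp_ln (r : R) : 0 < r -> cexp (ln r)%:C = r%:C.
Proof. by move=> r0; rewrite cexp_real lnK. Qed.

Lemma is_derive_slope (f : R -> R) (x l : R) : is_derive x 1 f l ->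
  forall e : R, 0 < e -> exists2 d : R, 0 < d & forall y : R, `|y - x| < d ->
    `|f y - f x - l * (y - x)| <= e * `|y - x|.
Proof.
move=> [df fl] e e0.
have : h^-1 *: ((f \o shift x) (h *: (1 : R^o)) - f x)
      @[h --> (0 : R)^'] --> l by rewrite -fl; exact: df.
move=> /cvgrPdist_lt/(_ _ e0); rewrite near_withinE.
move=> /nbhs_ballP[d d0 dP]; exists d => // y yx.
have [->|yx0] := eqVneq y x; first by rewrite !subrr mulr0 subr0 normr0 mulr0.
have := dP (y - x); rewrite /ball /= sub0r normrN subr_eq0 => /(_ yx yx0).
rewrite -[_ *: 1]/((y - x) * 1) mulr1 subrK.
rewrite -[_ *: _]/((y - x)^-1 * _) => /ltW.
have yx1 : 0 < `|y - x| by rewrite normr_gt0 subr_eq0.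
rewrite -(ler_pM2r yx1) -normrM mulrBl mulrAC mulVf ?mul1r ?subr_eq0//.
by rewrite distrC.
Qed.

Lemma cder_cexp0 : cder (@cexp R) 0 1.
Proof.
(* The final estimate spends six shares of [e / 6]: one on [expR u - 1 - u], two each on the cosine
   and sine errors because of the factor [expR u <= 2], and one on the mixed term
   [(expR u - 1) * v]. *)
move=> e e0; have e6 : 0 < e / 6 by rewrite divr_gt0.
have dE := is_derive_expR (0 : R); have dC := is_derive_cos (0 : R).
have dS := is_derive_sin (0 : R).
rewrite expR0 in dE; rewrite sin0 oppr0 in dC; rewrite cos0 in dS.
have [a a0 aP] := is_derive_slope dE e6.
have [a' a'0 a'P] := is_derive_slope dE ltr01.
have [b b0 bP] := is_derive_slope dC e6.
have [c c0 cP] := is_derive_slope dS e6.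
pose d := Num.min (Num.min a a') (Num.min (Num.min b c) (Num.min (1/2) (e / 12))).
exists d; first by rewrite /d !lt_min a0 a'0 b0 c0 !divr_gt0.
move=> w; rewrite subr0 mul1r cexp0 /d !lt_min.
move=> /andP[/andP[wa wa'] /andP[/andP[wb wc] /andP[w2 we]]].
have := Re_le_normc w; have := Im_le_normc w.
have n0 := normc_ge0 w.
case: w wa wa' wb wc w2 we n0 => u v; set N := normc _.
move=> wa wa' wb wc w2 we n0 nv nu.
rewrite [complex.Re _]/= in nu; rewrite [complex.Im _]/= in nv.
have := aP u; have := a'P u; have := bP v; have := cP v.
rewrite !subr0 expR0 cos0 sin0 !mul1r mul0r !subr0.
move=> /(_ (le_lt_trans nv wc)) S1 /(_ (le_lt_trans nv wb)) C1.
move=> /(_ (le_lt_trans nu wa')) E1 /(_ (le_lt_trans nu wa)) E2.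
have E3 : `|expR u - 1| <= 2 * `|u|.
  by rewrite -[_ - 1](subrK u) (le_trans (ler_normD _ _))//; lra.
have E4 : expR u <= 2.
  have := ler_norm (expR u - 1); lra.
have Ep := expR_ge0 u.
apply: (le_trans (normc_le_ReIm _)) => /=.
have -> : expR u * cos v - 0 * sin v + -1 + - u =
  (expR u - 1 - u) + expR u * (cos v - 1) by ring.
have -> : expR u * sin v + 0 * cos v + - 0 - v =
  expR u * (sin v - v) + (expR u - 1) * v by ring.
have A1 : `|expR u * (cos v - 1)| <= 2 * (e / 6 * `|v|).
  by rewrite normrM (ger0_norm Ep) ler_pM.
have A2 : `|expR u * (sin v - v)| <= 2 * (e / 6 * `|v|).
  by rewrite normrM (ger0_norm Ep) ler_pM.
have A3 : `|(expR u - 1) * v| <= e / 6 * N.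
  rewrite normrM ler_pM//; lra.
have A4 : e / 6 * `|v| <= e / 6 * N by rewrite ler_wpM2l// ltW.
have A5 : e / 6 * `|u| <= e / 6 * N by rewrite ler_wpM2l// ltW.
apply: (@le_trans _ _ ((e / 6 * `|u| + 2 * (e / 6 * `|v|)) +
  (2 * (e / 6 * `|v|) + e / 6 * N))).
  by apply: lerD; apply: (le_trans (ler_normD _ _)); exact: lerD.
lra.
Qed.

Lemma cder_cexp z : cder (@cexp R) z (cexp z).
Proof.
have h : cder (fun w => w + - z) z (1 + 0) by apply: cderD; [exact: cder_id|exact: cder_cst].
have := @cder_comp _ _ (@cexp R) z _ 1 h; rewrite subrr => /(_ cder_cexp0).
move=> /(cderMl (cexp z)); rewrite addr0 !mulr1; apply: (@cder_near _ _ _ _ _ 1) => // w _.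
by rewrite -cexpD addrC subrK.
Qed.

Lemma ccont_cexp z : ccont (@cexp R) z.
Proof. exact: cder_ccont (cder_cexp z). Qed.

Lemma periodicz (f : R -> R) (T : R) : periodic f T ->
  forall (m : int) a, f (a + T * m%:~R) = f a.
Proof.
move=> fT [n|n] a; first by rewrite -pmulrn mulr_natr periodicn.
rewrite NegzE mulrNz mulrN -pmulrn mulr_natr.
by rewrite -[in RHS](subrK (T *+ n.+1) a) periodicn.
Qed.

(** After reduction modulo 2 pi to b in [0, 2 pi[, the half-angle formula turns cos b = 1 into sin
    (b / 2) = 0, impossible when b / 2 lies in ]0, pi[. *)
Lemma cos_eq1 (a : R) : cos a = 1 -> exists m : int, a = 2 * pi * m%:~R.
Proof.
move=> ca; have p0 := pi_gt0 R; have pp : (0 : R) < 2 * pi by rewrite mulr_gt0.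
pose m := Num.floor (a / (2 * pi)).
have m1 : m%:~R <= a / (2 * pi) := Num.Theory.floor_le _.
have m2 : a / (2 * pi) < (m + 1)%:~R := Num.Theory.floorD1_gt _.
exists m; rewrite intrD in m2.
rewrite ler_pdivlMr// in m1; rewrite ltr_pdivrMr// in m2.
pose b := a + pi *+ 2 * (- m)%:~R.
have cb : cos b = 1 by rewrite /b periodicz//; exact: cosD2pi.
have bE : b = a - 2 * pi * m%:~R by rewrite /b mulrNz; ring.
suff : b = 0 by rewrite bE => /eqP; rewrite subr_eq0 => /eqP.
have b0 : 0 <= b by rewrite bE; lra.
have b2 : b < 2 * pi by rewrite bE; move: m2; rewrite mulrDl mul1r; lra.
apply: contrapT => /eqP bn0; have {}b0 : 0 < b by rewrite lt_neqAle eq_sym bn0.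
have : 0 < sin (b / 2) by apply: sin_gt0_pi; lra.
have bb : b = (b / 2) *+ 2 by rewrite -[RHS]mulr_natr divfK.
move: cb; rewrite {1}bb cos_mulr2n => cb.
have := cos2Dsin2 (b / 2); rewrite -[_ *+ 2]mulr_natr in cb.
move=> h s0; have : sin (b / 2) ^+ 2 = 0 by lra.
by move=> /eqP; rewrite sqrf_eq0 gt_eqF.
Qed.

Lemma cexp_eq1 z : cexp z = 1 -> exists m : int, z = 0 +i* (2 * pi * m%:~R).
Proof.
move=> ez; have rz : complex.Re z = 0.
  by apply: expR_inj; rewrite -normc_cexp ez normc1 expR0.
have : cos (complex.Im z) = 1.
  by move: ez; rewrite /cexp rz expR0 mul1r => -[].
move=> /cos_eq1[m mE]; exists m; exact/complex_eq.
Qed.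

Lemma cexp_inj_strip x y : cexp x = cexp y ->
  `|complex.Im x - complex.Im y| < 2 * pi -> x = y.
Proof.
move=> exy xy; have : cexp (x - y) = 1 by rewrite cexpB exy divff// cexp_neq0.
move=> /cexp_eq1[m /complex_eq[]]; rewrite cReD cImD cReN cImN => h1 h2.
move: xy; rewrite h2 normrM gtr0_norm ?mulr_gt0 ?pi_gt0//.
rewrite gtr_pMr ?mulr_gt0 ?pi_gt0// -intr_norm -[1]/(1%:~R) ltr_int.
move=> m1; have m0 : m = 0.
  by apply/eqP; rewrite -normr_le0 leNgt gtz0_ge1 -ltNge.
move: h2; rewrite m0 mulr0 => h2.
by apply: complex_eqP; apply/eqP; rewrite -subr_eq0; apply/eqP.
Qed.

Lemma cexp_periodic z (m : int) : cexp (z + (0 +i* (2 * pi * m%:~R))) = cexp z.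
Proof.
rewrite /cexp cReD cImD /= addr0 !(mulrC 2) !mulr_natr.
by rewrite !periodicz//; [exact: sinD2pi|exact: cosD2pi].
Qed.

(* The principal logarithm; only meaningful on the right half-plane. *)
Definition clog z : R[i] :=
  ln (normc z) +i* atan (complex.Im z / complex.Re z).

Lemma Im_clog z : `|complex.Im (clog z)| < pi / 2.
Proof. by rewrite /= ltr_norml atan_gtNpi2 atan_ltpi2. Qed.

Lemma normc_sqr z : normc z ^+ 2 = complex.Re z ^+ 2 + complex.Im z ^+ 2.
Proof. by case: z => a b; rewrite sqr_sqrtr// addr_ge0 ?sqr_ge0. Qed.

Lemma clogK z : 0 < complex.Re z -> cexp (clog z) = z.
Proof.
move=> a0; have nz : 0 < normc z.
  by apply: (lt_le_trans a0); exact: le_trans (ler_norm _) (Re_le_normc z).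
rewrite /cexp /clog [complex.Re (_ +i* _)]/= [complex.Im (_ +i* _)]/= lnK ?posrE//.
set t := complex.Im z / complex.Re z; set th := atan t.
have c0 : 0 < cos th by apply: cos_gt0_pihalf; rewrite atan_gtNpi2 atan_ltpi2.
have st : sin th = t * cos th.
  by rewrite -[t]atanK -/th /tan divfK// gt_eqF.
have := cos2Dsin2 th; rewrite st => cs.
have bt : complex.Im z = t * complex.Re z by rewrite divfK// gt_eqF.
have E : normc z * cos th = complex.Re z.
  apply/eqP; rewrite -(@eqrXn2 _ 2%N)//; [|exact: ltW (mulr_gt0 _ _)|exact: ltW].
  rewrite exprMn normc_sqr bt; apply/eqP.
  by rewrite -[RHS]mul1r -cs; ring.
apply: complex_eqP; first by rewrite cReMr.
by rewrite cImMr /= mulrCA E bt.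
Qed.

Lemma cvg_realP (f : R[i] -> R) z (l : R) :
  f w @[w --> (z : R[i]^o)] --> l <-> forall e : R, 0 < e ->
    exists2 d : R, 0 < d & forall w, normc (w - z) < d -> `|f w - l| < e.
Proof.
split.
  move=> /(@cvgrPdist_lt _ _ _ (nbhs (z : R[i]^o)) _ f l) H e e0.
  have /nbhs_normcP[d d0 dP] := H _ e0.
  by exists d => // w; rewrite distrC; exact: dP.
move=> H; apply/(@cvgrPdist_lt _ _ _ (nbhs (z : R[i]^o)) _ f l) => e e0.
have [d d0 dP] := H _ e0; apply/nbhs_normcP; exists d => // w.
by rewrite distrC; exact: dP.
Qed.

Lemma cvg_Re z : complex.Re w @[w --> (z : R[i]^o)] --> complex.Re z.
Proof.
apply/cvg_realP => e e0; exists e => // w wz.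
apply: le_lt_trans wz; have := Re_le_normc (w - z).
by rewrite cReD cReN.
Qed.

Lemma cvg_Im z : complex.Im w @[w --> (z : R[i]^o)] --> complex.Im z.
Proof.
apply/cvg_realP => e e0; exists e => // w wz.
apply: le_lt_trans wz; have := Im_le_normc (w - z).
by rewrite cImD cImN.
Qed.

Lemma cvg_normc z : normc w @[w --> (z : R[i]^o)] --> normc z.
Proof.
apply/cvg_realP => e e0; exists e => // w wz.
have := normc_lbB z w; have := normc_lbB w z; rewrite (normc_distC z w).
by rewrite ltr_norml => *; apply/andP; split; lra.
Qed.

Lemma ccont_ReIm (f : R[i] -> R[i]) z :
  complex.Re (f w) @[w --> (z : R[i]^o)] --> complex.Re (f z) ->
  complex.Im (f w) @[w --> (z : R[i]^o)] --> complex.Im (f z) -> ccont f z.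
Proof.
move=> cr ci e e0; have e2 : 0 < e / 2 by rewrite divr_gt0.
move/cvg_realP/(_ _ e2): cr => [a a0 aP].
move/cvg_realP/(_ _ e2): ci => [b b0 bP].
exists (Num.min a b); first by rewrite lt_min a0.
move=> w; rewrite lt_min => /andP[/aP A /bP B].
apply: (le_lt_trans (normc_le_ReIm _)); rewrite cReD cImD cReN cImN.
lra.
Qed.

Lemma ccont_clog z : 0 < complex.Re z -> ccont clog z.
Proof.
move=> a0; have nz : 0 < normc z.
  by apply: (lt_le_trans a0); exact: le_trans (ler_norm _) (Re_le_normc z).
apply: ccont_ReIm => /=.
  by apply: (cvg_comp _ _ (@cvg_normc z) (continuous_ln nz)).
apply: (cvg_comp (fun w : R[i]^o => complex.Im w / complex.Re w) (@atan R) _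
  (@continuous_atan R (complex.Im z / complex.Re z))).
have FF := nbhs_filter (z : R[i]^o).
have cRe := @cvgV _ _ _ FF (fun w : R[i] => complex.Re w) _ (lt0r_neq0 a0) (@cvg_Re z).
exact: (@cvgM R _ _ FF (fun w : R[i] => complex.Im w) _ _ _ (@cvg_Im z) cRe).
Qed.

(** All three arguments are below pi / 2 in modulus, so the imaginary parts of the two sides differ
    by less than 3 pi / 2 and no period can intervene. *)
Lemma clogM x y : 0 < complex.Re x -> 0 < complex.Re y ->
  0 < complex.Re (x * y) -> clog (x * y) = clog x + clog y.
Proof.
move=> x0 y0 xy0; apply: cexp_inj_strip; first by rewrite cexpD !clogK.
have := Im_clog x; have := Im_clog y; have := Im_clog (x * y).
rewrite cImD !ltr_norml => /andP[? ?] /andP[? ?] /andP[? ?].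
have := pi_gt0 R; move=> ?; apply/andP; split; lra.
Qed.

Lemma clog1 : clog 1 = 0.
Proof. by rewrite /clog normc1 ln1 /= mul0r atan0. Qed.

Lemma clog_real (r : R) : clog r%:C = (ln `|r|)%:C.
Proof. by rewrite /clog normc_real /= mul0r atan0. Qed.

(** A square root of [z] can be taken in the closed right half-plane. In the open half-plane its
    principal logarithm is doubled; on the boundary [z] is a negative real number. *)
Lemma cexp_surj z : z != 0 -> exists l, cexp l = z.
Proof.
move=> z0; have : exists w, [/\ w ^+ 2 = z & 0 <= complex.Re w].
  have [w0|w0] := leP 0 (complex.Re (sqrtc z)).
    by exists (sqrtc z); rewrite sqr_sqrtc.
  by exists (- sqrtc z); rewrite sqrrN sqr_sqrtc cReN oppr_ge0 ltW.
move=> [w [wz]]; rewrite le_eqVlt => /orP[/eqP w0|w0]; last first.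
  exists (clog w + clog w); by rewrite cexpD !clogK// -expr2.
have zr : z = (- (complex.Im w) ^+ 2)%:C.
  by rewrite -wz expr2; apply: complex_eqP; rewrite (cReM, cImM) -w0 /= ?expr2; ring.
have i0 : 0 < complex.Im w ^+ 2.
  rewrite lt_neqAle sqr_ge0 andbT eq_sym; apply: contra z0.
  by move=> /eqP h; rewrite zr h oppr0.
exists ((ln (complex.Im w ^+ 2))%:C + (0 +i* pi)).
rewrite cexpD cexp_ln// zr /cexp /= expR0 cospi sinpi mul1r.
by apply: complex_eqP => /=; ring.
Qed.

Lemma sectorP (alpha beta : R) z : sector alpha beta z <->
  exists l, cexp l = z /\ alpha < complex.Im l < beta.
Proof.
split=> [[r [th [r0 ab ->]]]|[l [<- lab]]].
  by exists (ln r +i* th); rewrite /cexp /= lnK.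
by exists (expR (complex.Re l)), (complex.Im l); rewrite expR_gt0.
Qed.

End ComplexExponential.

(** * Complex series and absolute convergence *)

Section ComplexSeries.
Variable R : realType.
Implicit Types (u v : nat -> R[i]) (s t z : R[i]).

Lemma has_csum_le u s (B : R) : has_csum u s ->
  (forall n, normc (\sum_(i < n) u i) <= B) -> normc s <= B.
Proof.
move=> /has_csumP us uB; apply/ler_addgt0Pr => e e0.
have [N NP] := us _ e0; have := NP _ (leqnn N) => h.
have := normc_triangle (\sum_(i < N) u i) s 0; rewrite !subr0 normc_distC.
by move: h (uB N); rewrite normc_distC; lra.
Qed.

Lemma has_csum_unique u s t : has_csum u s -> has_csum u t -> s = t.
Proof.
move=> /has_csumP us /has_csumP ut; apply/eqP; rewrite -subr_eq0; apply/eqP.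
apply: normc_le0; apply/ler_addgt0Pr => e e0.
have e2 : 0 < e / 2 by rewrite divr_gt0.
have [N NP] := us _ e2; have [M MP] := ut _ e2.
have := NP _ (leq_maxl N M); have := MP _ (leq_maxr N M).
have := normc_triangle (\sum_(i < maxn N M) u i) s t.
by rewrite (normc_distC s (\sum_(i < _) _)); lra.
Qed.

Lemma has_csumD u v s t : has_csum u s -> has_csum v t ->
  has_csum (fun n => u n + v n) (s + t).
Proof.
move=> /has_csumP us /has_csumP vt; apply/has_csumP => e e0.
have e2 : 0 < e / 2 by rewrite divr_gt0.
have [N NP] := us _ e2; have [M MP] := vt _ e2.
exists (maxn N M) => n; rewrite geq_max => /andP[/NP A /MP B].
by rewrite big_split/= opprD addrACA (le_lt_trans (normcD _ _))//; lra.
Qed.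

Lemma has_csumZ (c : R[i]) u s : has_csum u s -> has_csum (fun n => c * u n) (c * s).
Proof.
move=> /has_csumP us; apply/has_csumP => e e0.
have c1 : 0 < 1 + normc c by rewrite ltr_pwDl// normc_ge0.
have [N NP] := us _ (divr_gt0 e0 c1); exists N => n /NP.
rewrite -mulr_sumr -mulrBr normcM ltr_pdivlMr// => h; apply: le_lt_trans h.
by rewrite mulrC ler_wpM2l ?normc_ge0// lerDr.
Qed.

Lemma has_csumB u v s t : has_csum u s -> has_csum v t ->
  has_csum (fun n => u n - v n) (s - t).
Proof.
move=> us vt; have := has_csumD us (has_csumZ (c := -1) vt).
by under eq_fun do rewrite mulN1r; rewrite mulN1r.
Qed.

Lemma has_csum_real (a : nat -> R) (l : R) : series a @ \oo --> l ->
  forall e : R, 0 < e -> exists N, forall n, (N <= n)%N ->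
    `|\sum_(i < n) a i - l| < e.
Proof.
move=> /cvgrPdist_lt H e /H[N _ NP]; exists N => n Nn.
by have := NP n Nn; rewrite distrC /series /= big_mkord.
Qed.

Lemma cRe_sum (I : Type) (r : seq I) (F : I -> R[i]) :
  complex.Re (\sum_(i <- r) F i) = \sum_(i <- r) complex.Re (F i).
Proof.
by elim: r => [|a r ih]; rewrite ?big_nil// !big_cons cReD ih.
Qed.

Lemma cIm_sum (I : Type) (r : seq I) (F : I -> R[i]) :
  complex.Im (\sum_(i <- r) F i) = \sum_(i <- r) complex.Im (F i).
Proof.
by elim: r => [|a r ih]; rewrite ?big_nil// !big_cons cImD ih.
Qed.

Lemma bounded_normed_series (a : nat -> R) (B : R) :
  (forall n, \sum_(i < n) `|a i| <= B) -> cvgn (series a).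
Proof.
move=> aB; apply: normed_cvg; apply: nondecreasing_is_cvgn.
  apply/nondecreasing_seqP => n.
  by rewrite [leRHS]/series/= big_nat_recr//= lerDl//.
by exists B => _ [n _ <-]; rewrite [leLHS]/series/= big_mkord.
Qed.

Lemma abs_has_csum u (B : R) : (forall n, \sum_(i < n) normc (u i) <= B) ->
  exists2 s, has_csum u s & normc s <= B.
Proof.
move=> uB.
have cr : cvgn (series (fun n => complex.Re (u n))).
  by apply: (@bounded_normed_series _ B) => n; apply: le_trans (uB n); apply: ler_sum => i _; exact: Re_le_normc.
have ci : cvgn (series (fun n => complex.Im (u n))).
  by apply: (@bounded_normed_series _ B) => n; apply: le_trans (uB n); apply: ler_sum => i _; exact: Im_le_normc.
pose s : R[i] := lim (series (fun n => complex.Re (u n)) @ \oo) +i*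
  lim (series (fun n => complex.Im (u n)) @ \oo).
have us : has_csum u s.
  apply/has_csumP => e e0; have e2 : 0 < e / 2 by rewrite divr_gt0.
  have [N NP] := has_csum_real cr e2; have [M MP] := has_csum_real ci e2.
  exists (maxn N M) => n; rewrite geq_max => /andP[/NP A /MP D].
  apply: (le_lt_trans (normc_le_ReIm _)).
  by rewrite cReD cImD cReN cImN cRe_sum cIm_sum /s [complex.Re (_ +i* _)]/= [complex.Im (_ +i* _)]/=; lra.
exists s => //; apply: has_csum_le us _ => n; exact: le_trans (normc_sum _ _ _) _.
Qed.

Definition csum u : R[i] := xget 0 [set s | has_csum u s].

Lemma csumE u s : has_csum u s -> csum u = s.
Proof.
move=> us; rewrite /csum; case: xgetP => [t _ /= ut|/(_ s)//].
exact: has_csum_unique ut us.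
Qed.

Lemma csumP u (B : R) : (forall n, \sum_(i < n) normc (u i) <= B) ->
  has_csum u (csum u).
Proof. by move=> /abs_has_csum[s us _]; rewrite (csumE us). Qed.

Lemma csum_le u (B : R) : (forall n, \sum_(i < n) normc (u i) <= B) ->
  normc (csum u) <= B.
Proof. by move=> /abs_has_csum[s us]; rewrite (csumE us). Qed.

End ComplexSeries.

(** * Power series with a weighted l^1 bound on the coefficients *)

Section PowerSeries.
Variables (R : realType) (y : nat -> R[i]) (r B : R).
Hypotheses (r0 : 0 < r)
  (yB : forall n, \sum_(i < n) normc (y i) * r ^+ i <= B).
Implicit Types (v : R[i]).

Definition powser v : R[i] := csum (fun n => y n * v ^+ n).

(** One majorant for three kinds of series: the powers [v ^+ n], the derivative terms and the
    second-order remainders are all bounded by a multiple of [r ^+ n]. *)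
Lemma powser_terms (a : nat -> R[i]) (k : R) :
  (forall n, normc (a n) <= k * r ^+ n) -> 0 <= k ->
  forall n, \sum_(i < n) normc (y i * a i) <= k * B.
Proof.
move=> ak k0 n; apply: le_trans (ler_wpM2l k0 (yB n)).
rewrite mulr_sumr; apply: ler_sum => i _.
by rewrite normcM mulrCA ler_wpM2l ?normc_ge0.
Qed.

Lemma normc_expr_le v n : normc v <= r -> normc (v ^+ n) <= 1 * r ^+ n.
Proof. by move=> vr; rewrite mul1r normcX lerXn2r ?nnegrE ?normc_ge0 ?(ltW r0). Qed.

Lemma powserP v : normc v <= r -> has_csum (fun n => y n * v ^+ n) (powser v).
Proof.
by move=> vr; apply: csumP (powser_terms (fun n => normc_expr_le n vr) ler01).
Qed.

Lemma powser_le v : normc v <= r -> normc (powser v) <= B.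
Proof.
move=> vr; rewrite -[B]mul1r.
by apply: csum_le (powser_terms (fun n => normc_expr_le n vr) ler01).
Qed.

(** The remainder of order n + 1 is [v] times that of order n plus
    [n * v0 ^ (n - 1) * (v - v0) ^ 2]. The polynomial growth in n is paid for by the factor 2 ^ n,
    and multiplying through by [s ^+ 2] avoids negative powers. *)
Lemma taylor1_term (s : R) v (v0 : R[i]) n : 0 <= s -> normc v <= s -> normc v0 <= s ->
  s ^+ 2 * normc (v ^+ n - v0 ^+ n - n%:R * v0 ^+ n.-1 * (v - v0)) <=
  (2 * s) ^+ n * normc (v - v0) ^+ 2.
Proof.
move=> s0 vs v0s.
elim: n => [|n ih].
  by rewrite !expr0 subrr mul0r mul0r subr0 normc0 mulr0 mul1r exprn_ge0 ?normc_ge0.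
have -> : v ^+ n.+1 - v0 ^+ n.+1 - n.+1%:R * v0 ^+ n * (v - v0) =
  v * (v ^+ n - v0 ^+ n - n%:R * v0 ^+ n.-1 * (v - v0)) +
  n%:R * v0 ^+ n.-1 * (v - v0) ^+ 2.
  case: n {ih} => [|n]; rewrite !exprS ?expr0 -?[n.+1.-1]/n.
    by ring.
  by rewrite -!natr1; ring.
set t := _ - _ - _ in ih *.
have N0 := normc_ge0 (v - v0); have t0 := normc_ge0 t.
have nX : n%:R <= (2 : R) ^+ n.
  by rewrite -natrX ler_nat ltnW// ltn_expl.
have A : s ^+ 2 * normc (n%:R * v0 ^+ n.-1 * (v - v0) ^+ 2) <=
    s * ((2 * s) ^+ n * normc (v - v0) ^+ 2).
  rewrite !normcM !normcX normc_nat.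
  case: n {ih t t0} nX => [|n] nX; first by rewrite !mul0r mulr0 !mulr_ge0// exprn_ge0.
  rewrite [n.+1.-1]/= exprMn.
  have -> : s ^+ 2 * (n.+1%:R * normc v0 ^+ n * normc (v - v0) ^+ 2) =
      n.+1%:R * (s ^+ 2 * normc v0 ^+ n) * normc (v - v0) ^+ 2 by ring.
  have -> : s * (2 ^+ n.+1 * s ^+ n.+1 * normc (v - v0) ^+ 2) =
      2 ^+ n.+1 * (s ^+ 2 * s ^+ n) * normc (v - v0) ^+ 2.
    by rewrite [s ^+ n.+1]exprS; ring.
  rewrite ler_wpM2r ?exprn_ge0//.
  rewrite ler_pM ?mulr_ge0 ?exprn_ge0 ?normc_ge0//.
  by rewrite ler_wpM2l ?exprn_ge0// lerXn2r ?nnegrE ?normc_ge0.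
apply: (@le_trans _ _ (s * ((2 * s) ^+ n * normc (v - v0) ^+ 2) + s * ((2 * s) ^+ n * normc (v - v0) ^+ 2))).
  apply: (@le_trans _ _ (s ^+ 2 * (normc v * normc t) + s ^+ 2 * normc (n%:R * v0 ^+ n.-1 * (v - v0) ^+ 2))).
    by rewrite -mulrDr ler_wpM2l ?exprn_ge0// -normcM normcD.
  rewrite lerD// mulrCA; apply: ler_pM; rewrite ?mulr_ge0 ?normc_ge0 ?exprn_ge0//.
rewrite [(2 * s) ^+ n.+1]exprS le_eqVlt; apply/orP; left; apply/eqP; ring.
Qed.

(** The factor 2 ^ n of [taylor1_term] is absorbed by halving the radius. Because its constants are
    explicit and uniform on the disc, this one estimate yields both differentiability and a
    Lipschitz bound. *)
Lemma powser_taylor1 (s : R) (v0 : R[i]) : 0 < s -> 2 * s <= r -> normc v0 <= s ->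
  exists2 l, normc l <= B / s & forall v, normc v <= s ->
    normc (powser v - powser v0 - l * (v - v0)) <= B / s ^+ 2 * normc (v - v0) ^+ 2.
Proof.
move=> s0 sr v0s; have sr' : s <= r by lra.
have s2r n : (2 * s) ^+ n <= r ^+ n by rewrite lerXn2r ?nnegrE ?mulr_ge0// ltW.
have D n : normc (n%:R * v0 ^+ n.-1) <= s^-1 * r ^+ n.
  case: n => [|n]; first by rewrite mul0r normc0 expr0 mulr1 invr_ge0 ltW.
  rewrite normcM normcX normc_nat ler_pdivlMl// mulrC -mulrA; apply: le_trans (s2r _).
  rewrite exprMn ler_pM ?mulr_ge0 ?exprn_ge0 ?normc_ge0 ?(ltW s0)//.
    by rewrite -natrX ler_nat ltnW// ltn_expl.
  by rewrite exprSr ler_wpM2r ?(ltW s0)// lerXn2r ?nnegrE ?normc_ge0 ?(ltW s0).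
have si0 : 0 <= s^-1 by rewrite invr_ge0 ltW.
pose l := csum (fun n => y n * (n%:R * v0 ^+ n.-1)).
have lB : normc l <= s^-1 * B := csum_le (powser_terms D si0).
have hl : has_csum _ l := csumP (powser_terms D si0).
exists l; first by rewrite mulrC.
move=> v vs.
have hv := powserP (le_trans vs sr'); have hv0 := powserP (le_trans v0s sr').
have := has_csumB (has_csumB hv hv0) (has_csumZ (c := v - v0) hl).
rewrite [(v - v0) * l]mulrC => /has_csum_le; apply => n.
apply: le_trans (normc_sum _ _ _) _.
have T m : normc (v ^+ m - v0 ^+ m - m%:R * v0 ^+ m.-1 * (v - v0)) <=
    (normc (v - v0) ^+ 2 / s ^+ 2) * r ^+ m.
  have := taylor1_term m (ltW s0) vs v0s.
  rewrite mulrC -ler_pdivlMr ?exprn_gt0// => /le_trans; apply.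
  by rewrite -[leLHS]mulrA mulrC ler_wpM2l// divr_ge0 ?exprn_ge0 ?normc_ge0// ltW.
have k0 : 0 <= normc (v - v0) ^+ 2 / s ^+ 2.
  by rewrite divr_ge0 ?exprn_ge0 ?normc_ge0// ltW.
have := powser_terms T k0 n.
have -> : normc (v - v0) ^+ 2 / s ^+ 2 * B = B / s ^+ 2 * normc (v - v0) ^+ 2 by ring.
apply: le_trans; rewrite le_eqVlt; apply/orP; left; apply/eqP.
apply: eq_bigr => i _; congr normc; ring.
Qed.

End PowerSeries.

(** * The weighted l^1 norm on real polynomials *)

Section WeightedNorm.
Variables (R : realType) (r : R).
Hypothesis r0 : 0 < r.
Implicit Types (p q : {poly R}).

Definition pnorm q : R := \sum_(i < size q) `|q`_i| * r ^+ i.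

Lemma pnorm_wide q n : (size q <= n)%N -> pnorm q = \sum_(i < n) `|q`_i| * r ^+ i.
Proof.
move=> qn; rewrite /pnorm (big_ord_widen _ (fun i => `|q`_i| * r ^+ i) qn).
rewrite big_mkcond; apply: eq_bigr => i _; case: ltnP => // h.
by rewrite nth_default// normr0 mul0r.
Qed.

Lemma pnorm_ge0 q : 0 <= pnorm q.
Proof. by apply: sumr_ge0 => i _; rewrite mulr_ge0// exprn_ge0// ltW. Qed.

Lemma pnormD p q : pnorm (p + q) <= pnorm p + pnorm q.
Proof.
have h := size_polyD p q.
rewrite (pnorm_wide h) (pnorm_wide (leq_maxl (size p) (size q))).
rewrite (pnorm_wide (leq_maxr (size p) (size q))) -big_split/=.
apply: ler_sum => i _; rewrite coefD -mulrDl ler_wpM2r ?exprn_ge0 ?(ltW r0)//.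
exact: ler_normD.
Qed.

Lemma pnormZ (c : R) q : pnorm (c *: q) = `|c| * pnorm q.
Proof.
rewrite (pnorm_wide (size_scale_leq c q : (size (c *: q)%R <= size q)%N)) /pnorm mulr_sumr.
by apply: eq_bigr => i _; rewrite coefZ normrM mulrA.
Qed.

Lemma pnormN q : pnorm (- q) = pnorm q.
Proof. by rewrite -scaleN1r pnormZ normrN1 mul1r. Qed.

Lemma pnormB p q : pnorm (p - q) <= pnorm p + pnorm q.
Proof. by rewrite -(pnormN q) pnormD. Qed.

Lemma pnorm0 : pnorm 0 = 0.
Proof. by rewrite /pnorm size_poly0 big_ord0. Qed.

Lemma pnorm1 : pnorm 1 = 1.
Proof. by rewrite /pnorm size_poly1 big_ord1 coef1 normr1 expr0 mulr1. Qed.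

Lemma pnormMX q : pnorm (q * 'X) = pnorm q * r.
Proof.
have h : (size (q * 'X)%R <= (size q).+1)%N.
  by have [->|q0] := eqVneq q 0; rewrite ?mul0r ?size_poly0// size_mulX.
rewrite (pnorm_wide h) big_ord_recl coefMX normr0 mul0r add0r /pnorm mulr_suml.
by apply: eq_bigr => i _; rewrite coefMX/= exprSr mulrA.
Qed.

Lemma pnormMXn q n : pnorm (q * 'X^n) = pnorm q * r ^+ n.
Proof.
by elim: n => [|n ih]; rewrite ?mulr1// !exprSr !mulrA pnormMX ih.
Qed.

Lemma pnorm_sum (I : Type) (s : seq I) (P : pred I) (F : I -> {poly R}) :
  pnorm (\sum_(i <- s | P i) F i) <= \sum_(i <- s | P i) pnorm (F i).
Proof.
elim/big_ind2 : _ => //; first by rewrite pnorm0.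
by move=> x1 x2 y1 y2 h1 h2; apply: (le_trans (pnormD _ _)); exact: lerD.
Qed.

Lemma pnormM p q : pnorm (p * q) <= pnorm p * pnorm q.
Proof.
rewrite -[q in leLHS]coefK poly_def mulr_sumr (le_trans (pnorm_sum _ _ _))//.
rewrite [pnorm q]/pnorm mulr_sumr; apply: ler_sum => i _.
by rewrite -scalerAr pnormZ pnormMXn mulrCA.
Qed.

Lemma pnormX_le p n (k : R) : pnorm p <= k -> pnorm (p ^+ n) <= k ^+ n.
Proof.
move=> pk; elim: n => [|n ih]; first by rewrite !expr0 pnorm1.
by rewrite !exprS (le_trans (pnormM _ _))// ler_pM ?pnorm_ge0.
Qed.

(** The substitution only raises exponents, and larger exponents have smaller weights because r <=
    1. *)
Lemma pnorm_compXn q d : r <= 1 -> (0 < d)%N -> pnorm (q \Po 'X^d) <= pnorm q.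
Proof.
move=> r1 d0; rewrite comp_polyE (le_trans (pnorm_sum _ _ _))// [leRHS]/pnorm.
apply: ler_sum => i _; rewrite pnormZ ler_wpM2l// -exprM.
rewrite -['X^_]mul1r pnormMXn pnorm1 mul1r ler_wiXn2l ?(ltW r0)//.
by rewrite leq_pmull.
Qed.

Lemma pnorm_1D q (k : R) : pnorm q <= k -> pnorm (1 + q) <= 1 + k.
Proof. by move=> qk; rewrite (le_trans (pnormD _ _))// pnorm1 lerD2l. Qed.

(** The polynomial (1 + t) ^ n - 1 has nonnegative coefficients in t, so a submultiplicative norm
    passes inside it. *)
Lemma pnorm_1DX_sub1 q n (k : R) : pnorm q <= k ->
  pnorm ((1 + q) ^+ n - 1) <= (1 + k) ^+ n - 1.
Proof.
move=> qk; elim: n => [|n ih]; first by rewrite !expr0 !subrr pnorm0.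
have -> : (1 + q) ^+ n.+1 - 1 = q * (1 + q) ^+ n + ((1 + q) ^+ n - 1).
  by rewrite exprS; ring.
have -> : (1 + k) ^+ n.+1 - 1 = k * (1 + k) ^+ n + ((1 + k) ^+ n - 1).
  by rewrite exprS; ring.
rewrite (le_trans (pnormD _ _))// lerD// (le_trans (pnormM _ _))// ler_pM ?pnorm_ge0//.
exact/pnormX_le/pnorm_1D.
Qed.

Lemma coef_pnorm q i : `|q`_i| * r ^+ i <= pnorm q.
Proof.
have h : (size q <= (maxn (size q) i.+1))%N by rewrite leq_maxl.
rewrite (pnorm_wide h) (bigD1 (Ordinal (leq_maxr (size q) i.+1)))//= lerDl.
by apply: sumr_ge0 => j _; rewrite mulr_ge0// exprn_ge0// ltW.
Qed.

Lemma sum_coef_pnorm q n : \sum_(i < n) `|q`_i| * r ^+ i <= pnorm q.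
Proof.
have h : (size q <= (maxn (size q) n))%N by rewrite leq_maxl.
rewrite (pnorm_wide h) (big_ord_widen _ (fun i => `|q`_i| * r ^+ i) (leq_maxr (size q) n)).
rewrite big_mkcond; apply: ler_sum => i _; case: ltnP => // _.
by rewrite mulr_ge0// exprn_ge0// ltW.
Qed.

End WeightedNorm.

(** * Evaluation of real polynomials at complex points *)

Section PolyEvaluation.
Variable R : realType.
Implicit Types (p q : {poly R}) (z v : R[i]).

Lemma cevalE p z : ceval p z = \sum_(i < size p) (p`_i)%:C * z ^+ i.
Proof.
rewrite /ceval horner_coef size_map_poly; apply: eq_bigr => i _.
by rewrite coef_map.
Qed.

Lemma ceval_wide p n z : (size p <= n)%N ->
  ceval p z = \sum_(i < n) (p`_i)%:C * z ^+ i.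
Proof.
move=> pn; rewrite cevalE (big_ord_widen _ (fun i => (p`_i)%:C * z ^+ i) pn).
rewrite big_mkcond; apply: eq_bigr => i _; case: ltnP => // h.
by rewrite nth_default// mul0r.
Qed.

Lemma ceval_real p (x : R) : ceval p x%:C = (p.[x])%:C.
Proof. by rewrite /ceval horner_map. Qed.

Lemma cevalD p q z : ceval (p + q) z = ceval p z + ceval q z.
Proof. by rewrite /ceval rmorphD hornerD. Qed.

Lemma cevalB p q z : ceval (p - q) z = ceval p z - ceval q z.
Proof. by rewrite /ceval rmorphB hornerD hornerN. Qed.

Lemma cevalM p q z : ceval (p * q) z = ceval p z * ceval q z.
Proof. by rewrite /ceval rmorphM hornerM. Qed.

Lemma cevalZ (c : R) p z : ceval (c *: p) z = c%:C * ceval p z.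
Proof. by rewrite /ceval map_polyZ hornerZ. Qed.

Lemma ceval1 z : ceval 1 z = 1.
Proof. by rewrite /ceval rmorph1 hornerC. Qed.

Lemma cevalX p n z : ceval (p ^+ n) z = ceval p z ^+ n.
Proof. by rewrite /ceval rmorphXn horner_exp. Qed.

Lemma cevalXn n z : ceval 'X^n z = z ^+ n.
Proof. by rewrite /ceval map_polyXn hornerXn. Qed.

Lemma ceval_comp p q z : ceval (p \Po q) z = ceval p (ceval q z).
Proof. by rewrite /ceval map_comp_poly horner_comp. Qed.

Lemma ceval_sum (I : Type) (s : seq I) (F : I -> {poly R}) z :
  ceval (\sum_(i <- s) F i) z = \sum_(i <- s) ceval (F i) z.
Proof.
elim: s => [|a s ih]; rewrite ?big_nil /ceval ?rmorph0 ?horner0//.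
by rewrite !big_cons -!/(ceval _ _) cevalD ih.
Qed.

Lemma ccont_sum (I : Type) (s : seq I) (F : I -> R[i] -> R[i]) z :
  (forall i, ccont (F i) z) -> ccont (fun w => \sum_(i <- s) F i w) z.
Proof.
move=> h; elim: s => [|i s ih].
  under [X in ccont X _]eq_fun do rewrite big_nil; exact: ccont_cst.
under [X in ccont X _]eq_fun do rewrite big_cons; exact: ccontD.
Qed.

Lemma ccont_exp z n : ccont (fun w => w ^+ n) z.
Proof.
elim: n => [|n ih]; first exact: ccont_cst.
under [X in ccont X _]eq_fun do rewrite exprS.
by apply: ccontM => //; exact: ccont_id.
Qed.

Lemma ceval_conj p z : ceval p (conjc z) = conjc (ceval p z).
Proof.
rewrite !cevalE rmorph_sum; apply: eq_bigr => i _.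
by rewrite rmorphM rmorphXn /= oppr0.
Qed.

Lemma exp1D_le (a : R) k : 0 <= a -> 2 * k%:R * a <= 1 -> (1 + a) ^+ k <= 1 + 2 * k%:R * a.
Proof.
move=> a0; elim: k => [|k ih]; first by rewrite mulr0 mul0r addr0.
rewrite -natr1 => ka; have kpos : 0 <= (k%:R : R) by [].
have ka' : 2 * k%:R * a <= 1 by lra.
rewrite exprS; apply: (@le_trans _ _ ((1 + a) * (1 + 2 * k%:R * a))).
  by rewrite ler_wpM2l ?ih//; lra.
have : 2 * k%:R * a * a <= 1 * a by rewrite ler_wpM2r.
lra.
Qed.

End PolyEvaluation.

(** * Polynomial approximations of the inverse Boettcher series *)

Section BoettcherIteration.
Variables (R : realType) (p : {poly R}).
Let d := (size p).-1.
Implicit Types (x y : {poly R}).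

(* Write h w = w * (1 + X (1 / w)) for the inverse Boettcher function. With
   v = 1 / w, the equation h (w ^ d) = p (h w) reads
   1 + X (v ^ d) = \sum_j p_j v ^ (d - j) (1 + X v) ^ j.
   [boettcher_step] is the simplified Newton iteration for it. *)
Definition boettcher_poly x : {poly R} :=
  \sum_(j < d.+1) p`_j *: ('X^(d - j) * (1 + x) ^+ j).

Definition boettcher_step x : {poly R} :=
  x + d%:R^-1 *: (1 + (x \Po 'X^d) - boettcher_poly x).

Definition boettcher_iter N : {poly R} := iter N boettcher_step 0.

Hypotheses (pm : p \is monic) (d2 : (2 <= d)%N).

Lemma monic_coef_degree : p`_d = 1.
Proof. exact: monicP pm. Qed.

Let d0 : (0 < d)%N. Proof. exact: ltnW. Qed.
Let dR : 0 < d%:R :> R. Proof. by rewrite ltr0n. Qed.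

(** At 0 only the term j = d of [boettcher_poly] survives. The vanishing constant term is what keeps
    [h w - w] bounded near infinity: its expansion starts with a constant. *)
Lemma boettcher_iter_coef0 N : (boettcher_iter N)`_0 = 0.
Proof.
elim: N => [|N ih]; first by rewrite coef0.
rewrite /boettcher_iter iterS -/(boettcher_iter N) /boettcher_step.
move: (boettcher_iter N) ih => x; rewrite -!horner_coef0 => x0.
rewrite hornerD hornerZ hornerD hornerN hornerD x0 add0r hornerC horner_comp hornerXn.
rewrite expr0n eqn0Ngt d0 x0 addr0 /boettcher_poly big_ord_recr/= hornerD.
rewrite horner_sum big1 ?add0r => [|i _].
  rewrite hornerZ hornerM subnn hornerXn expr0 mul1r monic_coef_degree.
  by rewrite horner_exp hornerD hornerC x0 addr0 expr1n mulr1 subrr mulr0.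
rewrite hornerZ hornerM hornerXn expr0n subn_eq0 leqNgt ltn_ord mul0r mulr0 //.
Qed.

Let C := \sum_(j < d) `|p`_j|.
Let C0 : 0 <= C. Proof. exact: sumr_ge0. Qed.

(** In the ball of radius [delta], the powers [(1 + x) ^+ k] with k <= d stay within 1 / 8 of 1. The
    weight [r] is then taken so small that the lower coefficients of [p], of total modulus [C], only
    count for [C * r <= delta / 16]. *)
Definition boettcher_delta : R := (16 * d%:R)^-1.
Definition boettcher_radius : R := boettcher_delta / (16 * (1 + C)).
Let delta := boettcher_delta.
Let r := boettcher_radius.

Let delta0 : 0 < delta. Proof. by rewrite invr_gt0 mulr_gt0. Qed.

Lemma boettcher_radius_gt0 : 0 < r.
Proof. by rewrite divr_gt0// mulr_gt0// ltr_pwDl. Qed.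
Let r0 := boettcher_radius_gt0.

Let delta_d : delta * d%:R = 1 / 16.
Proof. by rewrite /delta /boettcher_delta; field; rewrite gt_eqF. Qed.

Let Cr : C * r <= delta / 16 /\ r <= delta / 16.
Proof.
have h : (1 + C) * r = delta / 16.
  by rewrite /r /boettcher_radius -/delta; field; rewrite gt_eqF// ltr_pwDl.
have := mulr_ge0 C0 (ltW r0); have := r0; rewrite -h; split; lra.
Qed.

Let delta1 : delta <= 1.
Proof. by rewrite invf_le1 ?mulr_gt0// -natrM ler1n muln_gt0. Qed.

Lemma boettcher_radius_le1 : r <= 1.
Proof. by have := Cr.2; have := delta1; lra. Qed.
Let r1 := boettcher_radius_le1.

Let powD k : (k <= d)%N -> (1 + delta) ^+ k <= 9 / 8.
Proof.
move=> kd; have kd' : k%:R * delta <= 1 / 16.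
  by rewrite -delta_d mulrC ler_wpM2l ?ler_nat// ltW.
by apply: (le_trans (exp1D_le (ltW delta0) _)); rewrite -(mulrA 2); lra.
Qed.

Let nrm := @pnorm R r.


Let pnorm_1DX_le x k : nrm x <= delta -> (k <= d)%N -> nrm ((1 + x) ^+ k) <= (1 + delta) ^+ k.
Proof. by move=> xd kd; apply: pnormX_le => //; exact: pnorm_1D. Qed.

Let pnorm_mul_1DX x y a b : nrm x <= delta -> nrm y <= delta -> (a + b <= d)%N ->
  nrm ((1 + x) ^+ a * (1 + y) ^+ b - 1) <= 1 / 8.
Proof.
move=> xd yd abd.
have bd : (b <= d)%N by apply: leq_trans abd; exact: leq_addl.
have -> : (1 + x) ^+ a * (1 + y) ^+ b - 1 =
  ((1 + x) ^+ a - 1) * (1 + y) ^+ b + ((1 + y) ^+ b - 1) by ring.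
have h := powD abd; rewrite exprD in h.
have h1 := pnorm_1DX_sub1 r0 a xd; have h2 := pnorm_1DX_sub1 r0 b yd.
have h3 := pnorm_1DX_le yd bd.
apply: (@le_trans _ _ (((1 + delta) ^+ a - 1) * (1 + delta) ^+ b + ((1 + delta) ^+ b - 1))).
  rewrite (le_trans (pnormD _ _ _))// lerD// (le_trans (pnormM _ _ _))//.
  by rewrite ler_pM ?pnorm_ge0.
lra.
Qed.

Let pnorm_subX x y k : nrm x <= delta -> nrm y <= delta -> (k <= d)%N ->
  nrm ((1 + x) ^+ k - (1 + y) ^+ k) <= nrm (x - y) * (d%:R * (9 / 8)).
Proof.
move=> xd yd kd; rewrite subrXX (_ : 1 + x - (1 + y) = x - y); last by ring.
rewrite (le_trans (pnormM r0 _ _))// ler_wpM2l ?pnorm_ge0//.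
apply: (le_trans (pnorm_sum r0 _ _ _)).
apply: (@le_trans _ _ (\sum_(i < k) (9 / 8 : R))).
  apply: ler_sum => i _.
  have h : (k.-1 - i + i <= d)%N.
    by rewrite subnK ?(leq_trans (leq_pred k))// -ltnS prednK ?ltn_ord// (leq_ltn_trans _ (ltn_ord i)).
  have := pnorm_mul_1DX xd yd h.
  have := pnormD r0 ((1 + x) ^+ (k.-1 - i) * (1 + y) ^+ i - 1) 1.
  by rewrite subrK pnorm1 /nrm; lra.
by rewrite sumr_const card_ord -[leLHS]mulr_natl ler_wpM2r// ?ler_nat//; lra.
Qed.

Let pnorm_linear x y : nrm x <= delta -> nrm y <= delta ->
  nrm (d%:R *: (x - y) - ((1 + x) ^+ d - (1 + y) ^+ d)) <= nrm (x - y) * (d%:R / 8).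
Proof.
move=> xd yd; rewrite subrXX (_ : 1 + x - (1 + y) = x - y); last by ring.
have -> : d%:R *: (x - y) - (x - y) * (\sum_(i < d) (1 + x) ^+ (d.-1 - i) * (1 + y) ^+ i) =
   - ((x - y) * (\sum_(i < d) ((1 + x) ^+ (d.-1 - i) * (1 + y) ^+ i - 1))).
  rewrite sumrB sumr_const card_ord scaler_nat; ring.
rewrite /nrm pnormN (le_trans (pnormM r0 _ _))// ler_wpM2l ?pnorm_ge0//.
apply: (le_trans (pnorm_sum r0 _ _ _)).
apply: (@le_trans _ _ (\sum_(i < d) (1 / 8 : R))).
  apply: ler_sum => i _; apply: pnorm_mul_1DX => //.
  by rewrite subnK ?leq_pred// -ltnS prednK.
by rewrite sumr_const card_ord -[leLHS]mulr_natl; lra.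
Qed.

Let pnorm_lower x y : nrm x <= delta -> nrm y <= delta ->
  nrm (\sum_(j < d) p`_j *: ('X^(d - j) * ((1 + x) ^+ j - (1 + y) ^+ j))) <=
  nrm (x - y) * (d%:R / 64).
Proof.
move=> xd yd; apply: (le_trans (pnorm_sum r0 _ _ _)).
apply: (@le_trans _ _ (\sum_(j < d) `|p`_j| * (r * (nrm (x - y) * (d%:R * (9 / 8)))))).
  apply: ler_sum => j _; rewrite pnormZ ler_wpM2l// mulrC pnormMXn// mulrC.
  rewrite ler_pM ?exprn_ge0 ?pnorm_ge0 ?(ltW r0)//.
    by rewrite -[leRHS]expr1 ler_wiXn2l// ?subn_gt0// ltW.
  by apply: pnorm_subX => //; exact: ltnW.
rewrite -mulr_suml -/C.
have h := Cr.1; have n0 := pnorm_ge0 r0 (x - y).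
have -> : C * (r * (nrm (x - y) * (d%:R * (9 / 8)))) =
  nrm (x - y) * (d%:R * (C * r * (9 / 8))) by ring.
rewrite ler_wpM2l// ler_wpM2l ?(ltW dR)//.
have hd : delta * 2 <= delta * d%:R by rewrite ler_wpM2l ?ler_nat// ltW.
by have := delta_d; lra.
Qed.

(** Before the division by d, three errors occur: d / 8 from linearizing [(1 + x) ^+ d], 1 from the
    substitution of 'X^d, and d / 64 from the lower terms of [p]. Dividing by d >= 2 leaves at most
    1 / 8 + 1 / 2 + 1 / 64 < 3 / 4. *)
Lemma boettcher_step_lip x y : nrm x <= delta -> nrm y <= delta ->
  nrm (boettcher_step x - boettcher_step y) <= 3 / 4 * nrm (x - y).
Proof.
move=> xd yd.
pose A := d%:R *: (x - y) - ((1 + x) ^+ d - (1 + y) ^+ d).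
pose L := \sum_(j < d) p`_j *: ('X^(d - j) * ((1 + x) ^+ j - (1 + y) ^+ j)).
have -> : boettcher_step x - boettcher_step y =
    d%:R^-1 *: (A + (((x - y) \Po 'X^d) - L)).
  have bE : boettcher_poly x - boettcher_poly y = L + ((1 + x) ^+ d - (1 + y) ^+ d).
    rewrite /boettcher_poly -sumrB big_ord_recr/= subnn expr0 !mul1r monic_coef_degree !scale1r.
    by congr (_ + _); apply: eq_bigr => j _; rewrite -scalerBr -mulrBr.
  have -> : A + (((x - y) \Po 'X^d) - L) =
     d%:R *: (x - y) + (((x - y) \Po 'X^d) - (boettcher_poly x - boettcher_poly y)).
    by rewrite bE /A; ring.
  rewrite scalerDr scalerA mulVf ?gt_eqF// scale1r comp_polyB /boettcher_step.
  rewrite opprD addrACA -scalerBr; congr (_ + _ *: _); ring.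
rewrite /nrm pnormZ ger0_norm ?invr_ge0 ?(ltW dR)// ler_pdivrMl//.
have hA := pnorm_linear xd yd; have hL := pnorm_lower xd yd.
have hX := pnorm_compXn r0 (x - y) r1 d0.
have hd : 2 <= d%:R :> R by rewrite ler_nat.
have n0 := pnorm_ge0 r0 (x - y).
have h1 : 2 * nrm (x - y) <= d%:R * nrm (x - y) by rewrite ler_wpM2r.
apply: (le_trans (pnormD r0 _ _)).
apply: (le_trans (lerD (lexx _) (pnormB r0 _ _))).
by move: hA hL hX h1; rewrite /nrm -/A -/L; lra.
Qed.

Lemma boettcher_step0 : nrm (boettcher_step 0) <= delta / 4.
Proof.
have -> : boettcher_step 0 = - (d%:R^-1 *: (\sum_(j < d) p`_j *: 'X^(d - j))).
  rewrite /boettcher_step /boettcher_poly big_ord_recr/= comp_poly0 addr0 add0r.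
  rewrite subnn expr0 expr1n mulr1 monic_coef_degree scale1r.
  under eq_bigr do rewrite expr1n mulr1.
  by rewrite opprD addrCA subrr addr0 scalerN.
rewrite /nrm pnormN pnormZ ger0_norm ?invr_ge0 ?(ltW dR)// ler_pdivrMl//.
apply: (le_trans (pnorm_sum r0 _ _ _)).
apply: (@le_trans _ _ (\sum_(j < d) `|p`_j| * r)).
  apply: ler_sum => j _; rewrite pnormZ ler_wpM2l// -['X^_]mul1r pnormMXn// pnorm1 mul1r.
  by rewrite -[leRHS]expr1 ler_wiXn2l// ?subn_gt0// ltW.
rewrite -mulr_suml -/C.
have hd : 2 * delta <= d%:R * delta by rewrite ler_wpM2r ?ler_nat// ltW.
by have := Cr.1; have := delta0; lra.
Qed.

(** The ball is invariant because the contraction factor 3 / 4 and the share 1 / 4 taken by the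
    image of 0 add up to 1. *)
Lemma boettcher_iter_le N : nrm (boettcher_iter N) <= delta.
Proof.
elim: N => [|N ih]; first by rewrite /nrm pnorm0 ltW.
rewrite /boettcher_iter iterS -/(boettcher_iter N).
rewrite -[boettcher_step _](subrK (boettcher_step 0)).
apply: (le_trans (pnormD r0 _ _)).
have h0 : nrm 0 <= delta by rewrite /nrm pnorm0 ltW.
have := boettcher_step_lip ih h0; have := boettcher_step0.
by rewrite subr0 /nrm in ih *; lra.
Qed.

Lemma boettcher_iter_succ N :
  nrm (boettcher_iter N.+1 - boettcher_iter N) <= delta / 4 * (3 / 4) ^+ N.
Proof.
elim: N => [|N ih].
  by rewrite expr0 mulr1 [boettcher_iter 0]/= subr0; exact: boettcher_step0.
have := boettcher_step_lip (boettcher_iter_le N.+1) (boettcher_iter_le N).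
by move=> /le_trans; apply; rewrite exprS; lra.
Qed.

Lemma boettcher_iter_cauchy N k :
  nrm (boettcher_iter (N + k) - boettcher_iter N) <= delta * (3 / 4) ^+ N.
Proof.
(* The exact partial sum of the geometric series is what the induction on [k] can carry. *)
suff : nrm (boettcher_iter (N + k) - boettcher_iter N) <=
    delta * (3 / 4) ^+ N * (1 - (3 / 4) ^+ k).
  have q34 : 0 < 3 / 4 :> R by lra.
  have q0 : 0 <= ((3 / 4) : R) ^+ k by rewrite exprn_ge0// ltW.
  have p0 : 0 < delta * (3 / 4) ^+ N by rewrite mulr_gt0// exprn_gt0.
  by move=> /le_trans; apply; rewrite ger_pMr//; lra.
elim: k => [|k ih]; first by rewrite addn0 subrr /nrm pnorm0 expr0 subrr mulr0.
rewrite addnS -[X in nrm X](subrKA (boettcher_iter (N + k))).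
apply: (le_trans (pnormD r0 _ _)).
have := boettcher_iter_succ (N + k); rewrite exprD [in X in _ -> X]exprS.
by move: ih; rewrite /nrm; lra.
Qed.

End BoettcherIteration.

(** A total function of [p], so that the coefficients can be named before any assumption on [p]; the
    limit exists by [boettcher_coef_cvg] when [p] is monic of degree at least 2. *)
Definition boettcher_coef (R : realType) (p : {poly R}) (i : nat) : R :=
  lim ((boettcher_iter p N)`_i @[N --> \oo]).

(** * The limit series and its functional equation *)

Section InverseBoettcher.
Variables (R : realType) (p : {poly R}).
Let d := (size p).-1.
Hypotheses (pm : p \is monic) (d2 : (2 <= d)%N).
Let r := boettcher_radius p.
Let delta := boettcher_delta p.
Let x N := boettcher_iter p N.
Let e i := boettcher_coef p i.
Let r0 : 0 < r. Proof. exact: boettcher_radius_gt0. Qed.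
Let r1 : r <= 1. Proof. exact: boettcher_radius_le1. Qed.
Let delta0 : 0 < delta.
Proof. by rewrite invr_gt0 mulr_gt0// ltr0n ltnW. Qed.

Let geometric_le n : \sum_(k < n) (3 / 4) ^+ k <= 4 :> R.
Proof.
have q34 : 0 <= 3 / 4 :> R by lra.
suff -> : \sum_(k < n) (3 / 4) ^+ k = 4 * (1 - (3 / 4) ^+ n) :> R.
  by have := exprn_ge0 n q34; lra.
elim: n => [|n ih]; first by rewrite big_ord0 expr0 subrr mulr0.
by rewrite big_ord_recr/= ih exprS; lra.
Qed.

Lemma boettcher_coef_cvg i : (x N)`_i @[N --> \oo] --> e i.
Proof.
have ri : 0 < r ^+ i by rewrite exprn_gt0.
suff : cvgn (series (fun k => (x k.+1)`_i - (x k)`_i)).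
  rewrite (_ : series _ = fun N => (x N)`_i)//.
  apply/funext => n; rewrite /series /= telescope_sumr//.
  by rewrite [x 0]/= coef0 subr0.
apply: (@bounded_normed_series _ _ (delta / r ^+ i)) => n.
rewrite ler_pdivlMr// mulr_suml.
apply: (@le_trans _ _ (\sum_(k < n) delta / 4 * (3 / 4) ^+ k)).
  apply: ler_sum => k _; apply: le_trans (boettcher_iter_succ pm d2 k).
  by rewrite -coefB; exact: coef_pnorm.
by rewrite -mulr_sumr; have := geometric_le n; have := delta0; nra.
Qed.

(** Cutting at [K] coefficients makes the limit M -> oo of the Cauchy bound a limit of finite sums;
    the bound does not depend on [K], so it passes to the whole series. *)
Lemma boettcher_coef_dist N K :
  \sum_(i < K) `|(x N)`_i - e i| * r ^+ i <= delta * (3 / 4) ^+ N.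
Proof.
have : \sum_(i < K) `|(x N)`_i - (x M)`_i| * r ^+ i @[M --> \oo] -->
    \sum_(i < K) `|(x N)`_i - e i| * r ^+ i.
  elim: K => [|K ih].
    by under eq_fun do rewrite big_ord0; rewrite big_ord0; exact: cvg_cst.
  under eq_fun do rewrite big_ord_recr/=; rewrite big_ord_recr/=.
  apply: cvgD => //; apply: cvgMr_tmp; apply: cvg_norm; apply: cvgB.
    exact: cvg_cst.
  exact: boettcher_coef_cvg.
move=> h; rewrite -(cvg_lim _ h)//; apply: limr_le; first by apply/cvg_ex; eexists; exact: h.
exists N => // M /= NM; rewrite -(subnKC NM).
apply: le_trans (boettcher_iter_cauchy pm d2 N (M - N)).
under eq_bigr do rewrite distrC -coefB.
exact: sum_coef_pnorm.
Qed.

Lemma boettcher_coef_le K : \sum_(i < K) `|e i| * r ^+ i <= delta.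
Proof.
have := boettcher_coef_dist 0 K; rewrite expr0 mulr1; apply: le_trans.
apply: ler_sum => i _.
by have -> : x 0%N = 0 by []; rewrite coef0 sub0r normrN.
Qed.

Lemma boettcher_coef0 : e 0 = 0.
Proof.
have := @boettcher_coef_cvg 0; under eq_fun do rewrite (boettcher_iter_coef0 pm d2).
by move=> /cvg_lim <-//; rewrite lim_cst.
Qed.

Let c n : R[i] := (e n.+1)%:C.

Lemma inv_boettcher_coef_le K : \sum_(i < K) normc (c i) * r ^+ i <= delta / r.
Proof.
rewrite ler_pdivlMr//; apply: le_trans (boettcher_coef_le K.+1).
rewrite mulr_suml big_ord_recl boettcher_coef0 normr0 mul0r add0r.
by apply: ler_sum => i _; rewrite normc_real -mulrA -exprSr.
Qed.

Let X (v : R[i]) := v * powser c v.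

Let X_csum v : normc v <= r -> has_csum (fun n => (e n)%:C * v ^+ n) (X v).
Proof.
move=> vr; have /has_csumP H := powserP r0 inv_boettcher_coef_le vr.
apply/has_csumP => t t0; have v1 : 0 < 1 + normc v by rewrite ltr_pwDl// normc_ge0.
have [N NP] := H _ (divr_gt0 t0 v1).
exists N.+1 => -[//|n] /NP; rewrite ltr_pdivlMr// => h.
rewrite big_ord_recl boettcher_coef0 mul0r add0r.
have -> : \sum_(i < n) (e (bump 0 i))%:C * v ^+ bump 0 i = v * \sum_(i < n) c i * v ^+ i.
  by rewrite mulr_sumr; apply: eq_bigr => i _; rewrite exprS mulrCA.
rewrite -mulrBr normcM; apply: le_lt_trans h; rewrite mulrC ler_wpM2l ?normc_ge0//.
by rewrite lerDr.
Qed.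

Let iter_dist v N : normc v <= r -> normc (ceval (x N) v - X v) <= delta * (3 / 4) ^+ N.
Proof.
move=> vr; have f : has_csum (fun n => ((x N)`_n)%:C * v ^+ n) (ceval (x N) v).
  apply/has_csumP => t t0; exists (size (x N)) => n h.
  by rewrite -ceval_wide// subrr normc0.
apply: has_csum_le (has_csumB f (X_csum vr)) _ => n.
apply: le_trans (boettcher_coef_dist N n); apply: le_trans (normc_sum _ _ _) _.
apply: ler_sum => i _; rewrite -mulrBl -rmorphB normcM normc_real ler_wpM2l//.
by rewrite normcX lerXn2r ?nnegrE ?normc_ge0 ?(ltW r0).
Qed.

Definition boettcher_rhs (v z : R[i]) : R[i] :=
  \sum_(j < d.+1) (p`_j)%:C * (v ^+ (d - j) * (1 + z) ^+ j).

(** By definition of [boettcher_step], the residual of the equation at an iterate is d times the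
    increment to the next iterate, which tends to 0. Continuity of [boettcher_rhs] does the rest. *)
Lemma inv_boettcher_series_eq v : normc v <= r ->
  1 + X (v ^+ d) = boettcher_rhs v (X v).
Proof.
move=> vr; have dgt0 : (0 < d)%N by exact: ltnW.
have vd : normc (v ^+ d) <= r.
  rewrite normcX (le_trans _ vr)// -[leRHS]expr1 ler_wiXn2l ?normc_ge0//.
  exact: le_trans r1.
apply/eqP; rewrite -subr_eq0; apply/eqP/normc_le0/ler_addgt0Pr => t t0.
have t4 : 0 < t / 4 by lra.
have cQ : ccont (boettcher_rhs v) (X v).
  apply: ccont_sum => j; apply: ccontM; first exact: ccont_cst.
  apply: ccontM; first exact: ccont_cst.
  apply: (@ccont_comp _ (fun w => 1 + w) (fun w => w ^+ j)); last exact: ccont_exp.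
  by apply: ccontD; [exact: ccont_cst|exact: ccont_id].
have [s s0 sP] := cQ _ t4.
have dR : 0 < d%:R :> R by rewrite ltr0n.
(* [s] serves the continuity of [boettcher_rhs], [t / 4] the error at [v ^+ d], and [t / (8 * d)]
   the increment, which is split into two distances and multiplied by d. *)
pose m := Num.min s (Num.min (t / 4) (t / (8 * d%:R))).
have m0 : 0 < m by rewrite !lt_min s0 t4/= divr_gt0 ?mulr_gt0.
have q34 : 0 <= 3 / 4 :> R by lra.
have [N NP] : exists N, delta * (3 / 4) ^+ N < m.
  have : (delta * (3 / 4) ^+ N) @[N --> \oo] --> delta * 0.
    by apply: cvgMl_tmp; apply: cvg_expr; rewrite ger0_norm//; lra.
  rewrite mulr0 => /cvgrPdist_lt/(_ _ m0)[N _ h]; exists N.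
  have := h N (leqnn N); rewrite sub0r normrN ger0_norm//.
  by rewrite mulr_ge0 ?exprn_ge0 ?(ltW delta0).
have NP1 : delta * (3 / 4) ^+ N.+1 < m.
  apply: le_lt_trans NP; rewrite exprS; have := exprn_ge0 N q34.
  by move: delta0; nra.
have A1 := iter_dist N vr; have A2 := iter_dist N.+1 vr; have A3 := iter_dist N vd.
have E : ceval (x N.+1) v = ceval (x N) v +
    (d%:R^-1)%:C * (1 + ceval (x N) (v ^+ d) - boettcher_rhs v (ceval (x N) v)).
  rewrite /x /boettcher_iter iterS -/(boettcher_iter p N) -/(x N).
  rewrite /boettcher_step cevalD cevalZ cevalB cevalD ceval1 ceval_comp cevalXn.
  congr (_ + _ * (_ - _)); rewrite /boettcher_poly ceval_sum; apply: eq_bigr => j _.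
  by rewrite cevalZ cevalM cevalXn cevalX cevalD ceval1.
move: NP NP1; rewrite /m !lt_min => /and3P[N1 N2 N3] /and3P[_ _ N4].
have A4 := sP _ (le_lt_trans A1 N1).
have alg (a b q xd q' xv dd : R[i]) : dd != 0 -> 1 + xd - q' =
    - (b - xd) + ((q - q') + dd * ((a + dd^-1 * (1 + b - q) - xv) - (a - xv))).
  by move=> dd0; field.
have -> : 1 + X (v ^+ d) - boettcher_rhs v (X v) =
  - (ceval (x N) (v ^+ d) - X (v ^+ d)) +
  ((boettcher_rhs v (ceval (x N) v) - boettcher_rhs v (X v)) +
   d%:R * ((ceval (x N.+1) v - X v) - (ceval (x N) v - X v))).
  by rewrite E realCV realC_nat; apply: alg; rewrite -realC_nat realC_eq0 gt_eqF.
apply: (le_trans (normcD _ _)); rewrite normcN.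
apply: (le_trans (lerD (lexx _) (normcD _ _))).
rewrite normcM normc_nat.
have B : d%:R * normc (ceval (x N.+1) v - X v - (ceval (x N) v - X v)) <= t / 4.
  rewrite mulrC -ler_pdivlMr// (le_trans (normcB _ _))//.
  have -> : t / 4 / d%:R = t / (8 * d%:R) + t / (8 * d%:R) by field; rewrite gt_eqF.
  by apply: lerD; apply: ltW; [exact: le_lt_trans A2 N4|exact: le_lt_trans A1 N3].
have add3 (a b f : R) : a < t / 4 -> b < t / 4 -> f <= t / 4 -> a + (b + f) <= 0 + t.
  by lra.
exact: add3 (le_lt_trans A3 N2) A4 B.
Qed.

Definition inv_boettcher (w : R[i]) : R[i] := w + powser c w^-1.

Lemma inv_boettcher_eq w : r^-1 <= normc w ->
  inv_boettcher (w ^+ d) = ceval p (inv_boettcher w).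
Proof.
move=> wr; have nw : 0 < normc w by apply: lt_le_trans wr; rewrite invr_gt0.
have w0 : w != 0 by rewrite -normc_gt0.
have vr : normc w^-1 <= r by rewrite normcV -[r]invrK lef_pV2 ?posrE ?invr_gt0.
have hE u : u != 0 -> inv_boettcher u = u * (1 + X u^-1).
  by move=> u0; rewrite /inv_boettcher /X; field.
rewrite (hE (w ^+ d)) ?expf_neq0// (hE w)// -exprVn (inv_boettcher_series_eq vr).
have sp : (size p <= d.+1)%N by rewrite leqSpred.
rewrite (ceval_wide _ sp) /boettcher_rhs mulr_sumr; apply: eq_bigr => j _.
rewrite mulrCA exprMn; congr (_ * _); rewrite mulrA exprVn; congr (_ * _).
have jd : (j <= d)%N by rewrite -ltnS.
by rewrite -{1}(subnKC jd) exprD mulfK// expf_neq0.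
Qed.

End InverseBoettcher.

(** * The inverse Boettcher function near infinity *)

Section InverseBoettcherAnalytic.
Variables (R : realType) (p : {poly R}).
Let d := (size p).-1.
Hypotheses (pm : p \is monic) (d2 : (2 <= d)%N).

Definition inv_boettcher_coef n : R[i] := (boettcher_coef p n.+1)%:C.

(** The Lipschitz constant 1 / 2 of [h w - w] makes [w |-> z - (h w - w)] a contraction, hence [h]
    invertible near infinity. The nonzero derivative is kept for differentiating branches of that
    inverse. *)
Lemma inv_boettcherP : exists M B : R, [/\ 1 <= M, 0 <= B,
  forall w, M < normc w -> inv_boettcher p (w ^+ d) = ceval p (inv_boettcher p w),
  forall w, M < normc w ->
    has_csum (fun n => inv_boettcher_coef n / w ^+ n) (inv_boettcher p w - w) /\
    normc (inv_boettcher p w - w) <= B &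
  (forall w, M < normc w -> exists2 m, m != 0 & cder (inv_boettcher p) w m) /\
  forall w w', M < normc w -> M < normc w' ->
    normc ((inv_boettcher p w - w) - (inv_boettcher p w' - w')) <= normc (w - w') / 2].
Proof.
have r0 : 0 < boettcher_radius p := boettcher_radius_gt0 d2.
pose r := boettcher_radius p; pose B := boettcher_delta p / r.
have yB : forall K, \sum_(i < K) normc (inv_boettcher_coef i) * r ^+ i <= B.
  exact: inv_boettcher_coef_le pm d2.
have B0 : 0 <= B by have := yB 0%N; rewrite big_ord0.
pose s := r / 2; have s0 : 0 < s by rewrite divr_gt0.
have sr : 2 * s <= r by rewrite /s; lra.
have Bs0 : 0 <= B / s by rewrite divr_ge0// ltW.
(* [s^-1] puts [w^-1] in the disc of the Taylor estimate. There the series is Lipschitz in [w^-1]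
   with constant [3 * (B / s)]; passing to [w] divides by [w * w'], so [6 * (B / s)] brings the
   constant down to 1 / 2. *)
pose M := 1 + s^-1 + 6 * (B / s).
have is0 : 0 < s^-1 by rewrite invr_gt0.
have M1 : 1 <= M by rewrite /M; lra.
have hE w : inv_boettcher p w - w = powser inv_boettcher_coef w^-1.
  by rewrite /inv_boettcher addrAC subrr add0r.
have Ms w : M < normc w -> normc w^-1 < s.
  move=> Mw; have w0 : 0 < normc w by lra.
  by rewrite normcV -[s]invrK ltf_pV2 ?posrE// (le_lt_trans _ Mw)// /M; lra.
have Mr w : M < normc w -> normc w^-1 <= r by move/Ms; rewrite /s; lra.
exists M, B; split=> //.
- move=> w Mw; apply: inv_boettcher_eq => //; apply: ltW; apply: le_lt_trans Mw.
  have : r^-1 <= s^-1 by rewrite lef_pV2 ?posrE// /s; lra.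
  by rewrite /M; lra.
- move=> w Mw; rewrite hE; split; last exact: powser_le r0 yB _ (Mr _ Mw).
  have := powserP r0 yB (Mr _ Mw).
  by under eq_fun do rewrite exprVn.
split=> [w Mw|w w' Mw Mw'].
  have [l lB lP] := powser_taylor1 r0 yB s0 sr (ltW (Ms _ Mw)).
  have w0 : w != 0 by rewrite -normc_gt0; lra.
  have dY : cder (powser inv_boettcher_coef) w^-1 l.
    move=> e e0; pose k := B / s ^+ 2 + 1.
    have k0 : 0 < k by rewrite ltr_wpDl// divr_ge0// exprn_ge0// ltW.
    exists (Num.min (s - normc w^-1) (e / k)).
      by rewrite lt_min subr_gt0 Ms// divr_gt0.
    move=> v; rewrite lt_min => /andP[v1 v2].
    have vs : normc v <= s.
      by have := normcD (v - w^-1) w^-1; rewrite subrK; lra.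
    apply: (le_trans (lP v vs)); rewrite expr2 mulrA ler_wpM2r ?normc_ge0//.
    rewrite ltr_pdivlMr// in v2; apply: le_trans (ltW v2).
    by rewrite mulrC ler_wpM2l ?normc_ge0// /k; lra.
  exists (1 + l * - w ^- 2).
    have h : normc (l * - w ^- 2) < 1.
      have w1 : 0 < normc w by rewrite normc_gt0.
      rewrite normcM normcN normcV normcX ltr_pdivrMr ?exprn_gt0// mul1r.
      apply: (le_lt_trans lB); apply: (@lt_le_trans _ _ (normc w)).
        by apply: le_lt_trans Mw; rewrite /M; lra.
      by rewrite expr2 ler_pMl//; lra.
    apply: contraTneq h => h; rewrite -leNgt.
    have -> : l * - w ^- 2 = - 1 by apply/eqP; rewrite -addr_eq0 addrC h.
    by rewrite normcN normc1.
  by apply: cderD; [exact: cder_id|exact: cder_comp (cderV w0) dY].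
have [l lB lP] := powser_taylor1 r0 yB s0 sr (ltW (Ms _ Mw')).
have w0 : w != 0 by rewrite -normc_gt0; lra.
have w'0 : w' != 0 by rewrite -normc_gt0; lra.
have n0 : 0 < normc w by rewrite normc_gt0.
have n'0 : 0 < normc w' by rewrite normc_gt0.
rewrite !hE -[X in normc X](subrK (l * (w^-1 - w'^-1))).
apply: (le_trans (normcD _ _)); rewrite normcM.
have A := lP _ (ltW (Ms _ Mw)).
have D : normc (w^-1 - w'^-1) <= 2 * s.
  by apply: (le_trans (normcB _ _)); have := Ms _ Mw; have := Ms _ Mw'; lra.
have D0 := normc_ge0 (w^-1 - w'^-1).
have A2 : B / s ^+ 2 * normc (w^-1 - w'^-1) ^+ 2 <= 2 * (B / s) * normc (w^-1 - w'^-1).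
  rewrite [normc _ ^+ 2]expr2 [leLHS]mulrA ler_wpM2r//.
  have -> : 2 * (B / s) = B / s ^+ 2 * (2 * s) by field; rewrite gt_eqF.
  by rewrite ler_wpM2l// divr_ge0// exprn_ge0// ltW.
have A3 : normc l * normc (w^-1 - w'^-1) <= B / s * normc (w^-1 - w'^-1).
  by rewrite ler_wpM2r.
apply: (@le_trans _ _ (3 * (B / s) * normc (w^-1 - w'^-1))).
  by move: A A2 A3; lra.
have -> : w^-1 - w'^-1 = - (w - w') / (w * w') by field; rewrite w0 w'0.
rewrite normc_div normcN normcM [leLHS]mulrA ler_pdivrMr ?mulr_gt0//.
rewrite [leLHS]mulrC -[leRHS]mulrA ler_wpM2l ?normc_ge0//.
have ww : normc w <= normc w * normc w' by rewrite ler_peMr//; lra.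
by move: Mw; rewrite /M; lra.
Qed.

End InverseBoettcherAnalytic.

(** * Growth of [p] at infinity and expansion of powers near 1 *)

Section PolynomialGrowth.
Variable R : realType.
Implicit Types (p : {poly R}).

Lemma ceval_growth p : p \is monic -> (2 <= (size p).-1)%N ->
  exists2 M : R, 1 <= M & forall z, M < normc z -> 2 * normc z < normc (ceval p z).
Proof.
move=> pm d2; pose d := (size p).-1.
pose C := \sum_(j < d) `|p`_j|; have C0 : 0 <= C by exact: sumr_ge0.
exists (2 + C) => [|z Mz]; first lra.
have z1 : 1 <= normc z by lra.
have dd : d = (d.-1).+1 by rewrite prednK// ltnW.
rewrite (@ceval_wide _ _ d.+1) ?leqSpred// big_ord_recr/= (monic_coef_degree pm) mul1r addrC.
apply: lt_le_trans (normc_lbD _ _); rewrite ltrBrDl normcX.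
have S : normc (\sum_(i < d) (p`_i)%:C * z ^+ i) <= C * normc z ^+ d.-1.
  apply: (le_trans (normc_sum _ _ _)); rewrite /C mulr_suml; apply: ler_sum => i _.
  rewrite normcM normc_real normcX ler_wpM2l// ler_weXn2l// -ltnS prednK ?ltn_ord//.
  exact: ltnW.
have -> : normc z ^+ d = normc z * normc z ^+ d.-1 by rewrite {1}dd exprS.
have X : normc z <= normc z ^+ d.-1 by rewrite -[leLHS]expr1 ler_weXn2l// -ltnS -dd.
apply: (@le_lt_trans _ _ ((C + 2) * normc z ^+ d.-1)).
  by rewrite mulrDl; lra.
by rewrite ltr_pM2r; [lra|rewrite exprn_gt0//; lra].
Qed.

Lemma normc_1DX_sub1 (x : R[i]) (k : R) n : normc x <= k ->
  normc ((1 + x) ^+ n - 1) <= (1 + k) ^+ n - 1.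
Proof.
move=> xk; have x0 := normc_ge0 x; elim: n => [|n ih].
  by rewrite !expr0 !subrr normc0.
have -> : (1 + x) ^+ n.+1 - 1 = x * (1 + x) ^+ n + ((1 + x) ^+ n - 1).
  by rewrite exprS; ring.
have -> : (1 + k) ^+ n.+1 - 1 = k * (1 + k) ^+ n + ((1 + k) ^+ n - 1).
  by rewrite exprS; ring.
rewrite (le_trans (normcD _ _))// lerD// normcM ler_pM ?normc_ge0// normcX.
rewrite lerXn2r ?nnegrE ?normc_ge0//; first lra.
by rewrite (le_trans (normcD _ _))// normc1 lerD2l.
Qed.

(** In [q ^+ d - 1 = (q - 1) * (d + \sum (q ^+ i - 1))] the sum has modulus at most d / 8, so the
    second factor is at least 7 d / 8 >= 3 / 2. *)
Lemma normc_expr_sub1 (q : R[i]) d : (2 <= d)%N -> normc (q - 1) <= (16 * d%:R)^-1 ->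
  3 / 2 * normc (q - 1) <= normc (q ^+ d - 1).
Proof.
move=> d2; set a := _^-1 => qa.
have hd : 2 <= d%:R :> R by rewrite ler_nat.
have a0 : 0 <= a by rewrite invr_ge0; lra.
have da : d%:R * a = 1 / 16 by rewrite /a; field; rewrite gt_eqF//; lra.
have q0 := normc_ge0 (q - 1).
have -> : q ^+ d - 1 = (q - 1) * (d%:R + \sum_(i < d) (q ^+ i - 1)).
  by rewrite subrX1 sumrB sumr_const card_ord [d%:R + _]addrC subrK.
rewrite normcM mulrC ler_wpM2l//; apply: le_trans (normc_lbD _ _).
rewrite normc_nat.
have : normc (\sum_(i < d) (q ^+ i - 1)) <= d%:R * (1 / 8).
  apply: (le_trans (normc_sum _ _ _)).
  apply: (@le_trans _ _ (\sum_(i < d) (1 / 8 : R))); last first.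
    by rewrite sumr_const card_ord -[leLHS]mulr_natl.
  apply: ler_sum => i _; rewrite (_ : q = 1 + (q - 1)); last by rewrite addrC subrK.
  have ia : i%:R * a <= 1 / 16 by rewrite -da ler_wpM2r// ler_nat ltnW.
  apply: (le_trans (normc_1DX_sub1 _ qa)).
  have h : 2 * i%:R * a <= 1 by rewrite -(mulrA 2); lra.
  by have := exp1D_le a0 h; rewrite -(mulrA 2); lra.
lra.
Qed.

End PolynomialGrowth.

(** * Inverting a small perturbation of the identity near infinity *)

Section InverseNearInfinity.
Variables (R : realType) (h : R[i] -> R[i]) (M B : R).
Hypotheses (M1 : 1 <= M) (B0 : 0 <= B)
  (hB : forall w, M < normc w -> normc (h w - w) <= B)
  (hL : forall w w', M < normc w -> M < normc w' ->
    normc ((h w - w) - (h w' - w')) <= normc (w - w') / 2).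

Definition inv_near_infty (z : R[i]) : R[i] := xget 0 [set w | M < normc w /\ h w = z].

Lemma near_id_inj w w' : M < normc w -> M < normc w' ->
  normc (w - w') <= 2 * normc (h w - h w').
Proof.
move=> Mw Mw'; have := hL Mw Mw'.
have -> : h w - w - (h w' - w') = (h w - h w') - (w - w') by ring.
have := normc_lbB (w - w') (h w - h w').
by rewrite (normc_distC (w - w') (h w - h w')); lra.
Qed.

(** Banach iteration of [w |-> z - (h w - w)] from [z]: every iterate stays within [B] of [z], hence
    in the domain, and the increments are halved at each step. *)
Lemma near_id_surj z : M + B < normc z -> exists w, M < normc w /\ h w = z.
Proof.
move=> zM; pose x n := iter n (fun w => z - (h w - w)) z.
have xS n : x n.+1 = z - (h (x n) - x n) by [].
have far w : normc (w - z) <= B -> M < normc w.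
  by move=> wz; have := normc_lbB z w; rewrite normc_distC; lra.
have xz n : normc (x n - z) <= B.
  elim: n => [|n ih]; first by rewrite [x _]/= subrr normc0.
  by rewrite xS addrAC subrr add0r normcN; apply: hB; exact: far.
have dx n : normc (x n.+1 - x n) <= B / 2 ^+ n.
  elim: n => [|n ih].
    rewrite expr0 divr1; exact: (xz 1%N).
  have -> : x n.+2 - x n.+1 = - ((h (x n.+1) - x n.+1) - (h (x n) - x n)).
    rewrite (xS n.+1) (_ : z = x n.+1 + (h (x n) - x n)); last by rewrite xS subrK.
    by ring.
  rewrite normcN; apply: le_trans (hL (far _ (xz _)) (far _ (xz _))) _.
  by rewrite exprSr invfM mulrA ler_wpM2r.
have sx n : \sum_(i < n) (x i.+1 - x i) = x n - z.
  elim: n => [|n ih]; first by rewrite big_ord0 subrr.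
  by rewrite big_ord_recr/= ih addrC subrKA.
have [s xs _] : exists2 s, has_csum (fun n => x n.+1 - x n) s & normc s <= 2 * B.
  apply: abs_has_csum => n.
  apply: (@le_trans _ _ (\sum_(i < n) B / 2 ^+ i)); first exact: ler_sum.
  suff -> : \sum_(i < n) B / 2 ^+ i = 2 * B * (1 - (2 ^+ n)^-1).
    by rewrite ler_piMr ?mulr_ge0// gerBl invr_ge0 exprn_ge0.
  elim: n => [|n ih]; first by rewrite big_ord0 expr0 invr1 subrr mulr0.
  by rewrite big_ord_recr/= ih exprS; field; rewrite expf_neq0.
(* The bound [2 * B] of the geometric series is too weak to keep the limit in the domain; the
   telescoped partial sums, all of modulus at most [B], do keep it there. *)
have sB : normc s <= B by apply: has_csum_le xs _ => n; rewrite sx.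
have Ms : M < normc (z + s) by apply: far; rewrite addrAC subrr add0r.
exists (z + s); split=> //.
apply/eqP; rewrite -subr_eq0; apply/eqP/normc_le0/ler_addgt0Pr => e e0.
have e3 : 0 < e / 3 by rewrite divr_gt0.
have [N NP] := (has_csumP _ _).1 xs _ e3.
have := NP _ (leqnn N); have := NP _ (leqnSn N); rewrite !sx => A1 A2.
have -> : h (z + s) - z =
   ((h (z + s) - (z + s)) - (h (x N) - x N)) - (x N.+1 - z - s).
  by rewrite xS; ring.
apply: (le_trans (normcB _ _)).
have := hL Ms (far _ (xz N)).
have -> : z + s - x N = - (x N - z - s) by ring.
by rewrite normcN; lra.
Qed.

Lemma inv_near_inftyP z : M + B < normc z ->
  M < normc (inv_near_infty z) /\ h (inv_near_infty z) = z.
Proof.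
move=> /near_id_surj[w wP]; rewrite /inv_near_infty.
by case: xgetP => [v _ //|/(_ w)].
Qed.

Lemma inv_near_inftyK w : M < normc w -> inv_near_infty (h w) = w.
Proof.
move=> Mw; rewrite /inv_near_infty; case: xgetP => [v _ [Mv hv]|/(_ w)]; last by case.
apply/eqP; rewrite -subr_eq0; apply/eqP/normc_le0.
by apply: (le_trans (near_id_inj Mv Mw)); rewrite hv subrr normc0 mulr0.
Qed.

Lemma inv_near_infty_dist z : M + B < normc z -> normc (inv_near_infty z - z) <= B.
Proof.
by move=> /inv_near_inftyP[Mw hw]; rewrite -{2}hw normc_distC; exact: hB.
Qed.

Lemma ccont_inv_near_infty z : M + B < normc z -> ccont inv_near_infty z.
Proof.
move=> zM e e0; exists (Num.min (normc z - (M + B)) (e / 2)).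
  by rewrite lt_min subr_gt0 zM divr_gt0.
move=> w; rewrite lt_min => /andP[w1 w2].
have wM : M + B < normc w by have := normc_lbB z w; rewrite normc_distC; lra.
have [Mw hw] := inv_near_inftyP wM; have [Mz hz] := inv_near_inftyP zM.
by have := near_id_inj Mw Mz; rewrite hw hz; lra.
Qed.

End InverseNearInfinity.

(** * Tools for the uniqueness of the Boettcher function *)

Section BoettcherUniqueness.
Variables (R : realType).

Lemma has_csum_bounded (u : nat -> R[i]) s : has_csum u s ->
  exists2 K : R, 0 <= K & forall n, normc (u n) <= K.
Proof.
move=> /has_csumP/(_ 1 ltr01)[N NP].
exists (\sum_(i < N) normc (u i) + 2) => [|n].
  by rewrite addr_ge0// sumr_ge0// => i _; exact: normc_ge0.
have [nN|Nn] := ltnP n N.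
  rewrite (bigD1 (Ordinal nN))//= -addrA lerDl addr_ge0// sumr_ge0// => i _.
  exact: normc_ge0.
have -> : u n = (\sum_(i < n.+1) u i - s) - (\sum_(i < n) u i - s).
  by rewrite big_ord_recr/=; ring.
apply: (le_trans (normcB _ _)).
have := NP _ Nn; have := NP _ (leq_trans Nn (leqnSn n)).
have : 0 <= \sum_(i < N) normc (u i) by apply: sumr_ge0 => i _; exact: normc_ge0.
lra.
Qed.

(** Convergence at the single point [z0] bounds [normc (b n)] by [K * z0 ^+ n]; beyond [2 * z0] the
    terms are then dominated by [K / 2 ^+ n]. *)
Lemma laurent_bounded (b : nat -> R[i]) (g : R[i] -> R[i]) : laurent_at_infty b g ->
  exists M K : R, [/\ 0 < M, 0 <= K & forall z, M < normc z -> normc (g z - z) <= K].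
Proof.
move=> [M M0 gM]; pose z0 := 1 + M.
have z00 : 0 < z0 by rewrite /z0; lra.
have := gM z0%:C; rewrite normc_real gtr0_norm// => /(_ _)/has_csum_bounded[].
  by rewrite /z0; lra.
move=> K K0 KP.
exists (2 * z0), (2 * K); split; [by rewrite mulr_gt0|by rewrite mulr_ge0|].
move=> z zz; have zM : M < normc z by rewrite /z0 in zz; lra.
apply: has_csum_le (gM z zM) _ => n.
apply: (le_trans (normc_sum _ _ _)).
apply: (@le_trans _ _ (\sum_(i < n) K / 2 ^+ i)).
  apply: ler_sum => i _; have := KP i.
  rewrite !normcM !normcV !normcX normc_real gtr0_norm// ler_pdivrMr ?exprn_gt0// => h.
  have nz : 0 < normc z by lra.
  rewrite ler_pdivrMr ?exprn_gt0//; apply: (le_trans h).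
  rewrite mulrAC ler_pdivlMr ?exprn_gt0// -mulrA ler_wpM2l// -exprMn.
  by rewrite lerXn2r ?nnegrE ?mulr_ge0 ?(ltW z00) ?normc_ge0//; lra.
suff -> : \sum_(i < n) K / 2 ^+ i = 2 * K * (1 - (2 ^+ n)^-1).
  by rewrite ler_piMr ?mulr_ge0// gerBl invr_ge0 exprn_ge0.
elim: n => [|n ih]; first by rewrite big_ord0 expr0 invr1 subrr mulr0.
by rewrite big_ord_recr/= ih exprS; field; rewrite expf_neq0.
Qed.

(* A function close to 1 near infinity that intertwines w |-> w ^ d with itself
   is 1: otherwise each application of w ^ d would expand its distance to 1. *)
Lemma power_conjugacy_unique (q : R[i] -> R[i]) (d : nat) (M : R) : (2 <= d)%N -> 1 <= M ->
  (forall w, M < normc w -> q (w ^+ d) = q w ^+ d) ->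
  (forall w, M < normc w -> normc (q w - 1) <= (16 * d%:R)^-1) ->
  forall w, M < normc w -> q w = 1.
Proof.
move=> d2 M1 qd q1 w Mw.
pose x n := iter n (fun w => w ^+ d) w.
have xS n : x n.+1 = x n ^+ d by [].
have x0 : x 0%N = w by [].
move: x xS x0 => x xS x0.
have Mx n : M < normc (x n).
  elim: n => [|n ih]; rewrite ?x0// xS normcX (lt_le_trans ih)//.
  by rewrite -[leLHS]expr1 ler_weXn2l ?(ltnW d2)//; lra.
have grow n : (3 / 2) ^+ n * normc (q w - 1) <= normc (q (x n) - 1).
  elim: n => [|n ih]; first by rewrite expr0 mul1r x0.
  rewrite xS (qd _ (Mx n)) exprS -mulrA.
  apply: le_trans (normc_expr_sub1 d2 (q1 _ (Mx n))).
  by rewrite ler_wpM2l//; lra.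
apply/eqP; rewrite -subr_eq0; apply/eqP/normc_le0; rewrite leNgt; apply/negP => q0.
have h n : n%:R * (normc (q w - 1) / 2) <= (16 * d%:R)^-1.
  apply: le_trans (q1 _ (Mx n)); apply: le_trans (grow n).
  have B : 1 + n%:R / 2 <= (3 / 2 : R) ^+ n.
    elim: n => [|n ih]; first by rewrite expr0 mul0r addr0.
    by rewrite -natr1 exprS; have : 0 <= n%:R :> R by []; nra.
  by nra.
have := h (Num.truncn ((16 * d%:R)^-1 / (normc (q w - 1) / 2))).+1.
by rewrite -ler_pdivlMr ?divr_gt0// leNgt truncnS_gt.
Qed.

End BoettcherUniqueness.

(** * Every Boettcher function is inverse to [inv_boettcher] *)

Section BoettcherFunction.
Variables (R : realType) (p : {poly R}) (d : nat).
Hypotheses (pm : p \is monic) (pd : size p = d.+1) (d2 : (2 <= d)%N).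
Let h := inv_boettcher p.
Let c := inv_boettcher_coef p.

Let dE : (size p).-1 = d. Proof. by rewrite pd. Qed.
Let d2' : (2 <= (size p).-1)%N. Proof. by rewrite dE. Qed.

Lemma boettcher_exists : exists (g0 : R[i] -> R[i]) (M B : R), [/\ 1 <= M, 0 <= B,
  forall w, M < normc w -> [/\ has_csum (fun n => c n / w ^+ n) (h w - w),
    h (w ^+ d) = ceval p (h w), g0 (h w) = w, normc (h w - w) <= B &
    exists2 m, m != 0 & cder h w m] &
  forall z, M + B < normc z -> [/\ M < normc (g0 z), h (g0 z) = z,
    normc (g0 z - z) <= B, g0 (ceval p z) = g0 z ^+ d & ccont g0 z]].
Proof.
have [M [B [M1 B0 hp hs [hd hL]]]] := inv_boettcherP pm d2'.
have hB w : M < normc w -> normc (h w - w) <= B by move=> /hs[].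
rewrite dE in hp.
exists (inv_near_infty h M), M, B; split=> //.
  move=> w Mw; split; [by case: (hs w Mw)|exact: hp| |exact: hB|exact: hd].
  exact: (inv_near_inftyK hL).
move=> z Mz; have [Mw hw] := inv_near_inftyP B0 hB hL Mz.
split=> //.
- exact: (inv_near_infty_dist B0 hB hL Mz).
- rewrite -{1}hw -hp// (inv_near_inftyK hL)//.
  rewrite normcX (lt_le_trans Mw)// -[leLHS]expr1 ler_weXn2l ?(ltnW d2)//; lra.
- exact: (ccont_inv_near_infty B0 hB hL Mz).
Qed.

Lemma boettcher_inverse (g : R[i] -> R[i]) : boettcher d p g ->
  inverse_at_infty g h /\ laurent_at_infty c h.
Proof.
move=> [[b gb] [Mg gp]].
have [g0 [M [B [M1 B0 hP gP]]]] := boettcher_exists.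
have [M2 [K [M20 K0 gK]]] := laurent_bounded gb.
pose a : R := (16 * d%:R)^-1.
have a0 : 0 < a by rewrite invr_gt0 mulr_gt0// ltr0n ltnW.
(* The last summand brings [g (h w) / w] within [a] of 1; the others put [w] and [h w] beyond the
   thresholds of [h] and of both properties of [g]. *)
pose T := M + B + `|Mg| + M2 + (K + B) / a.
have KBa : 0 <= (K + B) / a by rewrite divr_ge0 ?addr_ge0// ltW.
have Mg0 : 0 <= `|Mg| by [].
have MgT := ler_norm Mg.
have gh w : T < normc w -> g (h w) = w.
  have T1 : 1 <= T by rewrite /T; lra.
  have far w' : T < normc w' -> normc w' - B <= normc (h w').
    move=> Tw; have [] := hP w'; first by rewrite /T in Tw; lra.
    move=> _ _ _ hB _; have := normc_lbB w' (h w'); rewrite normc_distC; lra.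
  move=> Tw; have w0 : w != 0 by rewrite -normc_gt0; lra.
  suff : g (h w) / w = 1 by move=> /(congr1 (fun x => x * w)); rewrite divfK// mul1r.
  apply: (@power_conjugacy_unique R (fun w => g (h w) / w) d T) => //.
    move=> v Tv; have [] := hP v; first by rewrite /T in Tv; lra.
    move=> _ hv _ _ _; rewrite hv -gp ?expr_div_n//.
    by have := far _ Tv; rewrite /T in Tv *; lra.
  move=> v Tv; have v0 : v != 0 by rewrite -normc_gt0; lra.
  have nv : 0 < normc v by rewrite normc_gt0.
  have -> : g (h v) / v - 1 = (g (h v) - v) / v by field.
  rewrite normc_div ler_pdivrMr// -/a mulrC -ler_pdivrMr//.
  apply: (@le_trans _ _ ((K + B) / a)); last by rewrite /T in Tv; lra.
  rewrite ler_wpM2r ?invr_ge0 ?(ltW a0)//.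
  have [] := hP v; first by rewrite /T in Tv; lra.
  move=> _ _ _ hB _; apply: (le_trans (normc_triangle (h v) _ _)); apply: lerD => //.
  by apply: gK; have := far _ Tv; rewrite /T in Tv *; lra.
split; last first.
  exists M; first lra.
  by move=> w Mw; have [] := hP w Mw.
exists (T + B) => z Tz.
have Mz : M + B < normc z by rewrite /T in Tz; lra.
have [Mg0z hg0 g0B _ _] := gP z Mz.
have gz : g z = g0 z.
  rewrite -{1}hg0 gh//; have := normc_lbB z (g0 z); rewrite normc_distC; lra.
by rewrite gz hg0 gh//; lra.
Qed.

End BoettcherFunction.

(** * Segments in a strip and uniformity along them *)

Section Segments.
Variable R : realType.
Implicit Types (a b u : R[i]) (t s : R).

Definition seg a b t : R[i] := a + t%:C * (b - a).

Lemma seg0 a b : seg a b 0 = a.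
Proof. by rewrite /seg mul0r addr0. Qed.
Lemma seg1 a b : seg a b 1 = b.
Proof. by rewrite /seg mul1r addrC subrK. Qed.

Lemma seg_dist a b b' s t : 0 <= s <= 1 ->
  normc (seg a b' s - seg a b t) <= normc (b' - b) + `|s - t| * normc (b - a).
Proof.
move=> /andP[s0 s1].
have -> : seg a b' s - seg a b t = s%:C * (b' - b) + (s - t)%:C * (b - a).
  by rewrite /seg rmorphB/=; ring.
apply: (le_trans (normcD _ _)); rewrite !normcM !normc_real (ger0_norm s0).
by rewrite lerD2r ler_piMl ?normc_ge0.
Qed.

Lemma strip_seg (al be : R) a b t : 0 <= t <= 1 ->
  strip al be a -> strip al be b -> strip al be (seg a b t).
Proof.
move=> /andP[t0 t1] /andP[a1 a2] /andP[b1 b2].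
rewrite /strip /seg /= cImD cImMr cImD cImN.
have E : complex.Im a + t * (complex.Im b + - complex.Im a) =
  (1 - t) * complex.Im a + t * complex.Im b by ring.
rewrite E; have [->|tp] := eqVneq t 0; first by apply/andP; split; lra.
have {}t0 : 0 < t by rewrite lt_neqAle eq_sym tp.
have h1 : 0 <= (1 - t) * (complex.Im a - al) by rewrite mulr_ge0; lra.
have h2 : 0 < t * (complex.Im b - al) by rewrite mulr_gt0 ?subr_gt0.
have h3 : 0 <= (1 - t) * (be - complex.Im a) by rewrite mulr_ge0; lra.
have h4 : 0 < t * (be - complex.Im b) by rewrite mulr_gt0 ?subr_gt0.
by apply/andP; split; lra.
Qed.

Lemma strip_nbhs (al be : R) u : strip al be u ->
  exists2 d : R, 0 < d & forall w, normc (w - u) < d -> strip al be w.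
Proof.
move=> /andP[u1 u2].
exists (Num.min (complex.Im u - al) (be - complex.Im u)).
  by rewrite lt_min !subr_gt0 u1 u2.
move=> w; rewrite lt_min => /andP[h1 h2]; have := Im_le_normc (w - u).
rewrite cImD cImN ler_norml => /andP[h3 h4].
by rewrite /strip /=; apply/andP; split; lra.
Qed.

(* Compactness of [0, 1]: a relation between H-values that holds locally along
   the segment holds for all nearby segments, at a uniform mesh. *)
Lemma seg_uniform (H : R[i] -> R[i]) (Q : R[i] -> R[i] -> Prop) a b :
  (forall t, 0 <= t <= 1 -> ccont H (seg a b t)) ->
  (forall t, 0 <= t <= 1 -> exists2 e : R, 0 < e & forall x y,
    normc (x - H (seg a b t)) < e -> normc (y - H (seg a b t)) < e -> Q x y) ->
  exists2 d : R, 0 < d & forall b' s t, normc (b' - b) < d ->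
    0 <= s <= 1 -> 0 <= t <= 1 -> `|s - t| < d ->
    Q (H (seg a b' s)) (H (seg a b' t)).
Proof.
move=> Hc HQ.
(* Meshes tending to 0 from the right, as the parameter filter of the near-covering form of
   compactness; it merges the local radii into a single mesh. *)
pose F : set_system R := filter_from [set d : R | 0 < d] (fun d => [set x : R | 0 < x < d]).
have FF : Filter F.
  apply: filter_from_filter; first by exists 1 => /=.
  move=> i j /= i0 j0; exists (Num.min i j); first by rewrite /= lt_min i0.
  by move=> x /=; rewrite lt_min => /andP[-> /andP[-> ->]].
pose P (d t : R) := forall b' s t', normc (b' - b) < d -> 0 <= s <= 1 -> 0 <= t' <= 1 ->
  `|s - t| < d -> `|t' - t| < d -> Q (H (seg a b' s)) (H (seg a b' t')).
have /compact_near_coveringP/(_ _ F (fun d t => P d t) FF) := @segment_compact R 0 1.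
case.
  move=> t /=; rewrite in_itv/= => t01.
  have [e e0 eQ] := HQ t t01; have [d d0 dP] := Hc t t01 _ e0.
  pose k := 2 * (1 + normc (b - a)).
  have k0 : 0 < k by rewrite /k mulr_gt0// ltr_pwDl// normc_ge0.
  pose d' := d / k; have d'0 : 0 < d' by rewrite divr_gt0.
  have dk : d' * (1 + normc (b - a)) = d / 2.
    by rewrite /d' /k; field; rewrite gt_eqF// ltr_pwDl// normc_ge0.
  exists (ball t (d' / 2), [set x : R | 0 < x < d' / 2]) => /=.
    split; first by apply: nbhsx_ballx; rewrite divr_gt0.
    by exists (d' / 2) => //=; rewrite divr_gt0.
  move=> [t1 x] /= [tt /andP[x0 xd]] b' s t' bb s01 t01' st tt'.
  have near s' : 0 <= s' <= 1 -> `|s' - t1| < x -> normc (seg a b' s' - seg a b t) < d.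
    move=> s01' st'; apply: (le_lt_trans (seg_dist _ _ _ _ s01')).
    have : `|s' - t| <= d'.
      have := ler_distD t1 s' t; rewrite /ball /= distrC in tt.
      by rewrite [`|t1 - t|]distrC; move: tt; rewrite distrC; lra.
    move=> hh; have n0 := normc_ge0 (b - a).
    have : `|s' - t| * normc (b - a) <= d' * normc (b - a) by rewrite ler_wpM2r.
    by move: dk; rewrite mulrDr mulr1; lra.
  by apply: eQ; apply: dP; exact: near.
move=> d /= d0 dP; exists (d / 2); first by rewrite divr_gt0.
move=> b' s t bb s01 t01 st.
have /dP h : [set x : R | 0 < x < d] (d / 2) by rewrite /=; apply/andP; split; lra.
apply: (h t) => //=.
by rewrite subrr normr0 divr_gt0.
Qed.

(** The distance from [x] to [y] is below two thirds of [normc c], while [normc y] exceeds two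
    thirds of it, so the quotient is within distance 1 of 1. *)
Lemma Re_div_gt0 (x y c : R[i]) : normc (x - c) < normc c / 3 ->
  normc (y - c) < normc c / 3 -> 0 < complex.Re (x / y).
Proof.
move=> xc yc; have := normc_lbB c y; rewrite normc_distC => h.
have ny : 0 < normc y by have := normc_ge0 (y - c); lra.
have y0 : y != 0 by rewrite -normc_gt0.
have -> : x / y = 1 + (x - y) / y by field.
have : normc ((x - y) / y) < 1.
  rewrite normc_div ltr_pdivrMr// mul1r (le_lt_trans (normc_triangle c _ _))//.
  by rewrite (normc_distC c y); lra.
have := Re_le_normc ((x - y) / y); rewrite ler_norml cReD /= => /andP[h1 h2].
lra.
Qed.

Lemma sum_double (f : nat -> R[i]) n :
  \sum_(i < n.*2) f i = \sum_(j < n) (f j.*2 + f j.*2.+1).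
Proof.
elim: n => [|n ih]; first by rewrite !big_ord0.
by rewrite doubleS !big_ord_recr/= ih addrA.
Qed.

End Segments.

(** * Continuous logarithms on a strip *)

Section LogarithmOnStrip.
Variables (R : realType) (al be : R) (H : R[i] -> R[i]).
Hypotheses (Hc : forall u, strip al be u -> ccont H u)
  (H0 : forall u, strip al be u -> H u != 0).
Variables (a l0 : R[i]).
Hypotheses (sa : strip al be a) (el0 : cexp l0 = H a).

Let quot m x j := H (seg a x (j.+1%:R / 2 ^+ m)) / H (seg a x (j%:R / 2 ^+ m)).

(* Principal logarithms of the quotients of H along a dyadic subdivision of
   the segment from a to x. Once the mesh is fine enough, refining it does not
   change the sum, so no choice of branch is involved. *)
Definition dyadic_log m x : R[i] := l0 + \sum_(j < 2 ^ m) clog (quot m x j).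

(** Required of all close pairs of parameters and not only of dyadic neighbours, so that it passes
    to finer subdivisions. *)
Let fine_at m x := forall s t : R, 0 <= s <= 1 -> 0 <= t <= 1 -> `|s - t| <= (2 ^+ m)^-1 ->
  0 < complex.Re (H (seg a x s) / H (seg a x t)).

Let dyadic01 m j : (j <= 2 ^ m)%N -> 0 <= (j%:R / 2 ^+ m : R) <= 1.
Proof.
move=> jm; rewrite divr_ge0 ?exprn_ge0//= ler_pdivrMr ?exprn_gt0// mul1r.
by rewrite -natrX ler_nat.
Qed.

Let dyadic_step m j : `|j.+1%:R / 2 ^+ m - j%:R / 2 ^+ m : R| <= (2 ^+ m)^-1.
Proof. by rewrite -mulrBl -natr1 addrAC subrr add0r mul1r ger0_norm// invr_ge0 exprn_ge0. Qed.

Let fine_quot m x j : fine_at m x -> (j < 2 ^ m)%N -> 0 < complex.Re (quot m x j).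
Proof.
move=> fx jm; apply: fx; [exact: dyadic01|exact: (dyadic01 (ltnW jm))|exact: dyadic_step].
Qed.

Let fineS m x : fine_at m x -> fine_at m.+1 x.
Proof.
move=> fx s t s01 t01 st; apply: fx => //; apply: (le_trans st).
by rewrite lef_pV2 ?posrE ?exprn_gt0// exprS ler_peMl ?exprn_ge0// ler1n.
Qed.

Let seg_strip x t : strip al be x -> 0 <= t <= 1 -> strip al be (seg a x t).
Proof. by move=> sx t01; exact: strip_seg. Qed.

(** The quotient over a dyadic interval is the product of those over its halves, and their
    logarithms add because all three lie in the right half-plane. *)
Let dyadic_logS m x : strip al be x -> fine_at m x -> dyadic_log m.+1 x = dyadic_log m x.
Proof.
move=> sx fx; rewrite /dyadic_log; congr (_ + _).
rewrite (_ : 2 ^ m.+1 = (2 ^ m).*2)%N; last by rewrite expnS mul2n.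
rewrite (sum_double (fun j => clog (quot m.+1 x j))); apply: eq_bigr => j _.
have jm := ltn_ord j.
have j2 : (j.*2.+1 < 2 ^ m.+1)%N by rewrite expnS mul2n -doubleS leq_double.
have e1 : j.*2.+2%:R / 2 ^+ m.+1 = j.+1%:R / 2 ^+ m :> R.
  by rewrite -doubleS -mul2n natrM exprS; field; rewrite expf_neq0.
have e0 : j.*2%:R / 2 ^+ m.+1 = j%:R / 2 ^+ m :> R.
  by rewrite -mul2n natrM exprS; field; rewrite expf_neq0.
have q1 := fine_quot (fineS fx) j2; have q0 := fine_quot (fineS fx) (ltnW j2).
have q := fine_quot fx jm.
have qE : quot m x j = quot m.+1 x j.*2 * quot m.+1 x j.*2.+1.
  rewrite /quot e1 e0.
  have h1 : H (seg a x (j.*2.+1%:R / 2 ^+ m.+1)) != 0.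
    by apply: H0; apply: seg_strip => //; apply: dyadic01; exact: ltnW.
  have h0 : H (seg a x (j%:R / 2 ^+ m)) != 0.
    by apply: H0; apply: seg_strip => //; apply: dyadic01; exact: ltnW.
  by field; rewrite h1 h0.
by rewrite qE clogM// -qE.
Qed.

Let dyadic_log_stable m k x : strip al be x -> fine_at m x ->
  dyadic_log (m + k) x = dyadic_log m x.
Proof.
move=> sx fx; have fk : fine_at (m + k) x by elim: k => [|k ih]; rewrite ?addn0// addnS; exact: fineS.
elim: k fk => [|k ih] fk; first by rewrite addn0.
have fk' : fine_at (m + k) x by elim: k {ih fk} => [|k ih]; rewrite ?addn0// addnS; exact: fineS.
by rewrite addnS dyadic_logS// ih.
Qed.

Let cexp_dyadic_log m x : strip al be x -> fine_at m x -> cexp (dyadic_log m x) = H x.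
Proof.
move=> sx fx.
have step k : (k <= 2 ^ m)%N ->
    cexp (l0 + \sum_(j < k) clog (quot m x j)) = H (seg a x (k%:R / 2 ^+ m)).
  elim: k => [|k ih] km; first by rewrite big_ord0 addr0 mul0r seg0.
  rewrite big_ord_recr/= addrA cexpD ih ?(ltnW km)// clogK ?fine_quot//.
  rewrite /quot mulrCA divff ?mulr1//.
  by apply: H0; apply: seg_strip => //; apply: dyadic01; exact: ltnW.
rewrite /dyadic_log step// natrX divff ?seg1// expf_neq0//.
Qed.

Let ccont_dyadic_log m x : strip al be x -> fine_at m x -> ccont (dyadic_log m) x.
Proof.
move=> sx fx; apply: ccontD; first exact: ccont_cst.
apply: ccont_sum => j; have jm := ltn_ord j.
have cs k : (k <= 2 ^ m)%N -> ccont (fun y => H (seg a y (k%:R / 2 ^+ m))) x.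
  move=> km; apply: (@ccont_comp _ (fun y => seg a y (k%:R / 2 ^+ m)) H).
    apply: ccontD; first exact: ccont_cst.
    apply: ccontM; first exact: ccont_cst.
    by apply: ccontD; [exact: ccont_id|exact: ccont_cst].
  by apply: Hc; apply: seg_strip => //; exact: dyadic01.
apply: (@ccont_comp _ (fun y => quot m y j) (@clog R)).
  apply: ccontM; first exact: cs.
  apply: (@ccont_comp _ (fun y => H (seg a y (j%:R / 2 ^+ m))) GRing.inv).
    exact: cs (ltnW jm).
  apply: ccontV; apply: H0; apply: seg_strip => //; exact: dyadic01 (ltnW jm).
by apply: ccont_clog; exact: fine_quot.
Qed.

(** One level [m] serves all endpoints near [x]; there the logarithm is the fixed finite sum
    [dyadic_log m], which is visibly continuous. *)
Let fine_near x : strip al be x -> exists m, exists2 d : R, 0 < d &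
  forall y, normc (y - x) < d -> fine_at m y.
Proof.
move=> sx.
have Q t : 0 <= t <= 1 -> exists2 e : R, 0 < e & forall u v,
    normc (u - H (seg a x t)) < e -> normc (v - H (seg a x t)) < e ->
    0 < complex.Re (u / v).
  move=> t01; exists (normc (H (seg a x t)) / 3).
    by rewrite divr_gt0// normc_gt0; apply: H0; exact: seg_strip.
  by move=> u v; exact: Re_div_gt0.
have [d d0 dP] := seg_uniform (fun t t01 => Hc (seg_strip sx t01)) Q.
have [m mP] : exists m, (2 ^+ m)^-1 < d.
  exists (Num.truncn d^-1).+1; rewrite -[ltRHS]invrK ltf_pV2 ?posrE ?exprn_gt0 ?invr_gt0//.
  apply: (lt_trans (truncnS_gt _)); by rewrite -natrX ltr_nat ltn_expl.
exists m, d => // y yx s t s01 t01 st; apply: dP => //; exact: le_lt_trans mP.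
Qed.

Lemma log_on_strip : exists L, forall u, strip al be u -> ccont L u /\ cexp (L u) = H u.
Proof.
pose L x := xget 0 [set l | exists m, forall k, (m <= k)%N -> dyadic_log k x = l].
have LE m x : strip al be x -> fine_at m x -> L x = dyadic_log m x.
  move=> sx fx; rewrite /L; case: xgetP => [l _ [n nP]|/(_ (dyadic_log m x))].
    by rewrite -(nP (m + n)%N (leq_addl _ _)) dyadic_log_stable.
  by case; exists m => k mk; rewrite -(subnKC mk) dyadic_log_stable.
exists L => u su; have [m [d d0 dP]] := fine_near su.
have [d' d'0 d'P] := strip_nbhs su.
have fu : fine_at m u by apply: dP; rewrite subrr normc0.
split; last by rewrite (LE m)// cexp_dyadic_log.
apply: (@ccont_near _ (dyadic_log m) _ _ (Num.min d d')).
- by rewrite lt_min d0.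
- by move=> w; rewrite lt_min => /andP[/dP fw /d'P sw]; rewrite (LE m).
- exact: ccont_dyadic_log.
Qed.

End LogarithmOnStrip.

(** * Continuous functions with values in 2 pi i Z *)

Section IntegerValued.
Variable R : realType.

Definition two_pi_i (m : int) : R[i] := 0 +i* (2 * pi * m%:~R).

Lemma two_pi_iD m n : two_pi_i (m + n) = two_pi_i m + two_pi_i n.
Proof. by apply: complex_eqP; rewrite (cReD, cImD) /= ?addr0// intrD mulrDr. Qed.

Lemma two_pi_iMn m n : two_pi_i (m *+ n) = n%:R * two_pi_i m.
Proof.
elim: n => [|n ih]; first by rewrite mulr0n mul0r /two_pi_i mulr0.
by rewrite mulrS two_pi_iD ih -natr1; ring.
Qed.

Lemma two_pi_i_sep m n : normc (two_pi_i m - two_pi_i n) < 2 * pi -> two_pi_i m = two_pi_i n.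
Proof.
have pp : 0 < 2 * pi :> R by rewrite mulr_gt0// pi_gt0.
move=> /(le_lt_trans (Im_le_normc _)); rewrite cImD cImN /= -mulrBr -intrB.
rewrite normrM gtr0_norm// gtr_pMr// -intr_norm -[1]/(1%:~R) ltr_int => h.
have : m - n == 0 by rewrite -normr_le0 leNgt gtz0_ge1 -ltNge.
by rewrite subr_eq0 => /eqP ->.
Qed.

(** Points of 2 pi i Z are 2 pi apart, so two of them within pi of a common point coincide; a chain
    of equally spaced parameters with uniform mesh carries this from [a] to [b]. *)
Lemma int_valued_seg_const (N : R[i] -> R[i]) (a b : R[i]) :
  (forall t : R, 0 <= t <= 1 -> ccont N (seg a b t) /\ exists m, N (seg a b t) = two_pi_i m) ->
  N a = N b.
Proof.
move=> Nab; have p0 := pi_gt0 R.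
have Q t : 0 <= t <= 1 -> exists2 e : R, 0 < e & forall x y,
    normc (x - N (seg a b t)) < e -> normc (y - N (seg a b t)) < e ->
    (exists m, x = two_pi_i m) -> (exists m, y = two_pi_i m) -> x = y.
  move=> t01; exists pi => // x y xt yt [m xm] [k yk].
  rewrite xm yk in xt yt *; apply: two_pi_i_sep.
  apply: (le_lt_trans (normc_triangle (N (seg a b t)) _ _)).
  by rewrite (normc_distC (N _)); lra.
have [d d0 dP] := seg_uniform (fun t t01 => (Nab t t01).1) Q.
pose n := (Num.truncn d^-1).+1.
  have nd : n%:R^-1 < d.
    by rewrite -[ltRHS]invrK ltf_pV2 ?posrE ?ltr0n ?invr_gt0// truncnS_gt.
  have n0 : 0 < n%:R :> R by rewrite ltr0n.
  have t01 k : (k <= n)%N -> 0 <= (k%:R / n%:R : R) <= 1.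
    by move=> kn; rewrite divr_ge0//= ler_pdivrMr// mul1r ler_nat.
  have step k : (k <= n)%N -> N (seg a b (k%:R / n%:R)) = N a.
    elim: k => [|k ih] kn; first by rewrite mul0r seg0.
    rewrite -(ih (ltnW kn)); apply: dP; rewrite ?subrr ?normc0//.
    - exact: t01.
    - exact: t01 (ltnW kn).
    - by rewrite -mulrBl -natr1 addrAC subrr add0r mul1r ger0_norm// invr_ge0.
    - exact: (Nab _ (t01 _ kn)).2.
    - exact: (Nab _ (t01 _ (ltnW kn))).2.
  by rewrite -(step n (leqnn n)) divff ?gt_eqF// seg1.
Qed.

End IntegerValued.

(** * Escape and realness of the Poincare function [f] *)

Section PoincareFunction.
Variables (R : realType) (p : {poly R}) (lambda : R) (f : R[i] -> R[i]) (alpha beta : R).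
Hypotheses (pm : p \is monic) (d2 : (2 <= (size p).-1)%N) (p0 : p.[0] = 0)
  (pl : lambda = p^`().[0]) (l1 : 1 < lambda)
  (fc : forall z, ccont f z) (ff : forall z, f (lambda%:C * z) = ceval p (f z))
  (f0 : f 0 = 0) (df : cder f 0 1)
  (esc : sector alpha beta `<=` escaping_set p).

Let Lam := ln lambda.
Let Lam0 : 0 < Lam. Proof. exact: ln_gt0. Qed.
Let l0 : 0 < lambda. Proof. exact: lt_trans l1. Qed.

Lemma ceval_p0 : ceval p 0 = 0.
Proof. by rewrite -[0]/(0%:C) ceval_real p0. Qed.

Lemma iter_p0 n : iter n (ceval p) 0 = 0.
Proof. by elim: n => [//|n ih]; rewrite iterS ih ceval_p0. Qed.

Lemma poincare_iter n z : f ((lambda ^+ n)%:C * z) = iter n (ceval p) (f z).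
Proof.
elim: n => [|n ih]; first by rewrite expr0 mul1r.
by rewrite iterS -ih -ff exprS realCM mulrA.
Qed.

(* z |-> lambda ^ n * z in the coordinate u = log z. *)
Definition shift_log n (u : R[i]) : R[i] := u + (n%:R * Lam)%:C.

Lemma shift_logD m n u : shift_log m (shift_log n u) = shift_log (m + n) u.
Proof. by rewrite /shift_log natrD mulrDl realCD addrA addrAC. Qed.

Lemma shift_log0 u : shift_log 0 u = u.
Proof. by rewrite /shift_log mul0r addr0. Qed.

Lemma Im_shift_log n u : complex.Im (shift_log n u) = complex.Im u.
Proof. by rewrite cImD /= addr0. Qed.

Lemma Re_shift_log n u : complex.Re (shift_log n u) = complex.Re u + n%:R * Lam.
Proof. by rewrite cReD. Qed.

Lemma strip_shift_log (a b : R) n u : strip a b u -> strip a b (shift_log n u).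
Proof. by rewrite /strip /= Im_shift_log. Qed.

Lemma cexp_shift_log n u : cexp (shift_log n u) = (lambda ^+ n)%:C * cexp u.
Proof.
rewrite /shift_log addrC cexpD cexp_real; congr (_%:C * _).
by rewrite expRM_natl /Lam lnK ?posrE.
Qed.

Lemma poincare_shift n u : f (cexp (shift_log n u)) = iter n (ceval p) (f (cexp u)).
Proof. by rewrite cexp_shift_log poincare_iter. Qed.

Lemma escaping_iter z n : escaping_set p z -> escaping_set p (iter n (ceval p) z).
Proof.
move=> /cvgryPgt h; apply/cvgryPgt => A; have [N _ NP] := h A.
by exists N => // m /= Nm; rewrite -iterD; apply: NP; exact: leq_trans (leq_addr _ _).
Qed.

Lemma escapingP z : escaping_set p z -> forall A : R, exists n, A < normc (iter n (ceval p) z).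
Proof.
move=> /cvgryPgt h A; have [n _ nP] := h A; exists n; exact: nP (leqnn n).
Qed.

Lemma escaping_neq0 z : escaping_set p z -> z != 0.
Proof.
move=> /escapingP/(_ 0)[n]; apply: contraTneq => ->.
by rewrite iter_p0 normc0 ltxx.
Qed.

Lemma exists_small (z : R[i]) (e : R) : 0 < e -> exists n, normc z < e * lambda ^+ n.
Proof.
move=> e0; exists (Num.truncn (normc z / e / (lambda - 1))).+1.
set n := _.+1; rewrite mulrC -ltr_pdivrMr//.
apply: (@lt_le_trans _ _ (n%:R * (lambda - 1))).
  by rewrite -ltr_pdivrMr ?subr_gt0//; exact: truncnS_gt.
have h m : m%:R * (lambda - 1) + 1 <= lambda ^+ m.
  elim: m => [|m ih]; first by rewrite mul0r add0r.
  have m0 : 0 <= m%:R * (lambda - 1) by rewrite mulr_ge0// subr_ge0 ltW.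
  rewrite -natr1 exprS.
  have h1 : 0 <= lambda - 1 by rewrite subr_ge0 ltW.
  have h2 : 0 <= lambda ^+ m - 1 by rewrite subr_ge0 exprn_ege1// ltW.
  have := mulr_ge0 h1 h2.
  by move: m0 ih; generalize (lambda ^+ m) => x; lra.
by have := h n; lra.
Qed.

Lemma poincare_sector_escapes u : strip alpha beta u -> escaping_set p (f (cexp u)).
Proof.
move=> su; have [eta eta0 etaP] := strip_nbhs su.
have [e e0 eP] := ccont_clog (ltr01 : 0 < complex.Re (1 : R[i])) eta0.
(* [e / 2] makes the logarithm of [f w / w] smaller than [eta], so the argument of [f w] stays in
   the sector; [1 / 2] keeps the ratio in the right half-plane, where [clog] is a logarithm. *)
pose e' := Num.min (e / 2) (1 / 2).
have e'0 : 0 < e' by rewrite lt_min !divr_gt0.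
have [t t0 tP] := df e'0.
have [n nP] := exists_small (cexp u) t0.
have ln0 : 0 < lambda ^+ n by rewrite exprn_gt0.
pose w := cexp u / (lambda ^+ n)%:C.
have uw : cexp u = (lambda ^+ n)%:C * w by rewrite /w mulrC divfK// realC_eq0 gt_eqF.
have w0 : w != 0 by rewrite mulf_neq0 ?cexp_neq0// invr_eq0 realC_eq0 gt_eqF.
have wt : normc (w - 0) < t.
  by rewrite subr0 normc_div normc_real gtr0_norm// ltr_pdivrMr.
rewrite uw poincare_iter; apply: escaping_iter.
apply: esc; apply/sectorP.
have := tP w wt; rewrite f0 !subr0 mul1r => fw.
pose q := f w / w; have fE : f w = w * q by rewrite /q mulrC divfK.
have nw : 0 < normc w by rewrite normc_gt0.
have q1 : normc (q - 1) <= e'.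
  have -> : q - 1 = (f w - w) / w by rewrite /q; field.
  by rewrite normc_div ler_pdivrMr.
have q1e : normc (q - 1) < e.
  by apply: (le_lt_trans q1); rewrite /e' gt_min; apply/orP; left; lra.
have qr : 0 < complex.Re q.
  have h : normc (q - 1) <= 1 / 2 by apply: (le_trans q1); rewrite /e' ge_min lexx orbT.
  have := Re_le_normc (q - 1); rewrite cReD ler_norml /= => /andP[h1 h2].
  by lra.
have := eP q q1e; rewrite clog1 subr0 => lq.
exists (u - (n%:R * Lam)%:C + clog q); split.
  rewrite cexpD clogK// fE cexpB; congr (_ * _).
  by rewrite cexp_real expRM_natl /Lam lnK ?posrE.
have /etaP : normc (u + clog q - u) < eta by rewrite addrAC subrr add0r.
by rewrite /strip /= !cImD cImN /= subr0.
Qed.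


(** Every point far to the right is a shift of a point of the compact rectangle [0, ln lambda] x
    [a, b]. Escape at one time is an open condition and persists by [growth], so compactness gives
    one number of shifts for the whole rectangle. *)
Lemma poincare_uniform_escape (a b A : R) : alpha < a -> b < beta ->
  exists X : R, forall u, a <= complex.Im u <= b -> X < complex.Re u ->
    A < normc (f (cexp u)).
Proof.
move=> aa bb; have [Mp Mp1 growth] := ceval_growth pm d2.
pose A' := Num.max A Mp.
have stay z n : A' < normc z -> A' < normc (iter n (ceval p) z).
  move=> zA; elim: n => [//|n ih]; rewrite iterS.
  have Mi : Mp < normc (iter n (ceval p) z) by apply: le_lt_trans ih; rewrite /A' le_max lexx orbT.
  by have := growth _ Mi; lra.
pose P (N : nat) (q : R * R) := forall n, (N <= n)%N ->
  A' < normc (f (cexp (shift_log n (q.1 +i* q.2)))).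
have cK := compact_setX (@segment_compact R 0 Lam) (@segment_compact R a b).
have /compact_near_coveringP/(_ nat \oo P _) := cK; case.
  move=> [x y] [/=]; rewrite !in_itv/= => _ /andP[ya yb].
  pose u : R[i] := x +i* y.
  have su : strip alpha beta u by rewrite /strip /=; apply/andP; split; lra.
  have [n nA] := escapingP (poincare_sector_escapes su) A'.
  have c1 : ccont (fun v => f (cexp (shift_log n v))) u.
    apply: (@ccont_comp _ (fun v => cexp (shift_log n v)) f); last exact: fc.
    apply: (@ccont_comp _ (shift_log n) (@cexp R)); last exact: ccont_cexp.
    by apply: ccontD; [exact: ccont_id|exact: ccont_cst].
  rewrite -poincare_shift in nA.
  have e0 : 0 < normc (f (cexp (shift_log n u))) - A' by rewrite subr_gt0.
  have [d d0 dP] := c1 _ e0.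
  exists (ball x (d / 2) `*` ball y (d / 2), [set m | (n <= m)%N]) => /=.
    split; last by exists n.
    by exists (ball x (d / 2), ball y (d / 2)) => //=; split; apply: nbhsx_ballx; rewrite divr_gt0.
  move=> [[x' y'] N] /= [[xx yy] nN] m Nm /=.
  have := dP (x' +i* y'); set v : R[i] := x' +i* y' => vd.
  have {}vd : A' < normc (f (cexp (shift_log n v))).
    have vu : normc (v - u) < d.
      apply: (le_lt_trans (normc_le_ReIm _)); rewrite cReD cReN cImD cImN /=.
      by move: xx yy; rewrite /ball /= !(distrC _ x') !(distrC _ y'); lra.
    have := normc_lbB (f (cexp (shift_log n u))) (f (cexp (shift_log n v))).
    by rewrite normc_distC; have := vd vu; lra.
  have nm : (n <= m)%N by exact: leq_trans nN Nm.
  by rewrite -(subnK nm) -shift_logD poincare_shift; exact: stay.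
move=> N _ NP; exists (N%:R * Lam) => u uab uN.
have N0 : 0 <= N%:R * Lam by rewrite mulr_ge0// ltW.
pose n := Num.truncn (complex.Re u / Lam).
have uL : 0 <= complex.Re u / Lam by rewrite divr_ge0 ?(ltW Lam0)//; lra.
have /andP[n1 n2] := truncn_itv uL.
rewrite -/n ler_pdivlMr// in n1; rewrite -/n ltr_pdivrMr// -natr1 mulrDl mul1r in n2.
have Nn : (N <= n)%N by rewrite truncn_ge_nat// ler_pdivlMr// ltW.
have uE : u = shift_log n ((complex.Re u - n%:R * Lam) +i* complex.Im u).
  by apply: complex_eqP; rewrite (Im_shift_log, Re_shift_log) /= ?subrK.
rewrite uE; apply: (@le_lt_trans _ _ A'); first by rewrite /A' le_max lexx.
apply: (NP N (leqnn N) (complex.Re u - n%:R * Lam, complex.Im u)) => //=.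
by split; rewrite /= in_itv//=; apply/andP; split; lra.
Qed.

Lemma p_coef0 : p`_0 = 0.
Proof. by rewrite -horner_coef0. Qed.

Lemma p_coef1 : p`_1 = lambda.
Proof. by rewrite pl horner_coef0 coef_deriv. Qed.

(** Only degrees i >= 2 remain, and there [z ^+ i - w ^+ i] is [z - w] times i products of modulus
    at most r ^ (i - 1) <= r. *)
Lemma ceval_linear_part : exists2 C : R, 0 <= C & forall (z w : R[i]) (r : R), r <= 1 ->
  normc z <= r -> normc w <= r ->
  normc (ceval p z - ceval p w - lambda%:C * (z - w)) <= C * r * normc (z - w).
Proof.
pose C := \sum_(i < size p) `|p`_i| * i%:R.
exists C => [|z w r r1 zr wr]; first by apply: sumr_ge0 => i _; rewrite mulr_ge0.
have r0 : 0 <= r by apply: le_trans zr; exact: normc_ge0.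
have n0 := normc_ge0 (z - w).
have sp : (size p = (size p).-2.+2)%N by case: (size p) d2 => [|[]].
have -> : ceval p z - ceval p w - lambda%:C * (z - w) =
    \sum_(i < size p) (if (i < 2)%N then 0 else (p`_i)%:C * (z ^+ i - w ^+ i)).
  rewrite !cevalE -sumrB sp !big_ord_recl /= p_coef0 p_coef1 !expr0 !expr1 !subrr !add0r.
  rewrite -mulrBr addrAC subrr add0r.
  by apply: eq_bigr => i _; rewrite mulrBr.
apply: (le_trans (normc_sum _ _ _)); rewrite /C !mulr_suml; apply: ler_sum => i _.
case: ifPn => [_|]; first by rewrite normc0 !mulr_ge0.
rewrite -leqNgt => i2; rewrite normcM normc_real -!mulrA ler_wpM2l//.
rewrite subrXX normcM mulrC mulrA ler_wpM2r//.
apply: (le_trans (normc_sum _ _ _)); apply: (@le_trans _ _ (\sum_(j < i) r)).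
  apply: ler_sum => j _; rewrite normcM !normcX.
  apply: (@le_trans _ _ (r ^+ (i.-1 - j) * r ^+ j)).
    by rewrite ler_pM ?exprn_ge0 ?normc_ge0// lerXn2r ?nnegrE ?normc_ge0.
  have ji : (j <= i.-1)%N by rewrite -ltnS prednK ?ltn_ord// ltnW.
  rewrite -exprD subnK// -[leRHS]expr1 ler_wiXn2l//.
  by rewrite -ltnS prednK// ltnW.
by rewrite sumr_const card_ord mulr_natl.
Qed.

(* The gap q(t) = |f(t) - conj f(t)| exp(-K t) / t satisfies
   q(lambda t) <= q(t) for suitable K and vanishes as t -> 0. *)
Lemma poincare_real_near0 : exists2 t0 : R, 0 < t0 &
  forall t : R, 0 < t -> t < t0 -> conjc (f t%:C) = f t%:C.
Proof.
have [C C0 CP] := ceval_linear_part.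
have [d d0 dP] := df ltr01.
pose t1 := Num.min d (1 / 2).
have t10 : 0 < t1 by rewrite lt_min d0 divr_gt0.
pose D (t : R) := normc (f t%:C - conjc (f t%:C)).
have ft (t : R) : 0 < t -> t < t1 -> normc (f t%:C) <= 2 * t.
  move=> tp; rewrite lt_min => /andP[td _].
  have := dP t%:C; rewrite subr0 f0 subr0 mul1r normc_real gtr0_norm// mul1r => /(_ td).
  have := normcD (f t%:C - t%:C) t%:C; rewrite subrK normc_real gtr0_norm//; lra.
have normc_conj (z : R[i]) : normc (conjc z) = normc z.
  by case: z => x y /=; rewrite sqrrN.
have Dl (t : R) : 0 < t -> t < t1 -> D (lambda * t) <= (lambda + C * (2 * t)) * D t.
  move=> tp tt; have h := ft t tp tt.
  have t2 : t < 1 / 2 by move: tt; rewrite lt_min => /andP[].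
  have := CP (f t%:C) (conjc (f t%:C)) (2 * t); rewrite normc_conj.
  have t21 : 2 * t <= 1 by lra.
  move=> /(_ t21 h h); rewrite /D realCM ff ceval_conj -/(D t) => H.
  have := normcD (ceval p (f t%:C) - conjc (ceval p (f t%:C)) - lambda%:C * (f t%:C - conjc (f t%:C)))
    (lambda%:C * (f t%:C - conjc (f t%:C))).
  rewrite subrK normcM normc_real gtr0_norm//.
  by rewrite /D in H *; move: H; lra.
(* Chosen so that [K * (lambda - 1) = 2 * C / lambda]: the exponential then outweighs the factor
   [1 + 2 * C / lambda * t] by which [D t / t] may grow under t |-> lambda t. *)
pose K := 2 * C / lambda / (lambda - 1).
have lm1 : 0 < lambda - 1 by rewrite subr_gt0.
have lne : lambda != 0 by rewrite gt_eqF.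
pose q (t : R) := D t / t * expR (- K * t).
have q0 t : 0 < t -> 0 <= q t.
  by move=> tp; rewrite mulr_ge0 ?expR_ge0// divr_ge0 ?normc_ge0// ltW.
have ql (t : R) : 0 < t -> t < t1 -> q (lambda * t) <= q t.
  move=> tp tt; have tne : t != 0 by rewrite gt_eqF.
  have e1 : 1 + 2 * C / lambda * t <= expR (2 * C / lambda * t) by exact: expR_ge1Dx.
  have Dt0 : 0 <= D t / t by rewrite divr_ge0 ?normc_ge0// ltW.
  rewrite /q.
  have h1 : D (lambda * t) / (lambda * t) <= (1 + 2 * C / lambda * t) * (D t / t).
    rewrite ler_pdivrMr ?mulr_gt0//; apply: (le_trans (Dl t tp tt)).
    rewrite le_eqVlt; apply/orP; left; apply/eqP; field.
    by rewrite tne lne.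
  apply: (@le_trans _ _ (expR (2 * C / lambda * t) * (D t / t) * expR (- K * (lambda * t)))).
    rewrite ler_wpM2r ?expR_ge0//; apply: (le_trans h1).
    by rewrite ler_wpM2r.
  rewrite mulrC mulrA -expRD mulrC.
  have -> : - K * (lambda * t) + 2 * C / lambda * t = - K * t; last by [].
  have -> : 2 * C / lambda = K * (lambda - 1) by rewrite /K divfK// gt_eqF.
  ring.
have qn (t : R) n : 0 < t -> t < t1 -> q t <= q (t / lambda ^+ n).
  move=> tp tt; elim: n => [|n ih]; first by rewrite expr0 divr1.
  apply: (le_trans ih).
  have ln0 : 0 < lambda ^+ n.+1 by rewrite exprn_gt0.
  have -> : t / lambda ^+ n = lambda * (t / lambda ^+ n.+1).
    by rewrite exprS; field; rewrite lne expf_neq0.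
  apply: ql; first by rewrite divr_gt0.
  apply: le_lt_trans tt; rewrite ler_pdivrMr// ler_peMr ?(ltW tp)//.
  by rewrite exprn_ege1// ltW.
exists t1 => // t tp tt; apply/eqP; rewrite eq_sym -subr_eq0; apply/eqP/normc_le0.
suff : q t <= 0.
  rewrite /q pmulr_lle0 ?expR_gt0// pmulr_lle0 ?invr_gt0//.
apply/ler_addgt0Pr => e e0; rewrite add0r.
have e2 : 0 < e / 2 by rewrite divr_gt0.
have [s s0 sP] := df e2.
have [n nP] := exists_small t%:C s0; rewrite normc_real gtr0_norm// in nP.
have ln0 : 0 < lambda ^+ n by rewrite exprn_gt0.
apply: (le_trans (qn t n tp tt)).
set x := t / lambda ^+ n; have x0 : 0 < x by rewrite divr_gt0.
have xs : x < s by rewrite ltr_pdivrMr.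
have := sP x%:C; rewrite subr0 f0 subr0 mul1r normc_real gtr0_norm// => /(_ xs) h.
have Dx : D x <= e * x.
  rewrite /D.
  have -> : f x%:C - conjc (f x%:C) = (f x%:C - x%:C) - conjc (f x%:C - x%:C).
    have cB (z w : R[i]) : conjc (z - w) = conjc z - conjc w.
      by case: z => ? ?; case: w => ? ?; apply: complex_eqP => /=; ring.
    by rewrite cB conjc_real; ring.
  by apply: (le_trans (normcB _ _)); rewrite normc_conj; lra.
apply: (@le_trans _ _ (D x / x)); last by rewrite ler_pdivrMr.
have Dx0 : 0 <= D x / x by rewrite divr_ge0 ?normc_ge0// ltW.
rewrite /q ler_piMr//; apply: (le_trans _ (_ : expR 0 <= 1)); last by rewrite expR0.
rewrite ler_expR mulNr oppr_le0 mulr_ge0 ?(ltW x0)//.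
by rewrite /K !divr_ge0 ?mulr_ge0// ltW.
Qed.

End PoincareFunction.

(** * Opening of an escaping sector, and the positive axis *)

Section EscapingSector.
Variables (R : realType) (p : {poly R}) (lambda : R) (alpha beta : R).
Hypotheses (d2 : (2 <= (size p).-1)%N) (p0 : p.[0] = 0)
  (pl : lambda = p^`().[0]) (l1 : 1 < lambda)
  (esc : sector alpha beta `<=` escaping_set p).

(* [p] has a nonzero root, which does not escape. *)
Lemma escaping_sector_width : beta - alpha <= 2 * pi.
Proof.
rewrite leNgt; apply/negP => wide; have pi0 := pi_gt0 R.
have full z : z != 0 -> sector alpha beta z.
  (* [a'] is the left end of the window of length 2 pi centred in ]alpha, beta[; an argument of [z]
     can be moved into it. *)
  move=> /cexp_surj[l lz]; pose a' := (alpha + beta - 2 * pi) / 2.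
  pose m := Num.floor ((complex.Im l - a') / (2 * pi)).
  have /andP[m1 m2] := Num.Theory.floor_itv ((complex.Im l - a') / (2 * pi)).
  have pp : 0 < 2 * pi :> R by rewrite mulr_gt0.
  rewrite -/m ler_pdivlMr// in m1; rewrite -/m intrD ltr_pdivrMr// in m2.
  apply/sectorP; exists (l + (0 +i* (2 * pi * (- m)%:~R))).
  rewrite cexp_periodic lz; split=> //.
  rewrite cImD /= mulrNz; move: m2; rewrite mulrDl mul1r => m2.
  have := m1; have := m2; rewrite /a'; move: (m%:~R : R) => x; move=> *.
  by apply/andP; split; lra.
pose P := map_poly (real_complex R) p.
have P0 : root P 0 by rewrite /root -[P.[0]]/(ceval p 0) ceval_p0.
(* Since p'(0) = lambda is nonzero, 0 is a simple root: the cofactor [Q] of degree d - 1 >= 1 has a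
   root, and that root differs from 0. *)
have [Q PQ] := factor_theorem _ _ P0.
have Q0 : Q.[0] = lambda%:C.
  have : P^`().[0] = lambda%:C.
    by rewrite /P deriv_map -[0]/(0%:C) horner_map /= -pl.
  rewrite PQ derivM hornerD !hornerM hornerD hornerN hornerX !hornerC subrr mulr0 add0r.
  by rewrite derivB derivX derivC subr0 hornerC mulr1.
have sQ : size Q != 1%N.
  have sP : size P = size p by rewrite size_map_poly.
  have Q0' : Q != 0.
    apply/eqP => Qz; move: Q0; rewrite Qz horner0 => /esym/eqP.
    by rewrite realC_eq0 gt_eqF// (lt_trans ltr01 l1).
  have : size P = (size Q).+1.
    by rewrite PQ size_Mmonic ?monicXsubC// size_XsubC addn2.
  by rewrite sP => s; move: d2; rewrite s /=; case: (size Q) => [|[]].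
have [z zQ] := closed_rootP Q sQ.
have z0 : z != 0.
  apply: contraTneq zQ => ->; rewrite /root Q0 realC_eq0 gt_eqF//.
  exact: lt_trans l1.
have pz : ceval p z = 0 by rewrite /ceval -/P PQ hornerM (rootP zQ) mul0r.
have [n] := escapingP (esc (full z z0)) (normc z).
case: n => [|n]; first by rewrite ltxx.
by rewrite iterSr pz iter_p0// normc0 ltNge normc_ge0.
Qed.

(** A positive real number with a nonpositive value of [p] would yield, by the intermediate value
    theorem, a positive root, which lies in the sector without escaping. So [p] preserves the
    positive axis, and positivity of [f] spreads from small t by the functional equation. The
    integer [j] occurs because alpha and beta are not normalized: the axis may have any argument 2
    pi j. *)
Lemma poincare_pos_ray (f : R[i] -> R[i]) (x : R) :
  (forall z, f (lambda%:C * z) = ceval p (f z)) -> f 0 = 0 -> cder f 0 1 ->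
  0 < x -> sector alpha beta x%:C ->
  (exists j : int, alpha < 2 * pi * j%:~R < beta) /\
  forall t : R, 0 < t -> exists2 y : R, 0 < y & f t%:C = y%:C.
Proof.
move=> ff f0 df x0 /sectorP[l [lx lab]].
have lam0 : 0 < lambda by exact: lt_trans l1.
have [j jE] : exists j : int, complex.Im l = 2 * pi * j%:~R.
  have : cexp (l - (ln x)%:C) = 1.
    by rewrite cexpB lx cexp_ln// divff// realC_eq0 gt_eqF.
  move=> /cexp_eq1[j /complex_eq[_]]; rewrite cImD /= oppr0 addr0 => h; by exists j.
rewrite jE in lab; split; first by exists j.
have posesc (y : R) : 0 < y -> escaping_set p y%:C.
  move=> y0; apply: esc; apply/sectorP; exists ((ln y)%:C + two_pi_i R j).
  by rewrite cexp_periodic cexp_ln//; rewrite cImD /= add0r.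
have [C C0 CP] := ceval_linear_part d2 p0 pl.
have pos_small : exists2 s : R, 0 < s & forall y : R, 0 < y -> y < s -> 0 < p.[y].
  exists (Num.min 1 (lambda / (C + 1))); first by rewrite lt_min ltr01 divr_gt0//; lra.
  move=> y y0; rewrite lt_min => /andP[y1 y2].
  have := CP y%:C 0 y (ltW y1); rewrite normc0 normc_real gtr0_norm// => /(_ (lexx _) (ltW y0)).
  rewrite ceval_p0// !subr0 ceval_real -realCM -rmorphB normc_real normc_real [`|y|]gtr0_norm//.
  rewrite ltr_pdivlMr in y2; last lra.
  move=> h; have h2 := le_trans (ler_norm _) (_ : `|- (p.[y] - lambda * y)| <= C * y * y).
  rewrite normrN in h2; have {h2} := h2 h.
  have : 0 < (lambda - y * C) * y by rewrite mulr_gt0//; lra.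
  by lra.
have [s s0 sP] := pos_small.
have ppos (y : R) : 0 < y -> 0 < p.[y].
  move=> y0; rewrite ltNge; apply/negP => py.
  pose a := Num.min y (s / 2).
  have a0 : 0 < a by rewrite lt_min y0 divr_gt0.
  have pa : 0 < p.[a] by apply: sP => //; rewrite gt_min; apply/orP; right; lra.
  have ay : a <= y by rewrite ge_min lexx.
  have := @poly_ivt R (- p) a y ay; rewrite !hornerN oppr_le0 oppr_ge0 (ltW pa) py.
  move=> /(_ isT)[z /andP[az _]]; rewrite rootN => /rootP pz.
  have z0 : 0 < z by apply: lt_le_trans az.
  have [n] := escapingP (posesc z z0) `|z|.
  case: n => [|n]; first by rewrite [iter _ _ _]/= normc_real ltxx.
  by rewrite iterSr ceval_real pz iter_p0// normc0 ltNge normr_ge0.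
have [t0 t00 tP] := poincare_real_near0 d2 p0 pl l1 ff f0 df.
have half : 0 < 1 / 2 :> R by lra.
have [t1 t10 t1P] := df _ half.
have near0 (t : R) : 0 < t -> t < t0 -> t < t1 -> exists2 y : R, 0 < y & f t%:C = y%:C.
  move=> tp tt0 tt1; have := tP t tp tt0; have := t1P t%:C.
  rewrite subr0 f0 subr0 mul1r normc_real gtr0_norm// => /(_ tt1).
  case: (f t%:C) => u v /(le_trans (Re_le_normc _)); rewrite cReD ler_norml /=.
  move=> /andP[h1 h2] [hv]; exists u; first lra.
  by apply: complex_eqP => //=; lra.
move=> t tp.
have m0 : 0 < Num.min t0 t1 by rewrite lt_min t00.
have [n nP] := exists_small l1 t%:C m0; rewrite normc_real gtr0_norm// in nP.
have ln0 : 0 < lambda ^+ n by rewrite exprn_gt0.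
have := nP; rewrite -ltr_pdivrMr// lt_min => /andP[n1 n2].
have [y y0 fy] := near0 _ (divr_gt0 tp ln0) n1 n2.
have -> : t%:C = (lambda ^+ n)%:C * (t / lambda ^+ n)%:C.
  by rewrite -realCM mulrC divfK// gt_eqF.
rewrite (poincare_iter ff) fy.
elim: n {nP ln0 n1 n2 fy} => [|n [w w0 E]]; first by exists y.
by exists p.[w]; [exact: ppos|rewrite iterS E ceval_real].
Qed.

End EscapingSector.

(** * The phase: a logarithm of the Boettcher function along [f] *)

Section PhaseFunction.
Variables (R : realType) (p : {poly R}) (d : nat) (lambda : R) (f : R[i] -> R[i]).
Variables (alpha beta : R).
Hypotheses (pm : p \is monic) (pd : size p = d.+1) (d2 : (2 <= d)%N)
  (p0 : p.[0] = 0) (pl : lambda = p^`().[0]) (l1 : 1 < lambda)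
  (fd : forall z, exists l, cder f z l)
  (ff : forall z, f (lambda%:C * z) = ceval p (f z))
  (f0 : f 0 = 0) (df : cder f 0 1)
  (esc : sector alpha beta `<=` escaping_set p) (ab : alpha < beta).

Let h := inv_boettcher p.
Let Lam := ln lambda.
Let Lam0 : 0 < Lam. Proof. exact: ln_gt0. Qed.
Let shift := shift_log lambda.
Let S := strip alpha beta.
Let d2' : (2 <= (size p).-1)%N. Proof. by rewrite pd. Qed.
Let fc z : ccont f z. Proof. by have [l] := fd z; exact: cder_ccont. Qed.
Let dR : 0 < d%:R :> R. Proof. by rewrite ltr0n ltnW. Qed.

Variables (g0 : R[i] -> R[i]) (M B Mp : R) (ell : R[i] -> R[i]).
Hypotheses (M1 : 1 <= M) (B0 : 0 <= B)
  (hP : forall w, M < normc w -> exists2 m, m != 0 & cder h w m)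
  (gP : forall z, M + B < normc z -> [/\ M < normc (g0 z), h (g0 z) = z,
    normc (g0 z - z) <= B, g0 (ceval p z) = g0 z ^+ d & ccont g0 z])
  (growth : forall z, Mp < normc z -> 2 * normc z < normc (ceval p z))
  (ellP : forall u, S u -> ccont ell u /\ cexp (ell u) = f (cexp u)).

(** Beyond [M + 2 * B + 1] the ratio [g0 z / z] is within 1 / 2 of 1, hence in the domain of [clog];
    beyond [Mp] the modulus grows under [p], which makes [good_point] invariant under [shift 1]. *)
Let A0 := Num.max Mp (M + 2 * B + 1).

Definition good_point (u : R[i]) := S u /\ A0 < normc (f (cexp u)).
Let good := good_point.

(* A branch of log (g0 (f (exp u))), with g0 the Boettcher function. *)
Definition log_boettcher (u : R[i]) : R[i] :=
  ell u + clog (g0 (f (cexp u)) / f (cexp u)).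
Let A := log_boettcher.

Let good_far u : good u -> M + 2 * B + 1 < normc (f (cexp u)) /\ Mp < normc (f (cexp u)).
Proof. by move=> [_]; rewrite gt_max => /andP[]. Qed.

Let good_far' u : good u -> M + B < normc (f (cexp u)).
Proof. by move=> /good_far[h1 _]; have := B0; lra. Qed.

Let fS u : f (cexp (shift 1 u)) = ceval p (f (cexp u)).
Proof. by rewrite /shift (poincare_shift l1 ff). Qed.

Let goodS u : good u -> good (shift 1 u).
Proof.
move=> gu; have [h1 h2] := good_far gu; case: gu => Su uA.
split; first exact: strip_shift_log.
by rewrite fS; apply: (lt_trans uA); have := growth h2; have := normc_ge0 (f (cexp u)); lra.
Qed.

Let ratio_close z : M + 2 * B + 1 < normc z ->
  normc (g0 z / z - 1) <= B / normc z /\ 0 < complex.Re (g0 z / z).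
Proof.
have M1' := M1; have B0' := B0.
move=> zA; have nz : 0 < normc z by lra.
have z0 : z != 0 by rewrite -normc_gt0.
have [|_ _ gB _ _] := gP (z := z); first by have := B0; lra.
have q : normc (g0 z / z - 1) <= B / normc z.
  have -> : g0 z / z - 1 = (g0 z - z) / z by field.
  by rewrite normc_div ler_pM2r ?invr_gt0.
split=> //; have B2 : B / normc z <= 1 / 2 by rewrite ler_pdivrMr//; lra.
have := Re_le_normc (g0 z / z - 1); rewrite cReD ler_norml /= => /andP[h1 h2].
lra.
Qed.

Let cexp_A u : good u -> cexp (A u) = g0 (f (cexp u)).
Proof.
have M1' := M1; have B0' := B0.
move=> gu; have [h1 _] := good_far gu; have [_ r0] := ratio_close h1.
rewrite /A /log_boettcher cexpD clogK//; have [_ ->] := ellP gu.1.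
by rewrite mulrCA divff ?mulr1// -normc_gt0; lra.
Qed.

Let ccont_fexp u : ccont (fun w => f (cexp w)) u.
Proof. by apply: ccont_comp; [exact: ccont_cexp|exact: fc]. Qed.

Let ccont_A u : good u -> ccont A u.
Proof.
have M1' := M1; have B0' := B0.
move=> gu; have [h1 _] := good_far gu; have [_ r0] := ratio_close h1.
have [_ _ _ _ cg] := gP (good_far' gu).
apply: ccontD; first by case: (ellP gu.1).
apply: (@ccont_comp _ (fun u => g0 (f (cexp u)) / f (cexp u)) (@clog R)); last exact: ccont_clog.
apply: ccontM; first exact: (@ccont_comp _ (fun u => f (cexp u)) g0).
apply: (@ccont_comp _ (fun u => f (cexp u)) GRing.inv) => //.
by apply: ccontV; rewrite -normc_gt0; lra.
Qed.

(* Lies in 2 * pi * i * Z and is constant far out in the sector; a constant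
   shift of [log_boettcher] by 1 / (d - 1) times it removes it, and leaves the
   root of unity [phase_root] behind. *)
Definition branch_defect (u : R[i]) : R[i] :=
  log_boettcher (shift_log lambda 1 u) - d%:R * log_boettcher u.
Let N := branch_defect.

Let N_int u : good u -> exists m, N u = two_pi_i R m.
Proof.
move=> gu; have gS := goodS gu; have [_ _ _ gp _] := gP (good_far' gu).
apply: cexp_eq1; rewrite /N /branch_defect cexpB cexp_natl -/A.
have -> : cexp (A (shift_log lambda 1 u)) = cexp (A u) ^+ d.
  by rewrite cexp_A// fS gp -cexp_A.
by rewrite divff// expf_neq0// cexp_neq0.
Qed.

Let ccont_shift n u : ccont (shift n) u.
Proof. by apply: ccontD; [exact: ccont_id|exact: ccont_cst]. Qed.

Let ccont_N u : good u -> ccont N u.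
Proof.
move=> gu; apply: ccontD.
  by apply: (@ccont_comp _ (shift 1) A) => //; apply: ccont_A; exact: goodS.
have cdA : ccont (fun u => d%:R * A u) u.
  by apply: ccontM; [exact: ccont_cst|exact: ccont_A].
move=> e e0; have [t t0 tP] := cdA e e0; exists t => // w wt.
by rewrite opprK addrC normc_distC; exact: tP.
Qed.

Let half_strip (a b X : R) (u : R[i]) := a <= complex.Im u <= b /\ X < complex.Re u.

Let good_large a b : alpha < a -> b < beta ->
  exists X, forall u, half_strip a b X u -> good u.
Proof.
move=> aa bb; have [X XP] := poincare_uniform_escape pm d2' l1 fc ff f0 df esc A0 aa bb.
exists X => u [/andP[u1 u2] uX]; split; last by apply: XP => //; rewrite u1.
by rewrite /S /strip /=; apply/andP; split; lra.
Qed.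

Let N_const a b X u v : (forall u, half_strip a b X u -> good u) ->
  half_strip a b X u -> half_strip a b X v -> N u = N v.
Proof.
move=> gX [/andP[u1 u2] u3] [/andP[v1 v2] v3]; apply: int_valued_seg_const => t /andP[t0 t1].
have gt : good (seg u v t).
  apply: gX; split; rewrite /seg ?cImD ?cReD ?cImMr ?cReMr ?cImD ?cReD ?cImN ?cReN.
    have e : complex.Im u + t * (complex.Im v - complex.Im u) =
      (1 - t) * complex.Im u + t * complex.Im v by ring.
    rewrite e; have t1' : 0 <= 1 - t by lra.
    have := mulr_ge0 t0 (_ : 0 <= complex.Im v - a); rewrite subr_ge0 => /(_ v1) ?.
    have := mulr_ge0 t1' (_ : 0 <= complex.Im u - a); rewrite subr_ge0 => /(_ u1) ?.
    have := mulr_ge0 t0 (_ : 0 <= b - complex.Im v); rewrite subr_ge0 => /(_ v2) ?.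
    have := mulr_ge0 t1' (_ : 0 <= b - complex.Im u); rewrite subr_ge0 => /(_ u2) ?.
    by apply/andP; split; lra.
  have e : complex.Re u + t * (complex.Re v - complex.Re u) =
      (1 - t) * complex.Re u + t * complex.Re v by ring.
  rewrite e; have [->|tn0] := eqVneq t 0; first by have := B0; lra.
  have tp : 0 < t by rewrite lt_neqAle eq_sym tn0.
  have t1' : 0 <= 1 - t by lra.
  have := mulr_gt0 tp (_ : 0 < complex.Re v - X); rewrite subr_gt0 => /(_ v3) ?.
  have := mulr_ge0 t1' (_ : 0 <= complex.Re u - X); rewrite subr_ge0 => /(_ (ltW u3)) ?.
  lra.
by split; [exact: ccont_N|exact: N_int].
Qed.

(** Half-strips are convex, so the defect is constant on each. To get one [k] for all of them, every
    substrip is enlarged to contain the central line, and the constants are compared far out on that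
    line. *)
Lemma branch_defect_const : exists k, forall a b, alpha < a -> b < beta ->
  exists X : R, forall u, a <= complex.Im u <= b -> X < complex.Re u ->
    good_point u /\ branch_defect u = two_pi_i R k.
Proof.
have ab' := ab; pose th := (alpha + beta) / 2.
have th1 : alpha < th by rewrite /th; lra.
have th2 : th < beta by rewrite /th; lra.
have [X0 X0P] := good_large th1 th2.
pose v (X : R) : R[i] := (Num.max X X0 + 1) +i* th.
have vX a b X : a <= th <= b -> half_strip a b X (v X).
  move=> ath; split=> //=; have : X <= Num.max X X0 by rewrite le_max lexx.
  lra.
have vX0 X : half_strip th th X0 (v X).
  split; first by rewrite /= !lexx.
  rewrite /=; have : X0 <= Num.max X X0 by rewrite le_max lexx orbT.
  lra.
have [k kE] := N_int (X0P _ (vX0 X0)); exists k => a b aa bb.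
pose a' := Num.min a th; pose b' := Num.max b th.
have aa' : alpha < a' by rewrite lt_min aa.
have bb' : b' < beta by rewrite gt_max bb.
have [X XP] := good_large aa' bb'.
exists X => u /andP[u1 u2] uX.
have hu : half_strip a' b' X u.
  by split=> //; rewrite ge_min le_max u1 u2.
split; first exact: XP.
rewrite -kE -/N (N_const XP hu (vX a' b' X _)); last by rewrite ge_min le_max !lexx !orbT.
exact: N_const X0P (vX0 X) (vX0 X0).
Qed.

Variable k : int.
Hypothesis kP : forall a b, alpha < a -> b < beta ->
  exists X : R, forall u, a <= complex.Im u <= b -> X < complex.Re u ->
    good_point u /\ branch_defect u = two_pi_i R k.

Definition branch_shift : R[i] := two_pi_i R k / (d.-1)%:R.
Let zeta := branch_shift.

Definition phase0 (u : R[i]) : R[i] := log_boettcher u + branch_shift.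

(* The sequence on the right-hand side is eventually constant. *)
Definition phase (u : R[i]) : R[i] := xget 0 [set v | exists n0, forall n, (n0 <= n)%N ->
  v = phase0 (shift_log lambda n u) / d%:R ^+ n].

Let dE : d = (d.-1).+1. Proof. by rewrite prednK// ltnW. Qed.

Let d1_neq0 : (d.-1)%:R != 0 :> R[i].
Proof. by rewrite pnatr_eq0 -lt0n -ltnS -dE. Qed.

Let dC_neq0 : d%:R != 0 :> R[i].
Proof. by rewrite pnatr_eq0 -lt0n ltnW. Qed.

Let zetaE : (d.-1)%:R * zeta = two_pi_i R k.
Proof. by rewrite /zeta /branch_shift mulrC divfK. Qed.

Let Re_zeta : complex.Re zeta = 0.
Proof.
have : complex.Re ((d.-1)%:R * zeta) = 0 by rewrite zetaE.
rewrite -realC_nat cReMr => /eqP; rewrite mulf_eq0 => /orP[|/eqP//].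
by rewrite -realC_eq0 realC_nat (negbTE d1_neq0).
Qed.

Let phase0S u : N u = two_pi_i R k -> phase0 (shift 1 u) = d%:R * phase0 u.
Proof.
rewrite /N /branch_defect -zetaE /phase0 -/shift -/A -/zeta => NE.
have -> : A (shift 1 u) = d%:R * A u + (d.-1)%:R * zeta by rewrite -NE addrC subrK.
have -> : d%:R = (d.-1)%:R + 1 :> R[i] by rewrite natr1 -dE.
ring.
Qed.

Let stable a b X := forall u, a <= complex.Im u <= b -> X < complex.Re u ->
    good u /\ N u = two_pi_i R k.

Let half_strip_shift a b X n u : half_strip a b X u -> half_strip a b X (shift n u).
Proof.
move=> [u1 u2]; split; rewrite /shift ?Im_shift_log// Re_shift_log.
by apply: (lt_le_trans u2); rewrite lerDl mulr_ge0// ltW.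
Qed.

Let phase0_shift a b X n u : stable a b X -> half_strip a b X u ->
  phase0 (shift n u) = d%:R ^+ n * phase0 u.
Proof.
move=> st hu; elim: n => [|n ih]; first by rewrite /shift shift_log0 expr0 mul1r.
rewrite -add1n /shift -shift_logD -/(shift n u) -/(shift 1 _) phase0S.
  by rewrite ih exprS mulrA.
by have [h1 h2] := half_strip_shift n hu; case: (st _ h1 h2).
Qed.

Let phaseE a b X m u : stable a b X -> half_strip a b X (shift m u) ->
  phase u = phase0 (shift m u) / d%:R ^+ m.
Proof.
move=> st hu; have E n : phase0 (shift (n + m) u) / d%:R ^+ (n + m) = phase0 (shift m u) / d%:R ^+ m.
  rewrite /shift -shift_logD -/(shift m u) (phase0_shift n st hu) exprD.
  by field; rewrite !expf_neq0.
rewrite /phase; case: xgetP => [v _ [n0 n0P]|/(_ (phase0 (shift m u) / d%:R ^+ m))].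
  by rewrite (n0P (n0 + m)%N (leq_addr _ _)) -/shift E.
by case; exists m => n mn; rewrite -/shift -(subnK mn) E.
Qed.

(** Near each point a single shift [m] reaches a half-strip of constant defect, so [phase] is
    locally [phase0] rescaled by a fixed power of d and inherits its properties. The margin 1 in the
    choice of [m] absorbs the radius e <= 1. *)
Let phase_local u : S u -> exists a b X m (e : R), [/\ 0 < e, stable a b X &
  forall w, normc (w - u) < e -> half_strip a b X (shift m w)].
Proof.
move=> /andP[u1 u2].
pose a := (alpha + complex.Im u) / 2; pose b := (beta + complex.Im u) / 2.
have aa : alpha < a by rewrite /a; lra.
have bb : b < beta by rewrite /b; lra.
have [X XP] := kP aa bb.
pose m := (Num.truncn ((X + 1 - complex.Re u) / Lam)).+1.
have mX : X + 1 - complex.Re u < m%:R * Lam by rewrite -ltr_pdivrMr//; exact: truncnS_gt.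
pose e := Num.min 1 (Num.min (complex.Im u - a) (b - complex.Im u)).
exists a, b, X, m, e; split=> //.
  by rewrite !lt_min ltr01 !subr_gt0 /a /b; apply/andP; split; lra.
move=> w; rewrite !lt_min => /and3P[w1 wa wb].
have := Re_le_normc (w - u); have := Im_le_normc (w - u).
rewrite !ler_norml cReD cReN cImD cImN => /andP[i1 i2] /andP[r1 r2].
split; rewrite /shift ?Im_shift_log ?Re_shift_log -/Lam; first by apply/andP; split; lra.
lra.
Qed.

Let uu (u : R[i]) : normc (u - u) = 0. Proof. by rewrite subrr normc0. Qed.

Lemma phaseS u : S u -> phase (shift_log lambda 1 u) = d%:R * phase u.
Proof.
move=> Su; have [a [b [X [m [e [e0 st hu]]]]]] := phase_local Su.
have h1 : half_strip a b X (shift m u) by apply: hu; rewrite uu.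
have h2 : half_strip a b X (shift m (shift 1 u)).
  rewrite /shift shift_logD addnC -shift_logD; exact: half_strip_shift.
rewrite (phaseE st h1) -/shift (phaseE st h2).
have -> : shift m (shift 1 u) = shift 1 (shift m u) by rewrite /shift !shift_logD addnC.
by rewrite phase0S ?mulrA//; case: h1 => h3 h4; case: (st _ h3 h4).
Qed.

Let good_open u : good u -> exists2 e : R, 0 < e & forall w, normc (w - u) < e -> good w.
Proof.
move=> [Su uA]; have [a a0 aP] := strip_nbhs Su.
have e0 : 0 < normc (f (cexp u)) - A0 by rewrite subr_gt0.
have [e' e'0 eP] := @ccont_fexp u _ e0.
exists (Num.min a e'); first by rewrite lt_min a0.
move=> w; rewrite lt_min => /andP[/aP Sw /eP h1]; split=> //.
have := normc_lbB (f (cexp u)) (f (cexp w)); rewrite normc_distC => h2.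
by move: h1 h2; move: A0 => x; lra.
Qed.

Let cder_A u : good u -> exists l, cder A u l.
Proof.
move=> gu; have [gM hg _ _ _] := gP (good_far' gu).
have [m m0 dh] := hP gM; have [l dfl] := fd (cexp u).
have [e e0 eP] := good_open gu.
rewrite -(cexp_A gu) in dh.
exists (l * cexp u / (m * cexp (A u))).
apply: (cder_inverse _ e0 (ccont_A gu) (cder_comp (cder_cexp (A u)) dh)
  (cder_comp (cder_cexp u) dfl)).
  by rewrite mulf_neq0// cexp_neq0.
by move=> w /eP gw; rewrite cexp_A//; have [_ ->] := gP (good_far' gw).
Qed.

Lemma cder_phase u : S u -> exists l, cder phase u l.
Proof.
move=> Su; have [a [b [X [m [e [e0 st hu]]]]]] := phase_local Su.
have [h1 h2] : half_strip a b X (shift m u) by apply: hu; rewrite uu.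
have [gu _] := st _ h1 h2; have [l dA] := cder_A gu.
have ds : cder (shift m) u (1 + 0) by apply: cderD; [exact: cder_id|exact: cder_cst].
have d0 : cder phase0 (shift m u) (l + 0) by apply: cderD => //; exact: cder_cst.
have := cderMl ((d%:R ^+ m)^-1) (cder_comp ds d0).
move=> dd; eexists; apply: cder_near dd; first exact: e0.
by move=> w /hu hw; rewrite (phaseE st hw) mulrC.
Qed.

(** [branch_shift] is purely imaginary, so the real part is the logarithm of the modulus of
    [g0 (f (cexp u))], which exceeds M >= 1. *)
Let Re_phase0 u : good u -> 0 < complex.Re (phase0 u).
Proof.
move=> gu; rewrite /phase0 cReD -/zeta Re_zeta addr0 -expR_gt1 -normc_cexp cexp_A//.
by have [gM _ _ _ _] := gP (good_far' gu); exact: le_lt_trans gM.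
Qed.

Lemma Re_phase_gt0 u : S u -> 0 < complex.Re (phase u).
Proof.
move=> Su; have [a [b [X [m [e [e0 st hu]]]]]] := phase_local Su.
have h1 : half_strip a b X (shift m u) by apply: hu; rewrite uu.
rewrite (phaseE st h1) mulrC -realC_nat -realCX -realCV cReMr.
by rewrite mulr_gt0 ?invr_gt0 ?exprn_gt0// Re_phase0//; case: h1 => h2 h3; case: (st _ h2 h3).
Qed.

Definition phase_root : R[i] := cexp (- branch_shift).

Lemma phase_root_expr : phase_root ^+ d.-1 = 1.
Proof.
rewrite /phase_root -cexp_natl mulrN -/zeta zetaE.
have -> : - two_pi_i R k = 0 + two_pi_i R (- k).
  by apply: complex_eqP; rewrite ?add0r /= ?oppr0// mulrNz mulrN.
by rewrite cexp_periodic cexp0.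
Qed.

Lemma phase_large a b : alpha < a -> b < beta -> exists X : R, forall u,
  a <= complex.Im u <= b -> X < complex.Re u ->
  M < normc (phase_root * cexp (phase u)) /\
  h (phase_root * cexp (phase u)) = f (cexp u).
Proof.
move=> aa bb; have [X XP] := kP aa bb; exists X => u u1 u2.
have [gu _] := XP u u1 u2.
have hs : half_strip a b X (shift 0 u) by rewrite /shift shift_log0.
rewrite (phaseE XP hs) /shift shift_log0 expr0 divr1 /phase_root -cexpD /phase0.
rewrite addrC addrK -/A cexp_A//.
by have [gM hg _ _ _] := gP (good_far' gu).
Qed.

(** On the positive axis [ell] is the real logarithm of [f] up to a constant 2 pi i m, and
    [g0 z / z] tends to 1. The defect k is therefore m - d m, which is divisible by d - 1, and
    [branch_shift] is a period of the exponential. *)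
Lemma phase_root_eq1 (j : int) : alpha < 2 * pi * j%:~R < beta ->
  (forall t : R, 0 < t -> exists2 y : R, 0 < y & f t%:C = y%:C) -> phase_root = 1.
Proof.
move=> /andP[j1 j2] fpos.
pose v (t : R) : R[i] := t +i* (2 * pi * j%:~R).
have Sv t : S (v t) by rewrite /S /strip /= j1 j2.
have ev t : cexp (v t) = (expR t)%:C.
  have -> : v t = t%:C + two_pi_i R j by apply: complex_eqP; rewrite ?cReD ?cImD /= ?addr0 ?add0r.
  by rewrite cexp_periodic cexp_real.
have fv t : exists2 y : R, 0 < y & f (cexp (v t)) = y%:C.
  by rewrite ev; apply: fpos; exact: expR_gt0.
pose E u := ell u - clog (f (cexp u)).
have [m mP] : exists m, forall t, ell (v t) = clog (f (cexp (v t))) + two_pi_i R m.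
  have Eint t : ccont E (v t) /\ exists m, E (v t) = two_pi_i R m.
    have [ce ee] := ellP (Sv t); have [y y0 fy] := fv t.
    split.
      have cc : ccont (fun u => clog (f (cexp u))) (v t).
        by apply: (@ccont_comp _ (fun u => f (cexp u)) (@clog R)) => //; apply: ccont_clog; rewrite fy.
      apply: ccontD => // e e0; have [s s0 sP] := cc e e0; exists s => // w ws.
      by rewrite opprK addrC normc_distC; exact: sP.
    apply: cexp_eq1; rewrite /E cexpB ee clogK ?fy// divff// realC_eq0 gt_eqF//.
  have [m mE] := (Eint 0).2; exists m => t.
  rewrite -mE addrC -(@int_valued_seg_const R E (v t) (v 0)) ?subrK// => s _.
  have -> : seg (v t) (v 0) s = v (t + s * (0 - t)).
    apply: complex_eqP; rewrite /seg ?cReD ?cImD ?cReMr ?cImMr ?cReD ?cImD /=; first by ring.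
    by rewrite subrr mulr0 addr0.
  exact: Eint.
(* The defect combines two such deviations with weights 1 and d, so it misses 2 pi (m - d m) by at
   most 1, less than the spacing 2 pi. *)
have e0 : 0 < (d%:R + 1)^-1 :> R by rewrite invr_gt0 ltr_wpDl// ltW.
have [s s0 sP] := ccont_clog (ltr01 : 0 < complex.Re (1 : R[i])) e0.
have [X XP] := poincare_uniform_escape pm d2' l1 fc ff f0 df esc (Num.max (M + 2 * B + 1) (B / s)) j1 j2.
have [X' X'P] := kP j1 j2.
pose t := Num.max X X' + 1.
have tX : X < t /\ X' < t.
  by rewrite /t; split; apply: (@le_lt_trans _ _ (Num.max X X')); rewrite ?ltrDl ?le_max ?lexx ?orbT.
have vS r : shift 1 (v r) = v (r + Lam).
  by apply: complex_eqP; rewrite (Re_shift_log, Im_shift_log) //= mul1r.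
have ImA r : t <= r -> `|complex.Im (A (v r)) - 2 * pi * m%:~R| < (d%:R + 1)^-1.
  move=> tr; have [y y0 fy] := fv r.
  have := XP (v r); rewrite /= lexx => /(_ isT (lt_le_trans tX.1 tr)).
  rewrite gt_max => /andP[z1 z2]; have [q1 _] := ratio_close z1.
  have nz : 0 < normc (f (cexp (v r))) by rewrite fy normc_real normr_gt0 gt_eqF.
  have q2 : normc (g0 (f (cexp (v r))) / f (cexp (v r)) - 1) < s.
    by apply: (le_lt_trans q1); rewrite ltr_pdivrMr// mulrC -ltr_pdivrMr.
  have := sP _ q2; rewrite clog1 subr0; apply: le_lt_trans.
  apply: le_trans (Im_le_normc _); rewrite /A /log_boettcher mP fy clog_real !cImD /=.
  by rewrite add0r addrAC subrr add0r.
have tL : t <= t + Lam by rewrite lerDl ltW.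
have I1 := ImA t (lexx _); have I2 := ImA _ tL.
have Iv : 2 * pi * j%:~R <= complex.Im (v t) <= 2 * pi * j%:~R by rewrite /= lexx.
have [_ NE] := X'P (v t) Iv tX.2.
have kE : two_pi_i R k = two_pi_i R (m - m *+ d).
  apply: two_pi_i_sep; apply: (le_lt_trans (normc_le_ReIm _)).
  have p2 := pi_ge2 R.
  rewrite cReD cReN /= subrr normr0 add0r.
  have -> : 2 * pi * k%:~R = complex.Im (A (v (t + Lam))) - d%:R * complex.Im (A (v t)).
    rewrite -[LHS]/(complex.Im (two_pi_i R k)) -NE /branch_defect -/shift vS.
    by rewrite cImD cImN -realC_nat cImMr.
  have mE' : (m - m *+ d)%:~R = m%:~R - d%:R * m%:~R :> R.
    by rewrite rmorphB rmorphMn -mulr_natl.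
  rewrite mE'.
  set x1 := complex.Im _ in I2 *; set x0 := complex.Im _ in I1 *.
  have -> : x1 - d%:R * x0 - 2 * pi * (m%:~R - d%:R * m%:~R) =
    (x1 - 2 * pi * m%:~R) - d%:R * (x0 - 2 * pi * m%:~R) by ring.
  apply: (le_lt_trans (ler_normB _ _)); rewrite normrM (gtr0_norm dR).
  have I1' : d%:R * `|x0 - 2 * pi * m%:~R| <= d%:R * (d%:R + 1)^-1.
    by rewrite ler_wpM2l ?(ltW dR)// ltW.
  have one : d%:R * (d%:R + 1)^-1 + (d%:R + 1)^-1 = 1 :> R.
    by rewrite -[X in _ + X]mul1r -mulrDl divff// gt_eqF// ltr_wpDl// ltW.
  lra.
have zE : zeta = - two_pi_i R m.
  apply: (mulfI d1_neq0); rewrite zetaE kE.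
  have -> : m - m *+ d = - (m *+ d.-1) by rewrite {1}dE mulrS opprD addrA subrr add0r.
  have -> : two_pi_i R (- (m *+ d.-1)) = - two_pi_i R (m *+ d.-1).
    by apply: complex_eqP; rewrite /= ?oppr0// mulrNz mulrN.
  by rewrite two_pi_iMn mulrN.
by rewrite /phase_root -/zeta zE opprK -[two_pi_i R m]add0r cexp_periodic cexp0.
Qed.

End PhaseFunction.

(** * From the phase on the strip to the expansion in the sector *)

Lemma phase_exists (R : realType) (p : {poly R}) (d : nat) (lambda : R)
    (f : R[i] -> R[i]) (alpha beta : R) :
  p \is monic -> size p = d.+1 -> (2 <= d)%N ->
  p.[0] = 0 -> lambda = p^`().[0] -> 1 < lambda ->
  (forall z, exists l, cder f z l) ->
  (forall z, f (lambda%:C * z) = ceval p (f z)) ->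
  f 0 = 0 -> cder f 0 1 -> sector alpha beta `<=` escaping_set p -> alpha < beta ->
  exists (Phi : R[i] -> R[i]) (omega : R[i]), [/\
    omega ^+ d.-1 = 1,
    (exists2 x : R, 0 < x & sector alpha beta x%:C) -> omega = 1,
    omega != 0,
    forall u, strip alpha beta u ->
      [/\ Phi (u + (ln lambda)%:C) = d%:R * Phi u, exists l, cder Phi u l &
          0 < complex.Re (Phi u)] &
    forall a b, alpha < a -> b < beta -> exists X : R, forall u,
      a <= complex.Im u <= b -> X < complex.Re u ->
      let w := omega * cexp (Phi u) in
      has_csum (fun n => inv_boettcher_coef p n / w ^+ n) (f (cexp u) - w) /\
      inv_boettcher p w = f (cexp u)].
Proof.
move=> pm pd d2 p0 pl l1 fd ff f0 df esc ab.
have d2' : (2 <= (size p).-1)%N by rewrite pd.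
have [g0 [M [B [M1 B0 hP gP]]]] := boettcher_exists pm pd d2.
have [Mp _ growth] := ceval_growth pm d2'.
have fc z : ccont f z by have [l] := fd z; exact: cder_ccont.
have Hc u : strip alpha beta u -> ccont (fun w => f (cexp w)) u.
  by move=> _; apply: ccont_comp; [exact: ccont_cexp|exact: fc].
have H0 u : strip alpha beta u -> f (cexp u) != 0.
  move=> su; apply: (escaping_neq0 p0).
  exact: (poincare_sector_escapes l1 ff f0 df esc su).
have smid : strip alpha beta (0 +i* ((alpha + beta) / 2)).
  by rewrite /strip /=; apply/andP; split; lra.
have [l0 l0E] := cexp_surj (H0 _ smid).
have [ell ellP] := log_on_strip Hc H0 smid l0E.
have [k kP] := branch_defect_const pm pd d2 l1 fd ff f0 df esc ab M1 B0 gP growth ellP.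
have hP' w : M < normc w -> exists2 m, m != 0 & cder (inv_boettcher p) w m.
  by move=> /hP[].
exists (phase d lambda f g0 ell k), (phase_root R d k); split.
- exact: phase_root_expr.
- move=> [x x0 xs]; have [[j jab] fpos] := poincare_pos_ray d2' p0 pl l1 esc ff f0 df x0 xs.
  exact: (phase_root_eq1 pm pd d2 l1 fd ff f0 df esc M1 B0 gP ellP kP jab fpos).
- exact: cexp_neq0.
- move=> u su; split.
  + by rewrite -(phaseS d2 l1 kP su) /shift_log mul1r.
  + exact: (cder_phase d2 l1 fd M1 B0 hP' gP ellP kP su).
  + exact: (Re_phase_gt0 d2 l1 M1 B0 gP ellP kP su).
- move=> a b aa bb; have [X XP] := phase_large d2 l1 M1 B0 gP ellP kP aa bb.
  exists X => u uab uX; have [wM hw] := XP u uab uX; split=> //.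
  by rewrite -hw; have [] := hP _ wM.
Qed.

(* The root of unity [omega] is 1 when d = 2 or when the sector meets the
   positive axis, and cannot be dropped in general: for p = X^3 + 3 X one has
   lambda = d = 3, f z = exp (z / 2) - exp (- z / 2), and in the left half
   plane the large term - exp (- z / 2) is not of the form exp (z * F) with
   F (log_3 z) invariant under z |-> 3 z; there omega = -1. *)
Theorem theorem2p1 (R : realType) :
  exists c : {poly R} -> nat -> R[i],
  forall (d : nat) (p : {poly R}) (lambda rho : R) (f : R[i] -> R[i])
         (alpha beta : R),
  p \is monic -> size p = d.+1 -> (2 <= d)%N ->
  p.[0] = 0 -> lambda = p^`().[0] -> 1 < lambda ->
  holomorphic_on setT f ->
  (forall z, f (lambda%:C * z) = ceval p (f z)) ->
  f 0 = 0 -> has_cderivative f 0 1 ->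
  rho = ln d%:R / ln lambda ->
  sector alpha beta `<=` escaping_set p ->
  exists (F : R[i] -> R[i]) (omega : R[i]),
    let S := strip (alpha / ln lambda) (beta / ln lambda) in
    let phi := sector_phase alpha beta lambda rho F in
    [/\ omega ^+ d.-1 = 1 /\
        ((exists2 x : R, 0 < x & sector alpha beta x%:C) -> omega = 1),
        (forall w, S w -> F (w + 1) = F w) /\ holomorphic_on S F,
        (forall z, sector alpha beta z -> 0 < complex.Re (phi z)),
        large_in_sector alpha beta (fun z =>
          has_csum
            (fun n => c p n * (omega ^- n * cexp (- (n%:R * phi z))))
            (f z - omega * cexp (phi z))) &
        forall g, boettcher d p g ->
          exists h, [/\ inverse_at_infty g h, laurent_at_infty (c p) h &
            large_in_sector alpha beta (fun z =>
              f z = h (omega * cexp (phi z)))]].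
Proof.
exists (@inv_boettcher_coef R) => d p lambda rho f alpha beta pm pd d2 p0 pl l1.
move=> fhol ff f0 /cderP df rhoE esc.
have Lam0 : 0 < ln lambda by exact: ln_gt0.
have fd z : exists l, cder f z l by apply/has_cder; exact: fhol.
(* For beta <= alpha the sector is empty and trivial choices do; only the claims on a Boettcher
   function and its inverse keep content. *)
have [ab|ba] := ltP alpha beta; last first.
  have nosec a b : alpha <= a -> b <= beta -> forall z, ~ sector a b z.
    by move=> aa bb z [r [th [_ /andP[t1 t2] _]]]; move: aa bb t1 t2 ba; lra.
  exists (fun=> 0), 1; split.
  - by split=> //; rewrite expr1n.
  - by split.
  - by move=> z /nosec[].
  - by move=> a b aa bb; exists 0 => z /nosec; case; exact: ltW.
  - move=> g /(boettcher_inverse pm pd d2)[gh hl]; exists (inv_boettcher p); split=> //.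
    by move=> a b aa bb; exists 0 => z /nosec; case; exact: ltW.
have [Phi [omega [w1 w2 w0 PhiP large]]] :=
  phase_exists pm pd d2 p0 pl l1 fd ff f0 df esc ab.
have dgt0 : 0 < d%:R :> R by rewrite ltr0n ltnW.
have d2' : (2 <= (size p).-1)%N by rewrite pd.
have width := escaping_sector_width d2' p0 pl l1 esc.
pose Lam : R[i] := (ln lambda)%:C.
have LamN0 : Lam != 0 by rewrite realC_eq0 gt_eqF.
pose F w := Phi (Lam * w) * cexp (- rho%:C * Lam * w).
have SP w : strip (alpha / ln lambda) (beta / ln lambda) w -> strip alpha beta (Lam * w).
  move=> /andP[h1 h2]; rewrite ltr_pdivrMr// in h1; rewrite ltr_pdivlMr// in h2.
  by rewrite /strip /= cImMr mulrC h1 h2.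
(* By [width], two logarithms with imaginary parts in ]alpha, beta[ differ by less than 2 pi there,
   so [xget] has only one choice. *)
have logE l : strip alpha beta l -> sector_log alpha beta (cexp l) = l.
  move=> sl; rewrite /sector_log; case: xgetP => [m _ [ml mab]|/(_ l)[]//].
  apply: cexp_inj_strip => //; move: sl mab => /andP[l3 l4] /andP[m3 m4].
  by rewrite ltr_norml; apply/andP; split; lra.
have phiE l : strip alpha beta l -> sector_phase alpha beta lambda rho F (cexp l) = Phi l.
  move=> sl; rewrite /sector_phase logE// /F -/Lam.
  have -> : Lam * (l / Lam) = l by rewrite mulrC divfK.
  have -> : - rho%:C * Lam * (l / Lam) = - (rho%:C * l) by field.
  by rewrite mulrCA -cexpD subrr cexp0 mulr1.
have strip_sub a b l : alpha < a -> b < beta -> a < complex.Im l < b -> strip alpha beta l.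
  move=> aa bb /andP[h1 h2]; rewrite /strip /=; apply/andP; split.
    exact: lt_trans h1.
  exact: lt_trans bb.
(* The modulus of [cexp u] is [expR (Re u)], so a threshold [X] on the real part becomes the
   threshold [expR X] on the modulus. *)
have reduce (P : R[i] -> Prop) : (forall a b, alpha < a -> b < beta -> exists X : R, forall u,
    a <= complex.Im u <= b -> X < complex.Re u -> P (cexp u)) -> large_in_sector alpha beta P.
  move=> H a b aa bb; have [X XP] := H a b aa bb; exists (expR X) => z /sectorP[u [<- /andP[u3 u4]]].
  by rewrite normc_cexp ltr_expR => uX; apply: XP => //; rewrite !ltW.
exists F, omega; split.
- by [].
- split=> [w /SP sw|w /SP sw].
    have [Phi1 _ _] := PhiP _ sw.
    rewrite /F mulrDr mulr1 Phi1 mulrDr mulr1 cexpD.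
    have -> : cexp (- rho%:C * Lam) = (d%:R)^-1.
      rewrite mulNr cexpN /Lam -realCM rhoE divfK ?gt_eqF// cexp_ln//.
      by rewrite realC_nat.
    have dne : d%:R != 0 :> R[i] by rewrite -realC_nat realC_eq0 gt_eqF.
    by move: (Phi _) (cexp _) => x y; field.
  have [_ [l dPhi] _] := PhiP _ sw.
  apply/has_cder; have dw := cderMl Lam (cder_id w).
  have dw' := cderMl (- rho%:C * Lam) (cder_id w).
  by eexists; exact: cderM (cder_comp dw dPhi) (cder_comp dw' (cder_cexp _)).
- by move=> z /sectorP[u [<- su]]; rewrite phiE//; have [_ _] := PhiP _ su.
- apply: reduce => a b aa bb; have [X XP] := large a b aa bb; exists X => u uab uX.
  have su : strip alpha beta u.
    by move: uab => /andP[h1 h2]; rewrite /strip /=; apply/andP; split; [exact: lt_le_trans h1|exact: le_lt_trans bb].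
  rewrite phiE//; have [h1 _] := XP u uab uX.
  under eq_fun do rewrite cexpN cexp_natl.
  move: h1; under eq_fun do rewrite exprMn invfM.
  by [].
- move=> g /(boettcher_inverse pm pd d2)[gh hl]; exists (inv_boettcher p); split=> //.
  apply: reduce => a b aa bb; have [X XP] := large a b aa bb; exists X => u uab uX.
  have su : strip alpha beta u.
    by move: uab => /andP[h1 h2]; rewrite /strip /=; apply/andP; split; [exact: lt_le_trans h1|exact: le_lt_trans bb].
  by rewrite phiE//; have [_ ->] := XP u uab uX.
Qed.
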